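(* (1) The map $\mu\mapsto W(\infty,\mu)$ induces a bijection between $\Lambda^+(r)$ and the set of isomorphism classes of irreducible weight ${\boldsymbol{\mathcal S}}(\infty,r)$-modules. (2) Every weight ${\boldsymbol{\mathcal S}}(\infty,r)$-module is completely reducible.
   Context: $v$ indeterminate. ${\bf\Omega}_\infty$ is the $\mathbb Q(v)$-space with basis $\{\omega_i\}_{i\in\mathbb Z}$. ${\boldsymbol{\mathcal H}}$ is the Hecke algebra of $\mathfrak S_r$ over $\mathbb Q(v)$ with basis $\{\mathcal T_w\}$: $\mathcal T_s\mathcal T_w=\mathcal T_{sw}$ if $\ell(sw)>\ell(w)$, $=(v-v^{-1})\mathcal T_w+\mathcal T_{sw}$ otherwise; $T_w=v^{\ell(w)}\mathcal T_w$. ${\boldsymbol{\mathcal H}}$ acts on the right of ${\bf\Omega}_\infty^{\otimes r}$ by $(\omega_{i_1}\cdots\omega_{i_r})\mathcal T_{(j,j+1)}=\omega_{i_1}\cdots\omega_{i_{j+1}}\omega_{i_j}\cdots\omega_{i_r}$ if $i_j<i_{j+1}$; $=v\,\omega_{i_1}\cdots\omega_{i_r}$ if $i_j=i_{j+1}$; $=(v-v^{-1})\omega_{i_1}\cdots\omega_{i_r}+\omega_{i_1}\cdots\omega_{i_{j+1}}\omega_{i_j}\cdots\omega_{i_r}$ if $i_j>i_{j+1}$. ${\boldsymbol{\mathcal S}}(\infty,r)=\operatorname{End}_{\boldsymbol{\mathcal H}}({\bf\Omega}_\infty^{\otimes r})$. $\Lambda(\infty,r)$: finitely supported $\lambda\in\mathbb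 N^{\mathbb Z}$ with $\sum\lambda_i=r$; $\Lambda^+(r)$: partitions of $r$ viewed in $\Lambda(\infty,r)$ ($\lambda_i=0$ for $i\le0$, $\lambda_1\ge\lambda_2\ge\cdots$). For $\lambda\in\Lambda(\infty,r)$, $\Omega_\lambda$ is the span of the $\omega_{i_1}\otimes\cdots\otimes\omega_{i_r}$ with $\#\{j:i_j=k\}=\lambda_k$ for all $k$; it is an ${\boldsymbol{\mathcal H}}$-submodule and ${\bf\Omega}_\infty^{\otimes r}=\bigoplus_\lambda\Omega_\lambda$. Let $\mathtt k_\lambda\in{\boldsymbol{\mathcal S}}(\infty,r)$ be the projection onto $\Omega_\lambda$ along $\bigoplus_{\nu\ne\lambda}\Omega_\nu$. An ${\boldsymbol{\mathcal S}}(\infty,r)$-module $M$ is a weight module if $M=\bigoplus_{\lambda\in\Lambda(\infty,r)}\mathtt k_\lambda M$. Weyl modules: $\omega_\lambda$ is the basis tensor in $\Omega_\lambda$ with weakly increasing indices; $\mathfrak S_\lambda$ the Young subgroup stabilizing consecutive blocks of $\{1,\dots,r\}$ of sizes $\lambda_i$ (increasing $i$); $x_\lambda=\sum_{w\in\mathfrak S_\lambda}T_w$; $\varpi_i=1$ for $1\le i\le r$ and $0$ otherwise; $\omega_\varpi=\omega_1\otimes\cdots\otimes\omega_r$ generates $\Omega_\varpi$ freely over ${\boldsymbol{\mathcal H}}$. $\lambda^t_i=\#\{j:\lambda_j\ge i\}$ for $i\ge1$, $0$ for $i\le0$; $w_\lambda$ the unique distinguished $(\mathfrak S_\lambda,\mathfrak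 S_{\lambda^t})$-double coset representative with $w_\lambda^{-1}\mathfrak S_\lambda w_\lambda\cap\mathfrak S_{\lambda^t}=\{1\}$; $y_{\lambda^t}=\sum_{w\in\mathfrak S_{\lambda^t}}(-v^2)^{-\ell(w)}T_w$. $z_\mu\in{\boldsymbol{\mathcal S}}(\infty,r)$ vanishes on $\Omega_\nu$ for $\nu\ne\varpi$ and $z_\mu(\omega_\varpi h)=\omega_\mu T_{w_\mu}y_{\mu^t}h$. $W(\infty,\mu)={\boldsymbol{\mathcal S}}(\infty,r)z_\mu$. *)

(* Defs.v *)
From HB Require Import structures.
From mathcomp Require Import all_boot all_order all_algebra all_fingroup.
From mathcomp Require Import fraction.
From mathcomp Require Import boolp classical_sets functions cardinality fsbigop.
From Stdlib Require List.

Set Implicit Arguments.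
Unset Strict Implicit.
Unset Printing Implicit Defensive.
Import Order.TTheory GRing.Theory.
Local Open Scope ring_scope.

Definition K : fieldType := {fraction {poly rat}}.
Definition v : K := FracField.tofrac ('X : {poly rat}).

(* Basis of Omega_infty^{(x) r}: omega_{i_1} ... omega_{i_r}, i : 'I_r -> Z.  *)
Definition Idx (r : nat) := {ffun 'I_r -> int}.

(* Vectors of Omega_infty^{(x) r}: coefficient functions (finitely supported *)
(* when they come from actual vectors).                                      *)
Definition Vec (r : nat) := Idx r -> K.

(* A linear endomorphism f of Omega_infty^{(x)r} is recorded by its matrix  *)
(* F : Idx r -> Idx r -> K with  f(e_i) = \sum_k F i k e_k  (row i finitely *)
(* supported).  Right actions (Hecke algebra) are recorded the same way:    *)
(* e_i . h = \sum_k H i k e_k.                                              *)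
Notation Mat r := (Idx r -> Idx r -> K).

Definition vecmat r (x : Vec r) (F : Mat r) : Vec r :=
  fun k => \sum_(i \in [set: Idx r]) x i * F i k.

(* matrix product A.B (i.e. "first A then B" for right actions,             *)
(* and the matrix of  b o a  for left maps a, b).                           *)
Definition mulR r (A B : Mat r) : Mat r := fun i => vecmat (A i) B.

Definition comp r (F G : Mat r) : Mat r := mulR G F.

Definition idM r : Mat r := fun i k => (i == k)%:R.
Definition addM r (F G : Mat r) : Mat r := fun i k => F i k + G i k.

(* row-finiteness: F is the matrix of a linear map on the direct sum       *)
Definition rowfin r (F : Mat r) := forall i, finite_set [set k | F i k != 0].

Definition adjT r (a : 'I_r) : {perm 'I_r} :=
  if [pick b : 'I_r | val b == a.+1] is Some b then tperm a b else 1%g.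

(* Matrix of the right action of the generator  \mathcal T_{(a,a+1)} on     *)
(* Omega_infty^{(x) r}, as in the paper.                                    *)
Definition Hgen r (a : 'I_r) : Mat r := fun i k =>
  let b := adjT a a in
  let si : Idx r := [ffun p => i (adjT a p)] in
  if (i a < i b)%R then (k == si)%:R
  else if i a == i b then v * (k == i)%:R
  else (v - v^-1) * (k == i)%:R + (k == si)%:R.

Definition is_gen r (a : 'I_r) : bool := (a.+1 < r)%N.

(* Permutations are composed in the usual way  (x y)(p) = x (y p); in       *)
(* mathcomp's {perm} product  (y * x)%g  is this composite  x o y.          *)

Fixpoint wordperm r (ws : seq 'I_r) : {perm 'I_r} :=
  if ws is a :: ws' then (wordperm ws' * adjT a)%g else 1%g.

(* Coxeter length = number of inversions                                    *)
Definition len r (w : {perm 'I_r}) : nat :=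
  #|[set pq : 'I_r * 'I_r | (pq.1 < pq.2)%N && (w pq.2 < w pq.1)%N]|.

(* a reduced word for w (one exists; any choice gives the same \mathcal T_w) *)
Definition redw r (w : {perm 'I_r}) : seq 'I_r :=
  if [pick t : (len w).-tuple 'I_r | all (@is_gen r) t && (wordperm t == w)]
    is Some t then val t else [::].

Fixpoint wordmat r (ws : seq 'I_r) : Mat r :=
  if ws is a :: ws' then mulR (Hgen a) (wordmat ws') else @idM r.

Definition calT r (w : {perm 'I_r}) : Mat r := wordmat (redw w).
Definition Tw r (w : {perm 'I_r}) : Mat r := fun i k => v ^+ len w * calT w i k.

(* The Schur algebra S(infty, r) = End_H(Omega_infty^{(x) r}):              *)
(* linear maps commuting with the right action of H, i.e. with the action   *)
(* of its generators \mathcal T_{(a,a+1)}.                                  *)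
Definition inS r (F : Mat r) : Prop :=
  rowfin F /\ forall a : 'I_r, is_gen a -> mulR (Hgen a) F = mulR F (Hgen a).

Definition is_weight (r : nat) (lam : int -> nat) : Prop :=
  exists s : seq int, [/\ uniq s, (forall k, lam k != 0%N -> k \in s)
                        & (\sum_(k <- s) lam k)%N = r].

Definition is_partition (r : nat) (lam : int -> nat) : Prop :=
  [/\ is_weight r lam, (forall k : int, (k <= 0)%R -> lam k = 0%N)
    & (forall k : int, (1 <= k)%R -> (lam (k + 1)%R <= lam k)%N)].

Definition content r (i : Idx r) : int -> nat := fun k => #|[set p | i p == k]|.

Definition kproj r (lam : int -> nat) : Mat r := fun i k =>
  if pselect (content i = lam) is left _ then (i == k)%:R else 0.

Definition varpi (r : nat) : int -> nat := fun k => ((1 <= k) && (k <= r%:Z))%R : nat.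

Definition psum (lam : int -> nat) (n : nat) : nat := (\sum_(1 <= j < n.+1) lam j%:Z)%N.

(* omega_lambda for a partition lambda of r: the weakly increasing basis    *)
(* tensor (1^{lambda_1} 2^{lambda_2} ...); position p (0-based) carries the *)
(* index 1 + #{n in [1,r] | lambda_1+...+lambda_n <= p}.                     *)
Definition omega (r : nat) (lam : int -> nat) : Idx r :=
  [ffun p : 'I_r => (1 + \sum_(1 <= n < r.+1) (psum lam n <= p)%N)%N%:Z].

Definition young r (lam : int -> nat) : {set {perm 'I_r}} :=
  [set w : {perm 'I_r} | [forall p, omega r lam (w p) == omega r lam p]].

(* conjugate partition (for a partition of r, only j in [1,r] can have     *)
(* lambda_j >= i >= 1)                                                      *)
Definition conjp (r : nat) (lam : int -> nat) : int -> nat := fun i =>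
  if (1 <= i)%R then (\sum_(1 <= j < r.+1) (i <= (lam j%:Z)%:Z)%R)%N else 0%N.

(* w_lambda: distinguished (S_lambda, S_{lambda^t}) double coset           *)
(* representative with  w^{-1} S_lambda w  \cap S_{lambda^t} = 1           *)
Definition wlam r (lam : int -> nat) : {perm 'I_r} :=
  odflt 1%g [pick w : {perm 'I_r} |
     [forall a in young r lam, forall b in young r (conjp r lam),
         (len w <= len (b * w * a)%g)%N]
  && [forall a in young r lam,
         ((w * a * w^-1)%g \in young r (conjp r lam)) ==> (a == 1%g)]].

Definition ymat r (lam : int -> nat) : Mat r := fun i k =>
  \sum_(w in young r (conjp r lam)) (- v ^+ 2) ^- len w * Tw w i k.

Definition zvec r (mu : int -> nat) : Vec r :=
  mulR (Tw (wlam r mu)) (@ymat r mu) (omega r mu).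

Definition is_z r (mu : int -> nat) (Z : Mat r) : Prop :=
  [/\ inS Z,
      (forall i, content i <> varpi r -> forall k, Z i k = 0)
    & (* z(omega_varpi h) = omega_mu T_{w_mu} y_{mu^t} h for all h in H,
         i.e. for h running over the basis \mathcal T_w of H *)
      forall w : {perm 'I_r},
        vecmat (calT w (omega r (varpi r))) Z = vecmat (@zvec r mu) (calT w)].

Definition MatZ (r : nat) : zmodType := (Idx r -> Idx r -> K : zmodType).
Definition regact r (F : Mat r) (X : MatZ r) : MatZ r := comp F X.

Definition Weyl r (mu : int -> nat) : MatZ r -> Prop := fun X =>
  exists G Z, [/\ inS G, is_z mu Z & X = comp G Z].

(* Modules over S(infty,r).  A module is an abelian group M with an action  *)
(* act : Mat r -> M -> M (only its values on S(infty,r) matter).            *)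
Section Modules.
Variable r : nat.
Variable M : zmodType.
Variable act : Mat r -> M -> M.

Definition Smodule : Prop :=
  [/\ forall F G m, inS F -> inS G -> act (addM F G) m = act F m + act G m,
      forall F m n, inS F -> act F (m + n) = act F m + act F n,
      forall F G m, inS F -> inS G -> act (comp F G) m = act F (act G m)
    & forall m, act (@idM r) m = m].

Definition submod (N : M -> Prop) : Prop :=
  [/\ N 0, forall a b, N a -> N b -> N (a + b)
    & forall F m, inS F -> N m -> N (act F m)].

Definition irred (N : M -> Prop) : Prop :=
  [/\ submod N, exists m, N m /\ m <> 0
    & forall P, submod P -> (forall m, P m -> N m) ->
         (forall m, P m -> m = 0) \/ (forall m, N m -> P m)].

Definition dsum (J : Type) (Nf : J -> M -> Prop) (N : M -> Prop) : Prop :=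
  (forall m, N m -> exists (s : seq J) (c : J -> M),
       [/\ List.NoDup s, forall j, List.In j s -> Nf j (c j)
         & m = \sum_(j <- s) c j])
  /\ (forall (s : seq J) (c : J -> M), List.NoDup s ->
        (forall j, List.In j s -> Nf j (c j)) -> \sum_(j <- s) c j = 0 ->
        forall j, List.In j s -> c j = 0).

Definition weightmod (N : M -> Prop) : Prop :=
  dsum (fun (lam : int -> nat) m =>
          is_weight r lam /\ exists n, N n /\ m = act (@kproj r lam) n) N.

Definition compred (N : M -> Prop) : Prop :=
  exists (J : Type) (Nf : J -> M -> Prop),
    (forall j, irred (Nf j)) /\ dsum Nf N.
End Modules.

Definition iso r (M1 M2 : zmodType) (act1 : Mat r -> M1 -> M1) (N1 : M1 -> Prop)
    (act2 : Mat r -> M2 -> M2) (N2 : M2 -> Prop) : Prop :=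
  exists phi : M1 -> M2,
    [/\ forall a b, N1 a -> N1 b -> phi (a + b) = phi a + phi b,
        forall m, N1 m -> N2 (phi m),
        forall m m', N1 m -> N1 m' -> phi m = phi m' -> m = m',
        forall n, N2 n -> exists m, N1 m /\ phi m = n
      & forall F m, inS F -> N1 m -> phi (act1 F m) = act2 F (phi m)].

(* Main.v *)
Require Import Defs.
From HB Require Import structures.
From mathcomp Require Import all_boot all_order all_algebra all_fingroup.
From mathcomp Require Import fraction generic_quotient zify ring lra.
From mathcomp Require Import boolp classical_sets functions cardinality fsbigop.
From Stdlib Require List FinFun.

(* Let [e] be the projection onto the weight space [varpi]; then [e S e] is the Hecke algebra in
   its left regular representation. The transpose of a matrix of [S] is again in [S], and sums of
   squares in Q(v) are anisotropic, so [p p^T p <> 0] for every nonzero [p] in [S e].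

   As [x_mu H y_(mu^t)] is one-dimensional, [z S z] consists of multiples of [z] for [z = z_mu].
   Hence for a nonzero [p] in [S z] the product [z p^T p] is a nonzero multiple of [z], and [S z] is
   irreducible. If [z_nu S z_mu <> 0] then [mu] and [nu] are comparable for dominance, so that
   distinct partitions give non-isomorphic modules.

   The idempotent [e] lies in the ideal generated by the [z_mu]. Otherwise some nonzero vector of
   the regular representation is killed by [S z_mu S] for all [mu]. The submodule it generates
   contains an eigenvector of the Jucys-Murphy elements; its sequence of contents can be rearranged
   to the row reading of a partition [mu], and, with [v] replaced by [-v^-1], to that of [mu^t]. So
   there are a vector on which the row subgroup acts by [v] and one on which the column subgroup
   acts by [-v^-1], the second in the submodule generated by the first: an element of [S z_mu S]
   sends the former to the column antisymmetrization of the latter, a contradiction.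

   Every [k_lambda] factors through [e]. Therefore a weight module is the sum of the images of the
   maps [S z_mu -> M], each irreducible or zero, and Zorn's lemma extracts a direct sum. *)

Set Implicit Arguments.
Unset Strict Implicit.
Unset Printing Implicit Defensive.
Import Order.TTheory GRing.Theory.

(** * Content sequences of standard tableaux *)

Section ContentSequences.
Import Num.Theory.
Local Open Scope ring_scope.

Fixpoint run (a : int) (m : nat) : seq int :=
  if m is m'.+1 then a :: run (a + 1) m' else [::].

Fixpoint reading (a : int) (rows : seq nat) : seq int :=
  if rows is m :: rows' then run a m ++ reading (a - 1) rows' else [::].

Lemma size_run a m : size (run a m) = m.
Proof. by elim: m a => //= m IH a; rewrite IH. Qed.

Lemma nth_run a m j : (j < m)%N -> nth 0 (run a m) j = a + j%:Z.
Proof. by elim: m a j => //= m IH a [|j] h /=; [lia | rewrite IH //; lia]. Qed.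

Lemma mem_run a m x : (x \in run a m) = (a <= x) && (x < a + m%:Z).
Proof.
by elim: m a => [|m IH] a; rewrite ?in_nil ?inE ?IH /=; lia.
Qed.

Lemma run_rcons a m : run a m.+1 = rcons (run a m) (a + m%:Z).
Proof.
elim: m a => [|m IH] a; first by rewrite /= addr0.
by rewrite -[RHS]/(a :: rcons (run (a + 1) m) _) [LHS]/= -/(run (a+1) m.+1) IH; congr (_ :: rcons _ _); lia.
Qed.

Lemma run_split a m x : x \in run a m ->
  exists s m1, run a m = s ++ x :: run (x + 1) m1 /\ x + 1 + m1%:Z = a + m%:Z.
Proof.
elim: m a => //= m IH a; rewrite inE => /orP[/eqP ->|/IH[s [m1 [-> h]]]].
  by exists [::], m; split; [|lia].
by exists (a :: s), m1; split; [|lia].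
Qed.

Lemma size_reading a rows : size (reading a rows) = sumn rows.
Proof. by elim: rows a => //= m rows IH a; rewrite size_cat size_run IH. Qed.

Lemma reading_cat a rows1 rows2 :
  reading a (rows1 ++ rows2) = reading a rows1 ++ reading (a - (size rows1)%:Z) rows2.
Proof.
elim: rows1 a => [|m rows1 IH] a /=; first by rewrite subr0.
by rewrite IH catA; congr (_ ++ reading _ _); lia.
Qed.

Lemma reading_ge a rows x : x \in reading a rows -> a - (size rows)%:Z < x.
Proof.
elim: rows a => //= m rows IH a; rewrite mem_cat mem_run.
by case/orP=> [|/IH]; lia.
Qed.

Lemma nth_reading a rows i j : (j < nth 0%N rows i)%N ->
  nth 0 (reading a rows) (sumn (take i rows) + j) = a - i%:Z + j%:Z.
Proof.
elim: rows a i => [|m rows IH] a [|i] //= h; rewrite nth_cat size_run.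
  by rewrite add0n h nth_run //; lia.
by rewrite ifF; [rewrite -addnA addKn IH //; lia|lia].
Qed.

Fixpoint ascents (s : seq int) : nat :=
  if s is x :: s' then (count (fun y => (x < y)%R) s' + ascents s')%N else 0%N.

Lemma ascents_swap s1 (a b : int) s2 : a < b ->
  (ascents (s1 ++ b :: a :: s2) < ascents (s1 ++ a :: b :: s2))%N.
Proof.
move=> ab; elim: s1 => [|x s1 IH] /=; first by rewrite ab ltNge (ltW ab) /= add0n add1n ltnS addnCA.
have -> : count (fun y => x < y) (s1 ++ b :: a :: s2) =
  count (fun y => x < y) (s1 ++ a :: b :: s2).
  rewrite !count_cat /=. congr addn; exact: addnCA.
by rewrite ltn_add2l.
Qed.

Variable C : seq int -> Prop.
Hypothesis C_head : forall x s, C (x :: s) -> x = 0.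
Hypothesis C_neq : forall s1 a b s2, C (s1 ++ a :: b :: s2) -> a <> b.
Hypothesis C_braid : forall s1 a b s2, C (s1 ++ a :: b :: a :: s2) ->
  b <> a + 1 /\ b <> a - 1.
Hypothesis C_swap : forall s1 a b s2, C (s1 ++ a :: b :: s2) ->
  a <> b -> b <> a + 1 -> b <> a - 1 -> C (s1 ++ b :: a :: s2).

Lemma C_move_left s1 s x s2 : C (s1 ++ s ++ x :: s2) ->
  (forall y, y \in s -> x + 1 < y \/ y < x - 1) -> C (s1 ++ x :: s ++ s2).
Proof.
elim/last_ind: s s2 => [|s y IH] s2 //= h hy.
rewrite cat_rcons; apply: IH => [|z zs]; last by apply: hy; rewrite mem_rcons inE zs orbT.
rewrite cat_rcons catA in h; rewrite catA.
by apply: C_swap h _ _ _; have := hy y; rewrite mem_rcons inE eqxx; lia.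
Qed.

Lemma C_move_right s1 s x s2 : C (s1 ++ x :: s ++ s2) ->
  (forall y, y \in s -> x + 1 < y \/ y < x - 1) -> C (s1 ++ s ++ x :: s2).
Proof.
elim: s s1 => [|y s IH] s1 //= h hy.
rewrite -cat_rcons; apply: IH => [|z zs]; last by apply: hy; rewrite inE zs orbT.
rewrite cat_rcons.
by apply: C_swap h _ _ _; have := hy y; rewrite inE eqxx; lia.
Qed.

Lemma minimal_ascents c0 : C c0 -> exists c, [/\ C c, perm_eq c c0 &
  forall s1 a b s2, c = s1 ++ a :: b :: s2 -> b <= a + 1].
Proof.
have [n] := ubnP (ascents c0); elim: n c0 => // n IH c0 h Cc0.
case: (pselect (exists s1 a b s2, c0 = s1 ++ a :: b :: s2 /\ a + 1 < b)).
  move=> [s1 [a [b [s2 [e ab]]]]].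
  have Cc : C (s1 ++ b :: a :: s2) by rewrite e in Cc0; apply: C_swap Cc0 _ _ _; lia.
  case: (IH _ _ Cc) => [|c [h1 h2 h3]].
    by rewrite ltnS in h; apply: leq_trans h; rewrite e; apply: ascents_swap; lia.
  exists c; split=> //; apply: perm_trans h2 _; rewrite e perm_cat2l.
  by rewrite -[b :: _]/([:: b] ++ [:: a] ++ s2) perm_catCA.
move=> hn; exists c0; split=> // s1 a b s2 e; rewrite leNgt; apply/negP => ab.
by apply: hn; exists s1, a, b, s2.
Qed.

Definition decreasing_rows rows := sorted geq rows && all (leq 1) rows.

(* While the reading order is scanned, the next content either prolongs the last row or
   opens a new one; every illegal move is excluded by sliding it to a forbidden pattern
   [a, a +- 1, a], or to the front. *)
Lemma prefix_reading c : C c ->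
  (forall s1 a b s2, c = s1 ++ a :: b :: s2 -> b <= a + 1) ->
  forall s1 s2, c = s1 ++ s2 -> exists rows, s1 = reading 0 rows /\ decreasing_rows rows.
Proof.
move=> Cc asc; elim/last_ind => [|s1 b IH] s2 e; first by exists [::].
rewrite cat_rcons in e; have [rows [e1 hr]] := IH _ e.
case/lastP: rows e1 hr => [|rows m] e1 hr.
  rewrite e1 /= in e; rewrite e in Cc; rewrite e1 (C_head Cc).
  by exists [:: 1%N].
move: hr; rewrite /decreasing_rows -cats1 all_cat /= andbT => /andP[hs /andP[hr hm]].
case: m hm hs e1 => // m _ hs.
set st : int := - (size rows)%:Z.
rewrite -cats1 reading_cat /= cats0 sub0r -/st => e1.
rewrite -[_ :: run _ _]/(run st m.+1) in e1.
have hb : b <= st + m%:Z + 1.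
  apply: (asc (reading 0 rows ++ run st m) _ b s2).
  by rewrite e e1 run_rcons -cats1 -!catA.
have [eb|nb] := eqVneq b (st + m%:Z + 1).
  exists (rcons rows m.+2); split.
    rewrite -[rcons rows _]cats1 reading_cat /= cats0 sub0r -/st e1 -cats1 -catA; congr (_ ++ _).
    rewrite cats1 -[RHS]/(run st m.+2) [in RHS]run_rcons; congr (rcons _ _).
    by rewrite eb; lia.
  rewrite /decreasing_rows -[rcons rows _]cats1 all_cat hr /= andbT.
  case/lastP: rows hs hr @st e1 hb eb => [//|rows m'] hs hr st e1 hb eb.
  have hs' x : sorted geq (rcons rows m' ++ [:: x]) = sorted geq (rcons rows m') && (x <= m')%N.
    by rewrite cat_rcons sorted_cat_cons /= andbT.
  rewrite cats1 -cats1 !hs' in hs *; case/andP: hs => -> /=.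
  rewrite leq_eqVlt => /orP[/eqP em|//]; exfalso.
  rewrite -cats1 reading_cat /= cats0 sub0r -em in e1.
  have ea : - (size rows)%:Z = st + 1 by rewrite /st size_rcons; lia.
  have eb' : st + 1 + m%:Z = b by lia.
  have eb2 : st + m%:Z = b - 1 by lia.
  rewrite ea -[st :: _]/(run st m.+1) !run_rcons eb' eb2 in e1.
  rewrite e e1 -!cats1 -!catA /= catA in Cc.
  have [|_] := @C_braid ((reading 0 rows ++ run (st + 1) m) ++ run st m) b (b - 1) s2; last by lia.
  rewrite -catA; apply: C_move_right Cc _ => y; rewrite mem_run; lia.
have e1' : s1 = (reading 0 rows ++ run st m) ++ [:: st + m%:Z] by rewrite e1 run_rcons -cats1 catA.
have blt : b < st + m%:Z.
  suff : b <> st + m%:Z by lia.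
  by move=> eb; move: Cc; rewrite e e1' -[_ ++ b :: _]catA /= => /C_neq; rewrite eb.
have [bst|bst] := leP st b.
  have bm : b \in run st m.+1 by rewrite mem_run; lia.
  have [s [[|m1] [es hm1]]] := run_split bm; first by lia.
  exfalso; rewrite e e1 es -!catA /= in Cc.
  rewrite -[_ ++ _]/(reading 0 rows ++ s ++ b :: (b + 1) :: run (b + 1 + 1) m1 ++ b :: s2) in Cc.
  have [|] := @C_braid (reading 0 rows ++ s) b (b + 1) (run (b + 1 + 1) m1 ++ s2); last by lia.
  rewrite -catA -[b :: _]/([:: b; b + 1] ++ b :: run (b + 1 + 1) m1 ++ s2) !catA.
  by apply: C_move_left => [|y]; [rewrite -!catA | rewrite mem_run; lia].
have [eb|nb2] := eqVneq b (st - 1).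
  exists (rcons (rcons rows m.+1) 1%N); split.
    rewrite -!cats1 !reading_cat /= !cats0 size_cat /= sub0r -/st -[st :: _]/(run st m.+1) -e1 eb.
    by congr (_ ++ [:: _]); rewrite /st; lia.
  rewrite /decreasing_rows -!cats1 !all_cat hr /= andbT -catA /= sorted_cat_cons /= andbT.
  by rewrite cats1 in hs *; rewrite hs.
have Cb : C ([::] ++ b :: s1 ++ s2).
  apply: C_move_left => [|y]; first by rewrite -e.
  rewrite e1 mem_cat mem_run => /orP[/reading_ge|]; last lia.
  by rewrite sub0r -/st; lia.
by have := C_head Cb; rewrite /st in bst *; lia.
Qed.

Lemma exists_reading c0 : C c0 ->
  exists rows, [/\ C (reading 0 rows), perm_eq (reading 0 rows) c0 & decreasing_rows rows].
Proof.
move=> /minimal_ascents[c [Cc pc hc]].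
have [|rows [e hr]] := @prefix_reading c Cc hc c [::]; first by rewrite cats0.
by exists rows; rewrite -e.
Qed.

End ContentSequences.

Section Conjugation.
Import Num.Theory.

Lemma sum_initial_segment (p : nat -> bool) n i :
  (forall i j, (i <= j)%N -> p j -> p i) -> (forall j, p j -> (j < n)%N) ->
  (i < \sum_(0 <= j < n) p j)%N = p i.
Proof.
move=> dc; elim: n p dc i => [|n IH] p dc i hn.
  by rewrite big_geq //; apply/esym/negbTE/negP => /hn.
rewrite big_nat_recl //; case p0 : (p 0%N); last first.
  rewrite big1 => [|j _]; first by apply/esym/negbTE/negP => /(dc 0%N) => /(_ isT); rewrite p0.
  by apply/eqP; rewrite eqb0; apply/negP => /(dc 0%N) => /(_ isT); rewrite p0.
case: i => [|i]; first by rewrite p0.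
rewrite add1n ltnS (IH (fun j => p j.+1)) // => [a b ab|j /hn //].
exact: dc.
Qed.

Lemma count_run a m x : count_mem x (run a m) = ((a <= x)%R && (x < a + m%:Z)%R) :> nat.
Proof.
have u : uniq (run a m).
  elim: m a => //= m IH a; rewrite IH mem_run andbT; lia.
by rewrite count_uniq_mem // mem_run.
Qed.

Lemma count_reading a rows x : count_mem x (reading a rows) =
  (\sum_(0 <= i < size rows) ((a - i%:Z <= x)%R && (x < a - i%:Z + (nth 0%N rows i)%:Z)%R))%N.
Proof.
elim: rows a => [|m rows IH] a /=; first by rewrite big_geq.
rewrite count_cat big_nat_recl // count_run IH subr0; congr addn.
by apply: eq_bigr => i _ /=; congr (nat_of_bool (_ && _)); lia.
Qed.

Variable rows : seq nat.
Hypothesis dec_rows : decreasing_rows rows.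

Lemma decreasing_rows_nth i j : (i <= j)%N -> (nth 0%N rows j <= nth 0%N rows i)%N.
Proof.
move=> ij; case/andP: dec_rows => hs _.
have [hj|hj] := ltnP j (size rows); last by rewrite (nth_default _ hj).
have tr : transitive geq by move=> x y z /=; lia.
have rf : reflexive geq by move=> x /=; exact: leqnn.
by apply: (sorted_leq_nth tr rf 0%N hs); rewrite ?unfold_in //=; lia.
Qed.

Lemma nth_rows_size i k : (k < nth 0%N rows i)%N -> (i < size rows)%N.
Proof. by rewrite ltnNge => h; rewrite ltnNge; apply: contra h => /(nth_default 0%N) ->. Qed.

Lemma count_reading_ge0 k i :
  (i < count_mem (k%:Z)%R (reading 0 rows))%N = (k + i < nth 0%N rows i)%N.
Proof.
rewrite count_reading -(@sum_initial_segment (fun i => k + i < nth 0%N rows i)%N (size rows) i).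
- by congr (_ < _)%N; apply: eq_bigr => j _; congr nat_of_bool; lia.
- by move=> a b ab; have := decreasing_rows_nth ab; lia.
- by move=> j h; apply: (@nth_rows_size j k); apply: leq_trans h; rewrite ltnS leq_addr.
Qed.

Lemma count_reading_le0 k i :
  (i < count_mem (- k%:Z)%R (reading 0 rows))%N = (i < nth 0%N rows (i + k))%N.
Proof.
rewrite count_reading.
have -> : (\sum_(0 <= j < size rows) ((0 - j%:Z <= - k%:Z)%R && (- k%:Z < 0 - j%:Z + (nth 0%N rows j)%:Z)%R) =
  \sum_(0 <= j < size rows) (j < nth 0%N rows (j + k)))%N.
  have [hk|hk] := leqP k (size rows); last first.
    rewrite !big_nat !big1 // => j hj.
      by rewrite nth_default; lia.
    by apply/eqP; rewrite eqb0; lia.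
  rewrite [LHS](@big_cat_nat _ _ _ k) //= [X in (X + _)%N]big_nat [X in (X + _)%N]big1 ?add0n => [|j hj]; last by apply/eqP; rewrite eqb0; lia.
  rewrite -{1}(add0n k) big_addn.
  rewrite [RHS](@big_cat_nat _ _ _ (size rows - k)) //=; last by rewrite leq_subr.
  rewrite [X in (_ + X)%N]big_nat [X in (_ + X)%N]big1 ?addn0 => [|j hj]; last first.
    by rewrite nth_default; lia.
  by apply: eq_bigr => j _; congr nat_of_bool; lia.
rewrite (@sum_initial_segment (fun j => j < nth 0%N rows (j + k))%N (size rows) i) //.
- move=> a b ab; have := @decreasing_rows_nth (a + k)%N (b + k)%N; lia.
- move=> j h; have := nth_rows_size h; lia.
Qed.

End Conjugation.

(* A Young diagram meets each diagonal in an initial segment, so it is determined by its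
   multiset of contents. *)
Lemma reading_opp_conjugate rows rows' i j :
  decreasing_rows rows -> decreasing_rows rows' ->
  perm_eq (reading 0 rows') [seq (- x)%R | x <- reading 0 rows] ->
  (j < nth 0%N rows i)%N = (i < nth 0%N rows' j)%N.
Proof.
move=> d d' /seq.permP pm.
have cm x : count_mem x (reading 0 rows') = count_mem (- x)%R (reading 0 rows).
  by rewrite pm count_map; apply: eq_count => y /=; rewrite eqr_oppLR.
have [ij|ij] := leqP i j.
  have := cm (- (j - i)%N%:Z)%R; rewrite opprK => e.
  have h := count_reading_ge0 d (j - i) i; have h' := count_reading_le0 d' (j - i) i.
  by rewrite e in h'; rewrite subnK // in h; rewrite subnKC // in h'; rewrite -h -h'.
have e := cm ((i - j)%N%:Z)%R; have ji := ltnW ij.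
have h := count_reading_le0 d (i - j) j; have h' := count_reading_ge0 d' (i - j) j.
by rewrite e in h'; rewrite subnKC // in h; rewrite subnK // in h'; rewrite -h -h'.
Qed.

(** * Partitions *)

Section Partitions.
Local Open Scope nat_scope.

Definition part (l : nat -> nat) : int -> nat := fun k => if k is Posz n.+1 then l n else 0.

Definition partn (r : nat) (l : nat -> nat) :=
  [/\ forall n, l n.+1 <= l n, forall n, r <= n -> l n = 0 & \sum_(0 <= j < r) l j = r].

Lemma eq_from_lt m n : (forall j, (j < m) = (j < n)) -> m = n.
Proof. by move=> h; case: (ltngtP m n) => // lt; have := h m; have := h n; rewrite !ltnn lt. Qed.

Section PartialSums.
Variables (r : nat) (l : nat -> nat).

(* When the positions [0, .., r-1] fill the diagram of [l] row by row, [bl p] and [off p] are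
   the row and the column of position [p]. *)
Definition ps n := \sum_(0 <= j < n) l j.
Definition bl p := \sum_(0 <= n < r) (ps n.+1 <= p).
Definition off p := p - ps (bl p).

Lemma psS n : ps n.+1 = ps n + l n. Proof. exact: big_nat_recr. Qed.
Lemma ps0 : ps 0 = 0. Proof. exact: big_geq. Qed.
Lemma ps_mono m n : m <= n -> ps m <= ps n.
Proof. by move=> mn; rewrite /ps (@big_cat_nat _ _ _ m 0 n) //= leq_addr. Qed.

Hypothesis pl : partn r l.

Lemma partn_mono m n : m <= n -> l n <= l m.
Proof.
case: pl => h _ _; elim: n => [|n IH]; first by rewrite leqn0 => /eqP ->.
by rewrite leq_eqVlt => /orP[/eqP -> //|/IH]; apply: leq_trans.
Qed.

Lemma ps_r : ps r = r. Proof. by case: pl. Qed.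

Lemma lt_bl p i : p < r -> (i < bl p) = (ps i.+1 <= p).
Proof.
move=> pr; apply: (@sum_initial_segment (fun n => ps n.+1 <= p)) => [m n mn|j h].
  by apply: leq_trans; exact: ps_mono.
rewrite ltnNge; apply/negP => rj; have := ps_mono (leqW rj); rewrite ps_r; lia.
Qed.

Lemma bl_bounds p : p < r -> ps (bl p) <= p < ps (bl p).+1.
Proof.
move=> pr; rewrite (ltnNge p) -(lt_bl _ pr) ltnn andbT.
case e : (bl p) => [|b]; first by rewrite ps0.
by rewrite -(lt_bl _ pr) e.
Qed.

Lemma bl_uniq p i : p < r -> ps i <= p < ps i.+1 -> bl p = i.
Proof.
move=> pr /andP[h1 h2]; apply/eqP; rewrite eqn_leq; apply/andP; split.
  by rewrite leqNgt (lt_bl _ pr) -ltnNge.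
by case: i h1 {h2} => // i h1; rewrite (lt_bl _ pr).
Qed.

Lemma bl_mono p q : p <= q -> bl p <= bl q.
Proof. by move=> pq; apply: leq_sum => n _; case: (leqP (ps n.+1) p) => // h; rewrite (leq_trans h). Qed.

Lemma off_lt p : p < r -> off p < l (bl p).
Proof. by move=> /bl_bounds; rewrite psS /off; lia. Qed.

Lemma bl_off p : p < r -> p = ps (bl p) + off p.
Proof. by move=> /bl_bounds; rewrite /off; lia. Qed.

Lemma off_succ p : p.+1 < r -> bl p.+1 = bl p -> off p.+1 = (off p).+1.
Proof. by move=> h e; rewrite /off e; have := bl_bounds (ltnW h); lia. Qed.

Lemma off_pred p : p < r -> 0 < off p -> bl p.-1 = bl p /\ off p = (off p.-1).+1.
Proof.
move=> pr o0; have h := bl_bounds pr; have pr' : p.-1 < r by lia.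
have e : bl p.-1 = bl p by apply: bl_uniq => //; move: o0; rewrite /off; lia.
by split=> //; move: o0; rewrite /off e; lia.
Qed.

Lemma sum_bl_off (F : nat -> nat -> nat) :
  \sum_(p < r) F (bl p) (off p) = \sum_(0 <= i < r) \sum_(0 <= j < l i) F i j.
Proof.
pose G p := F (bl p) (off p).
suff h n : n <= r -> \sum_(0 <= p < ps n) G p = \sum_(0 <= i < n) \sum_(0 <= j < l i) F i j.
  by rewrite -h // ps_r big_mkord.
elim: n => [|n IH] nr; first by rewrite ps0 !big_geq.
have le : ps n <= ps n.+1 by exact: ps_mono.
rewrite (@big_cat_nat _ _ _ (ps n)) //= IH 1?ltnW // big_nat_recr //=; congr addn.
rewrite -{1}(add0n (ps n)) big_addn psS addKn !big_nat; apply: eq_bigr => j /andP[_ jl].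
have jr : j + ps n < r by have := ps_mono nr; rewrite psS ps_r; lia.
have e : bl (j + ps n) = n by apply: bl_uniq => //; rewrite psS; lia.
by rewrite /G /off e; congr (F _ _); lia.
Qed.

Lemma sum_pred1 n m t : \sum_(0 <= j < n) ((j == t) * m) = (t < n) * m.
Proof.
elim: n => [|n IH]; first by rewrite big_geq.
by rewrite big_nat_recr //= IH ltnS; case: (ltngtP n t) => _; rewrite /= ?mul0n ?mul1n ?addn0 ?add0n.
Qed.

Lemma sum_bl n : \sum_(p < r) (bl p == n) = l n.
Proof.
rewrite (sum_bl_off (fun i _ => (i == n) : nat)).
under eq_bigr do rewrite sum_nat_const_nat subn0 mulnC.
rewrite (eq_bigr (fun i => (i == n) * l n)) => [|i _]; last by case: eqP => [->|].
rewrite sum_pred1; case: ltnP; rewrite ?mul1n // => h.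
by case: pl => _ /(_ n h) ->.
Qed.

Definition fibers (f : 'I_r -> nat) := forall t, \sum_p (f p == t) = l t.

Lemma fibers_lt f m : fibers f -> #|[set p | f p < m]| = ps m.
Proof.
move=> ff; rewrite -sum1_card big_mkcond /=.
rewrite (eq_bigr (fun p => \sum_(0 <= t < m) (f p == t))) => [|p _].
  by rewrite exchange_big /=; apply: eq_bigr => t _; exact: ff.
rewrite inE (eq_bigr (fun t => (t == f p) * 1)) => [|t _]; last by rewrite muln1 eq_sym.
by rewrite sum_pred1 muln1; case: ltnP.
Qed.

End PartialSums.

Section Conjugate.
Variables (r : nat) (l : nat -> nat).
Hypothesis pl : partn r l.

Definition conj_part : nat -> nat := fun i => \sum_(0 <= j < r) (i < l j).

Lemma lt_conj i j : (j < conj_part i) = (i < l j).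
Proof.
apply: (@sum_initial_segment (fun j => i < l j)) => [a b ab h|b h].
  exact: leq_trans h (partn_mono pl ab).
by rewrite ltnNge; apply/negP => rb; case: pl => _ h2 _; rewrite h2 in h.
Qed.

Lemma part_le n : l n <= r.
Proof.
case: (leqP r n) => [h|h]; first by case: pl => _ -> .
by rewrite -{1}(ps_r pl); apply: leq_trans (ps_mono l h); rewrite psS leq_addl.
Qed.

Lemma sum_lt n m : \sum_(0 <= j < n) (j < m) = minn n m.
Proof. elim: n => [|n IH]; first by rewrite big_geq ?min0n. rewrite big_nat_recr //= IH; lia. Qed.

Lemma partn_conj : partn r conj_part.
Proof.
split=> [n|n rn|].
- by apply: leq_sum => j _; case: (ltnP n.+1 (l j)) => // h; rewrite (ltnW h).
- rewrite /conj_part big1 // => j _; apply/eqP; rewrite eqb0 -leqNgt.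
  exact: leq_trans (part_le j) rn.
rewrite exchange_big /= -[RHS](ps_r pl); apply: eq_bigr => j _.
by rewrite sum_lt; apply/minn_idPr/part_le.
Qed.

Lemma fibers_off : fibers l (fun p : 'I_r => off r conj_part p).
Proof.
move=> t; rewrite (sum_bl_off partn_conj (fun _ j => (j == t) : nat)).
rewrite (eq_bigr (fun i => (t < conj_part i) : nat)) => [|i _]; last first.
  by have := sum_pred1 (conj_part i) 1 t; rewrite muln1 => <-; apply: eq_bigr => j _; rewrite muln1.
under eq_bigr do rewrite lt_conj.
by rewrite sum_lt; apply/minn_idPr/part_le.
Qed.

End Conjugate.

Section StrictFillings.
Variables (r : nat) (l l' : nat -> nat).
Hypotheses (pl : partn r l) (pl' : partn r l').
Notation bc := (bl r (conj_part r l)).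
Notation oc := (off r (conj_part r l)).
Variable f : 'I_r -> nat.
Hypothesis ff : fibers l' f.
Hypothesis f_strict : forall p q : 'I_r, q = p.+1 :> nat -> bc q = bc p -> f p < f q.

Lemma off_le_strict (p : 'I_r) : oc p <= f p.
Proof.
have [n] := ubnP (nat_of_ord p); elim: n p => // n IH p pn.
case: (posnP (oc p)) => [-> //|o0].
have [eb eo] := off_pred (partn_conj pl) (ltn_ord p) o0.
have p0 : 0 < p by move: o0; rewrite /off; lia.
have pr : p.-1 < r by have := ltn_ord p; lia.
have := f_strict (p := Ordinal pr) (q := p); rewrite /= prednK // eb => /(_ erefl erefl).
have /= := IH (Ordinal pr); rewrite eo => h; apply: leq_ltn_trans; apply: h; lia.
Qed.

Lemma strict_dominance m : ps l' m <= ps l m.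
Proof.
rewrite -(fibers_lt m ff) -(fibers_lt m (fibers_off pl)).
by apply/subset_leq_card/fintype.subsetP => p; rewrite !inE; apply: leq_ltn_trans; exact: off_le_strict.
Qed.

Lemma strict_unique : l =1 l' -> forall p : 'I_r, f p = oc p.
Proof.
move=> e p; apply/eqP; rewrite eqn_leq off_le_strict andbT.
have : [set q | f q < (oc p).+1] = [set q : 'I_r | oc q < (oc p).+1].
  apply/eqP; rewrite eqEcard (fibers_lt _ ff) (fibers_lt _ (fibers_off pl)).
  rewrite (_ : ps l _ = ps l' (oc p).+1) ?leqnn ?andbT; last by apply: eq_bigr => j _; exact: e.
  by apply/fintype.subsetP => q; rewrite !inE; apply: leq_ltn_trans; exact: off_le_strict.
by move/setP/(_ p); rewrite !inE !ltnS leqnn.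
Qed.

End StrictFillings.

Lemma dominance_antisym l l' : (forall m, ps l m <= ps l' m) -> (forall m, ps l' m <= ps l m) -> l =1 l'.
Proof.
move=> h1 h2 n; have e m : ps l m = ps l' m by apply/eqP; rewrite eqn_leq h1 h2.
by have := e n.+1; rewrite !psS e => /addnI.
Qed.

Lemma psum_part l n : psum (part l) n = ps l n.
Proof. by rewrite /psum big_add1. Qed.

Lemma omega_part r l (p : 'I_r) : omega r (part l) p = Posz (bl r l p).+1.
Proof.
rewrite ffunE add1n big_add1 /=; congr (Posz _.+1); apply: eq_bigr => n _.
by rewrite psum_part.
Qed.

Lemma conjp_part r l : conjp r (part l) = part (conj_part r l).
Proof.
apply/funext => -[[|n]|n] //; rewrite /conjp /= big_add1 /=.
by apply: eq_bigr => j _.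
Qed.

Lemma part_is_partition r l : partn r l -> is_partition r (part l).
Proof.
move=> pl; split=> [|[[|n]|n]|[[|n]|n]] //; last first.
- by move=> _; rewrite -PoszD addn1; case: pl => h _ _; exact: h.
exists [seq Posz j.+1 | j <- iota 0 r]; split.
- by rewrite map_inj_uniq ?iota_uniq // => x y [].
- move=> [[|n]|n] //= ln; apply: map_f; rewrite mem_iota add0n /= ltnNge.
  by apply: contra ln => h; case: pl => _ -> .
by rewrite big_map -(subn0 r) -/(index_iota 0 r) subn0; exact: ps_r.
Qed.

Lemma is_partition_part r lam : is_partition r lam -> exists2 l, partn r l & lam = part l.
Proof.
case=> -[s [us hs sum]] h0 hd; pose l n := lam (Posz n.+1).
have el : lam = part l by apply/funext => -[[|n]|n] //; apply: h0.
exists l => //.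
have dec n : l n.+1 <= l n.
  by have := hd (Posz n.+1) isT; rewrite /l -PoszD addn1.
have sub N : ps l N <= r.
  pose t := [seq Posz j.+1 | j <- iota 0 N & l j != 0].
  have ut : uniq t by rewrite map_inj_uniq ?filter_uniq ?iota_uniq // => x y [].
  have st : {subset t <= s} by move=> x /mapP[j]; rewrite mem_filter => /andP[lj _] ->; exact: hs.
  rewrite -sum; apply: leq_trans (_ : \sum_(k <- t) lam k <= _).
    rewrite big_map big_filter /ps /index_iota subn0 [X in _ <= X]big_mkcond /=.
    by apply: leq_sum => j _; case: eqP => [->|].
  rewrite [X in _ <= X](bigID (mem t)) /=; apply: leq_trans (leq_addr _ _).
  rewrite -[X in _ <= X]big_filter.
  rewrite (perm_big [seq k <- s | k \in t]) //.
  apply: uniq_perm => //; first by rewrite filter_uniq.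
  by move=> x; rewrite mem_filter; case: (boolP (x \in t)) => //= /st.
have mono m n : m <= n -> l n <= l m.
  elim: n => [|n IH]; first by rewrite leqn0 => /eqP ->.
  by rewrite leq_eqVlt => /orP[/eqP -> //|/IH]; apply: leq_trans.
have z n : r <= n -> l n = 0.
  move=> rn; apply/eqP; rewrite -leqn0 leqNgt; apply/negP => ln.
  have := sub n.+1; rewrite leqNgt => /negP; apply.
  apply: leq_trans (_ : \sum_(0 <= j < n.+1) 1 <= _); first by rewrite sum_nat_const_nat subn0 muln1 ltnS.
  rewrite /ps !big_nat; apply: leq_sum => j /andP[_ jn]; exact: leq_trans ln (mono _ _ _).
split=> //; apply/eqP; rewrite eqn_leq sub -{1}sum /=.
pose t := [seq Posz j.+1 | j <- iota 0 r].
have ut : uniq t by rewrite map_inj_uniq ?iota_uniq // => x y [].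
have et : ps l r = \sum_(k <- t) lam k by rewrite /ps big_map /index_iota subn0.
rewrite -/(ps l r) et.
have -> : \sum_(k <- s) lam k = \sum_(k <- s | k \in t) lam k.
  rewrite [RHS]big_mkcond /=; apply: eq_bigr => k _; case: ifP => // /negbT kt.
  apply/eqP; rewrite el; case: k kt => [[|n]|n] //= kt; rewrite z // leqNgt.
  by apply: contra kt => nr; apply: map_f; rewrite mem_iota.
rewrite -big_filter [X in _ <= X](bigID (mem s)) /=; apply: leq_trans (leq_addr _ _).
rewrite -[X in _ <= X]big_filter (perm_big [seq k <- t | k \in s]) //.
apply: uniq_perm; rewrite ?filter_uniq // => x; rewrite !mem_filter andbC //.
Qed.

Lemma ps_rows rows n : ps (nth 0 rows) n = sumn (take n rows).
Proof.
elim: n rows => [|n IH] rows; first by rewrite ps0 take0.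
case: rows => [|m s]; first by rewrite /ps big1 // => j _; rewrite nth_nil.
by rewrite /ps big_nat_recl // -/(ps (nth 0 s) n) IH.
Qed.

Lemma rows_partn r rows : decreasing_rows rows -> sumn rows = r -> partn r (nth 0 rows).
Proof.
move=> dr sr.
have sz : size rows <= r.
  case/andP: dr => _; rewrite -sr; elim: (rows) => //= m s IH /andP[m1 /IH]; lia.
split=> [n|n rn|]; first exact: decreasing_rows_nth.
  by rewrite nth_default //; exact: leq_trans sz rn.
by rewrite -/(ps _ _) ps_rows take_oversize.
Qed.

Lemma reading_block r rows p : decreasing_rows rows -> sumn rows = r -> p.+1 < r ->
  bl r (nth 0 rows) p.+1 = bl r (nth 0 rows) p ->
  ((reading 0 rows)`_p.+1 = (reading 0 rows)`_p + 1)%R.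
Proof.
move=> dr sr pr e; have pl := rows_partn dr sr; have pr' := ltnW pr.
have o1 := off_lt pl pr; have o0 := off_lt pl pr'.
have h1 := bl_off pl pr; have h0 := bl_off pl pr'; rewrite e (off_succ pl pr e) in h1 o1.
rewrite [in LHS]h1 [in RHS]h0 !ps_rows !nth_reading //.
by rewrite -addn1 PoszD addrA.
Qed.

Lemma conj_rows r rows rows' : decreasing_rows rows -> sumn rows = r ->
  (forall i j, (j < nth 0 rows i) = (i < nth 0 rows' j)) -> conj_part r (nth 0 rows) =1 nth 0 rows'.
Proof.
move=> dr sr h n; have pl := rows_partn dr sr.
by apply: eq_from_lt => j; rewrite (lt_conj pl) h.
Qed.

End Partitions.

(** * Inversions and reduced words *)

Section Permutations.
Variable r : nat.
Notation S := {perm 'I_r}.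
Implicit Types (a : 'I_r) (w : S).
Local Open Scope group_scope.

Definition nxt a : 'I_r := adjT a a.

Lemma adjT_gen a : is_gen a -> val (nxt a) = a.+1 /\ adjT a = tperm a (nxt a).
Proof.
rewrite /nxt /adjT /is_gen => h; case: pickP => [b /eqP e|/(_ (Ordinal h))]; last by rewrite eqxx.
by rewrite tpermL.
Qed.

Lemma val_nxt a : is_gen a -> nxt a = a.+1 :> nat. Proof. by case/adjT_gen. Qed.
Lemma adjTE a : is_gen a -> adjT a = tperm a (nxt a). Proof. by case/adjT_gen. Qed.
Lemma adjTL a : adjT a a = nxt a. Proof. by []. Qed.
Lemma adjTR a : is_gen a -> adjT a (nxt a) = a. Proof. by move/adjTE => ->; rewrite tpermR. Qed.
Lemma adjTK a : is_gen a -> involutive (adjT a).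
Proof. by move/adjTE => -> p; rewrite tpermK. Qed.
Lemma adjT2 a : is_gen a -> adjT a * adjT a = 1.
Proof. by move/adjTE => ->; rewrite tperm2. Qed.
Lemma adjTKl a w : is_gen a -> adjT a * (adjT a * w) = w.
Proof. by move=> ga; rewrite mulgA adjT2 // mul1g. Qed.
Lemma adjTV a : is_gen a -> (adjT a)^-1 = adjT a.
Proof. by move=> ga; apply/eqP; rewrite eq_invg_mul adjT2. Qed.

Lemma adjTD a p : is_gen a -> p != a -> p != nxt a -> adjT a p = p.
Proof. by move/adjTE => -> pa pb; rewrite tpermD // eq_sym. Qed.

Lemma adjT_lt a p q : is_gen a -> (p, q) != (a, nxt a) -> (p, q) != (nxt a, a) ->
  (adjT a p < adjT a q)%N = (p < q)%N.
Proof.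
move=> ga; rewrite !xpair_eqE => h1 h2; have vb := val_nxt ga; have [va tE] := adjT_gen ga.
rewrite tE; case: (tpermP a (nxt a) p) => [ep|ep|/eqP pa /eqP pb];
  case: (tpermP a (nxt a) q) => [eq|eq|/eqP qa /eqP qb] //; subst; rewrite ?eqxx // ?ltnn // in h1 h2 *;
  do ?[move: pa; rewrite -val_eqE /= => pa]; do ?[move: pb; rewrite -val_eqE /= => pb];
  do ?[move: qa; rewrite -val_eqE /= => qa]; do ?[move: qb; rewrite -val_eqE /= => qb]; lia.
Qed.

Section Inversions.
Variables (T : eqType) (g : 'I_r -> T).

(* Inversions of [w] between positions with equal [g]-values; [len] is the case of constant [g]. *)
Definition inv_set w := [set pq : 'I_r * 'I_r |
  [&& (pq.1 < pq.2)%N, (w pq.2 < w pq.1)%N & g (w pq.1) == g (w pq.2)]].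
Definition inv w := #|inv_set w|.

Lemma inv_adjT a w : is_gen a -> (w a < w (nxt a))%N ->
  inv (adjT a * w) = ((g (w a) == g (w (nxt a))) + inv w)%N.
Proof.
move=> ga up; have vb := val_nxt ga.
rewrite /inv (cardsD1 (a, nxt a)); congr addn.
  by rewrite inE /= !permM adjTL adjTR // up vb ltnSn /= eq_sym.
pose f (pq : 'I_r * 'I_r) := (adjT a pq.1, adjT a pq.2).
have finj : injective f by move=> [p q] [p' q'] [/perm_inj -> /perm_inj ->].
rewrite -(card_imset (inv_set w) finj); apply: eq_card => -[p q].
rewrite !inE /= !permM.
apply/idP/imsetP => [/andP[ne /and3P[lt gt e]]|[[p' q']]].
  exists (adjT a p, adjT a q); last by rewrite /f /= !adjTK.
  rewrite inE /= gt e adjT_lt ?lt //.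
  by apply/eqP => -[ep eq]; move: lt; rewrite ep eq vb; lia.
rewrite inE /= => /and3P[lt gt e] [-> ->].
rewrite !adjTK // gt e !andbT.
have ne : (p', q') != (a, nxt a) by apply/eqP => -[ep eq]; move: gt up; rewrite ep eq; lia.
rewrite adjT_lt // ?lt ?andbT; last by apply/eqP => -[ep eq]; move: lt; rewrite ep eq vb; lia.
apply/eqP => -[ep eq]; move: lt; have -> : p' = nxt a by rewrite -(adjTK ga p') ep.
have -> : q' = a by rewrite -(adjTK ga q') eq adjTR.
by rewrite vb; lia.
Qed.

End Inversions.

Lemma len_inv w : len w = inv (fun=> tt) w.
Proof. by apply: eq_card => pq; rewrite !inE eqxx andbT. Qed.

Lemma len_up a w : is_gen a -> (w a < w (nxt a))%N -> len (adjT a * w) = (len w).+1.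
Proof. by move=> ga up; rewrite !len_inv inv_adjT. Qed.

Lemma lt_or_gt w p q : p != q -> (w q < w p)%N = ~~ (w p < w q)%N.
Proof. by move=> pq; rewrite -leqNgt [RHS]leq_eqVlt (inj_eq val_inj) (inj_eq perm_inj) eq_sym (negbTE pq). Qed.

Lemma nxt_neq a : is_gen a -> a != nxt a.
Proof. by move=> ga; rewrite -val_eqE /= val_nxt // neq_ltn ltnSn. Qed.

Lemma up_adjT a w : is_gen a -> ((adjT a * w)%g a < (adjT a * w)%g (nxt a))%N = ~~ (w a < w (nxt a))%N.
Proof. by move=> ga; rewrite !permM adjTL adjTR // lt_or_gt // nxt_neq. Qed.

Lemma len_down a w : is_gen a -> ~~ (w a < w (nxt a))%N -> len w = (len (adjT a * w)).+1.
Proof. by move=> ga dn; rewrite -{1}(adjTKl w ga) len_up // up_adjT. Qed.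

Lemma len1 : len (1 : S) = 0%N.
Proof. by apply/eqP; rewrite cards_eq0; apply/eqP/setP => -[p q]; rewrite !inE !perm1 /=; lia. Qed.

Lemma increasing_perm w : (forall a, is_gen a -> (w a < w (nxt a))%N) -> w = 1.
Proof.
move=> h.
have step (p q : 'I_r) : q = p.+1 :> nat -> (w p < w q)%N.
  move=> e; have gp : is_gen p by rewrite /is_gen -e.
  have -> : q = nxt p by apply: val_inj; rewrite /= val_nxt.
  exact: h.
have ge n (p : 'I_r) : p = n :> nat -> (n <= w p)%N.
  elim: n p => // n IH p e; have np : (n < r)%N by have := ltn_ord p; lia.
  by have := step (Ordinal np) p e; have := IH (Ordinal np) erefl; lia.
have le n (p : 'I_r) : (p + n = r.-1)%N -> (w p + n <= r.-1)%N.
  elim: n p => [|n IH] p e; first by have := ltn_ord (w p); lia.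
  have np : (p.+1 < r)%N by have := ltn_ord p; lia.
  by have /= := step p (Ordinal np) erefl; have /= := IH (Ordinal np); lia.
apply/permP => p; rewrite perm1; apply: val_inj => /=.
have h1 := ge _ p erefl; have h2 := le (r.-1 - p)%N p; have := ltn_ord p; lia.
Qed.

Definition reduced (ws : seq 'I_r) := all (@is_gen r) ws && (len (wordperm ws) == size ws).

Lemma wordperm_cat s t : wordperm (s ++ t) = (wordperm t * wordperm s : S).
Proof. by elim: s => [|a s IH] /=; rewrite ?mulg1 // IH mulgA. Qed.

Lemma wordperm_rcons s a : wordperm (rcons s a) = (adjT a * wordperm s : S).
Proof. by rewrite -cats1 wordperm_cat /= mul1g. Qed.

Lemma len_wordperm ws : all (@is_gen r) ws -> (len (wordperm ws) <= size ws)%N.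
Proof.
elim/last_ind: ws => [|ws a IH] /=; first by rewrite len1.
rewrite all_rcons wordperm_rcons size_rcons => /andP[ga /IH h].
case: (boolP (wordperm ws a < wordperm ws (nxt a))%N) => up.
  by rewrite len_up.
by have := len_down ga up; lia.
Qed.

Lemma reduced_rcons ws a : reduced (rcons ws a) ->
  [/\ reduced ws, is_gen a & (wordperm ws a < wordperm ws (nxt a))%N].
Proof.
rewrite /reduced all_rcons wordperm_rcons size_rcons => /andP[/andP[ga gws] /eqP e].
have le := len_wordperm gws.
case: (boolP (wordperm ws a < wordperm ws (nxt a))%N) => up.
  by rewrite len_up // in e; case: e => ->; rewrite gws eqxx.
by have := len_down ga up; lia.
Qed.

Lemma reduced_redw w : reduced (redw w) /\ wordperm (redw w) = w.
Proof.
have [ws [rws ew]] : exists ws, reduced ws /\ wordperm ws = w.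
  have [n] := ubnP (len w); elim: n w => // n IH w lt.
  case: (pselect (forall a, is_gen a -> (w a < w (nxt a))%N)) => [/increasing_perm ->|].
    by exists [::]; rewrite /reduced /= len1.
  move/existsNP => [a /not_implyP[ga /negP dn]].
  have le := len_down ga dn; have [|ws [/andP[gws /eqP sz] e]] := IH (adjT a * w); first lia.
  exists (rcons ws a); rewrite /reduced wordperm_rcons all_rcons ga gws e adjTKl //=.
  by rewrite size_rcons -sz e le.
have sz : size ws == len w by case/andP: rws => _; rewrite ew eq_sym.
rewrite /redw; case: pickP => [t /andP[gt /eqP e]|/(_ (Tuple sz)) /=].
  by rewrite /reduced e gt size_tuple eqxx.
by case/andP: rws => -> _; rewrite ew eqxx.
Qed.

End Permutations.

Local Open Scope ring_scope.

(** * Jucys-Murphy elements *)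

Section JucysMurphy.
Import Num.Theory.
Variables (F : fieldType) (B : finType) (r : nat).
Notation V := {ffun B -> F^o}.
Variable T : nat -> {linear V -> V}.
Variable q : F.
Hypothesis q0 : q != 0.
Hypothesis q_root : forall n, (0 < n)%N -> q ^+ n != 1.
Hypothesis anisotropic : forall u : V, \sum_s u s * u s = 0 -> u = 0.
Notation delta := (q - q^-1).

Definition form (u w : V) : F := \sum_s u s * w s.

Hypothesis T_quad : forall i u, (i.+1 < r)%N -> T i (T i u) = delta *: T i u + u.
Hypothesis T_braid : forall i u, (i.+2 < r)%N ->
  T i (T i.+1 (T i u)) = T i.+1 (T i (T i.+1 u)).
Hypothesis T_comm : forall i j u, (i.+1 < j)%N -> (j.+1 < r)%N ->
  T i (T j u) = T j (T i u).
Hypothesis T_adj : forall i u w, (i.+1 < r)%N -> form (T i u) w = form u (T i w).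

Fixpoint jucys_murphy (i : nat) (u : V) : V :=
  if i is j.+1 then T j (jucys_murphy j (T j u)) else u.

(* Locked: otherwise unification sees through [L i.+1 u] to a [T i _] redex. *)
Definition L := locked jucys_murphy.

Lemma L0 u : L 0 u = u. Proof. by rewrite /L -lock. Qed.
Lemma LS i u : L i.+1 u = T i (L i (T i u)). Proof. by rewrite /L -lock. Qed.

Lemma L_linear i a u w : L i (a *: u + w) = a *: L i u + L i w.
Proof. by elim: i u w => [|i IH] u w; rewrite ?L0 // !LS linearP IH linearP. Qed.

HB.instance Definition _ i := GRing.isLinear.Build F V V _ (L i) (L_linear i).

Lemma T_L i u : (i.+1 < r)%N -> T i (L i u) = L i.+1 (T i u) - delta *: L i.+1 u.
Proof. by move=> hi; rewrite !LS T_quad // 2!linearP addrAC subrr add0r. Qed.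

Lemma L_T i u : (i.+1 < r)%N -> L i (T i u) = T i (L i.+1 u) - delta *: L i.+1 u.
Proof. by move=> hi; rewrite !LS T_quad // addrAC subrr add0r. Qed.

Lemma T_L_gt i j u : (i < j)%N -> (j.+1 < r)%N -> T j (L i u) = L i (T j u).
Proof.
elim: i u => [|i IH] u hi hj; first by rewrite !L0.
by rewrite !LS -(T_comm _ hi hj) IH ?(T_comm _ hi hj) // ltnW.
Qed.

Lemma T_L_lt i j u : (j.+1 < i)%N -> (i < r)%N -> T j (L i u) = L i (T j u).
Proof.
elim: i j u => // -[|i] IH j u // ji ir.
have [e|ne] := eqVneq j i; last first.
  have ji' : (j.+1 < i.+1)%N by lia.
  by rewrite !(LS i.+1) (T_comm _ ji' ir) (IH j) 1?(T_comm _ ji' ir) // ltnW.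
subst j; rewrite !LS T_braid //; congr (T _ _).
by rewrite T_L_gt // -T_braid.
Qed.

Lemma L_comm i j u : (i < r)%N -> (j < r)%N -> L i (L j u) = L j (L i u).
Proof.
suff h a b w : (a <= b)%N -> (b < r)%N -> L a (L b w) = L b (L a w).
  by move=> hi hj; case: (leqP i j) => ij; [exact: h | apply/esym/h => //; exact: ltnW].
rewrite leq_eqVlt => /orP[/eqP -> //|].
elim: a w => [|a IH] w ab br; first by rewrite !L0.
by rewrite !LS -(T_L_lt _ ab br) -(IH _ (ltnW ab) br) (T_L_lt _ ab br).
Qed.

Lemma form_L i u w : (i < r)%N -> form (L i u) w = form u (L i w).
Proof.
elim: i u w => [|i IH] u w hi; first by rewrite !L0.
by rewrite !LS (T_adj _ _ hi) (IH _ _ (ltnW hi)) (T_adj _ _ hi).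
Qed.

Ltac modring := apply/ffunP => ?; rewrite !ffunE /GRing.scale /=; ring.

Lemma formZl a u w : form (a *: u) w = a * form u w.
Proof. by rewrite /form mulr_sumr; apply: eq_bigr => s _; rewrite !ffunE mulrA. Qed.
Lemma formC u w : form u w = form w u.
Proof. by apply: eq_bigr => s _; rewrite mulrC. Qed.
Lemma formZr a u w : form u (a *: w) = a * form u w.
Proof. by rewrite formC formZl formC. Qed.
Lemma formDl u1 u2 w : form (u1 + u2) w = form u1 w + form u2 w.
Proof. by rewrite /form -big_split; apply: eq_bigr => s _; rewrite !ffunE mulrDl. Qed.
Lemma formDr u1 u2 w : form w (u1 + u2) = form w u1 + form w u2.
Proof. by rewrite formC formDl !(formC w). Qed.
Lemma form0r u : form u 0 = 0.
Proof. by rewrite /form big1 // => s _; rewrite ffunE mulr0. Qed.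

(* Intertwiner of the eigenspaces of [L i] and [L i.+1]. *)
Definition phi i u : V := T i (L i.+1 u - L i u) - delta *: L i.+1 u.

Lemma LB i a b : L i (a - b) = L i a - L i b. Proof. exact: linearB. Qed.
Lemma LZ i a b : L i (a *: b) = a *: L i b. Proof. exact: linearZ. Qed.
Lemma TB i a b : T i (a - b) = T i a - T i b. Proof. exact: linearB. Qed.
Lemma TZ i a b : T i (a *: b) = a *: T i b. Proof. exact: linearZ. Qed.

Lemma L_TS i w : (i.+1 < r)%N -> L i.+1 (T i w) = T i (L i w) + delta *: L i.+1 w.
Proof. by move=> hi; rewrite T_L // subrK. Qed.

Lemma phi_L i u : (i.+1 < r)%N -> L i (phi i u) = phi i (L i.+1 u).
Proof.
move=> hi; rewrite /phi LB L_T // LZ !LB (@L_comm i i.+1) ?TB //; last by lia.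
modring.
Qed.

Lemma phi_LS i u : (i.+1 < r)%N -> L i.+1 (phi i u) = phi i (L i u).
Proof.
move=> hi; rewrite /phi LB L_TS // LZ !LB (@L_comm i i.+1) ?TB //; last by lia.
modring.
Qed.

Lemma phi_phi i u : (i.+1 < r)%N -> phi i (phi i u) =
  - (L i.+1 (L i.+1 u - q^-2 *: L i u) - q^+2 *: L i (L i.+1 u - q^-2 *: L i u)).
Proof.
move=> hi; rewrite {1}/phi phi_L // phi_LS //.
rewrite /phi !(TB, TZ, T_quad, LB, LZ) // (@L_comm i i.+1) //; last by lia.
apply/ffunP => ?; rewrite !ffunE /GRing.scale /=. field; exact: q0.
Qed.

Definition split_prod (A : seq int) (f : V -> V) (u : V) : V :=
  foldr (fun a w => f w - q ^ (2 * a) *: w) u A.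

Lemma split_prod_intertwine A (f g h : V -> V) u :
  (forall c x y, h (x - c *: y) = h x - c *: h y) -> (forall x, h (f x) = g (h x)) ->
  h (split_prod A f u) = split_prod A g (h u).
Proof. by move=> hl hc; elim: A => //= a A IH; rewrite hl hc IH. Qed.

Lemma split_prod_shift A d i j w : (i < r)%N -> (j < r)%N ->
  L j w = q ^ (2 * d) *: L i w -> split_prod A (L i) w = 0 ->
  split_prod [seq a + d | a <- A] (L j) w = 0.
Proof.
move=> hi hj e; have comm x : L j (L i x) = L i (L j x) by exact: L_comm.
suff : exists c, split_prod [seq a + d | a <- A] (L j) w = c *: split_prod A (L i) w.
  by case=> c -> ->; exact: scaler0.
elim: A => [|a A [c IH]]; first by exists 1; rewrite /= scale1r.
exists (c * q ^ (2 * d)); rewrite /= IH LZ.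
rewrite (@split_prod_intertwine A (L i) (L i) (L j)) // => [|c' x y]; last by rewrite LB LZ.
have -> : split_prod A (L i) (L j w) = q ^ (2 * d) *: L i (split_prod A (L i) w).
  rewrite e -(@split_prod_intertwine A (L i) (L i) (fun x => q ^ (2 * d) *: L i x)) //.
    by move=> c' x y; rewrite LB LZ; modring.
  by move=> x; rewrite LZ.
rewrite mulrDr expfzDr //; modring.
Qed.

Lemma L_split i : (i < r)%N -> exists A, forall u, split_prod A (L i) u = 0.
Proof.
elim: i => [|i IH] hi.
  by exists [:: 0] => u; rewrite /= L0 mulr0 expr0z scale1r subrr.
have [A hA] := IH (ltnW hi); have hi' := ltnW hi.
exists ([seq a - 1 | a <- A] ++ [seq a + 1 | a <- A] ++ A) => u.
rewrite /split_prod !foldr_cat -/(split_prod A (L i.+1) u).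
set w0 := split_prod A (L i.+1) u.
have p0 : phi i w0 = 0.
  rewrite (@split_prod_intertwine A (L i.+1) (L i) (phi i)) ?hA //.
    move=> c x y; rewrite /phi !LB !LZ !TB !TZ; modring.
  by move=> x; rewrite phi_L.
have p1 : L i.+1 (L i.+1 w0 - q ^- 2 *: L i w0) = q ^+ 2 *: L i (L i.+1 w0 - q ^- 2 *: L i w0).
  apply/eqP; rewrite -subr_eq0 -oppr_eq0 -phi_phi // p0.
  by rewrite /phi !linear0 !addr0 linear0.
have s1 := @split_prod_shift A 1 i i.+1 _ hi' hi p1 (hA _).
have hl (c : F) (x y : V) : L i.+1 x - q ^- 2 *: L i x - c *: (L i.+1 y - q ^- 2 *: L i y) = L i.+1 (x - c *: y) - q ^- 2 *: L i (x - c *: y).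
  rewrite !LB !LZ; modring.
rewrite -(@split_prod_intertwine [seq a + 1 | a <- A] (L i.+1) (L i.+1) (fun x => L i.+1 x - q ^- 2 *: L i x)) // in s1; last first.
  by move=> x; rewrite LB LZ (@L_comm i i.+1).
apply: (@split_prod_shift A (-1) i i.+1 _ hi' hi _ (hA _)).
by apply/eqP; rewrite -subr_eq0; apply/eqP.
Qed.

Definition invariant (P : V -> Prop) :=
  (forall a u w, P u -> P w -> P (a *: u + w)) /\
  (forall i u, (i.+1 < r)%N -> P u -> P (T i u)).

Definition linked u w := forall P, invariant P -> (P u <-> P w).

Definition spectral (c : seq int) u :=
  [/\ u != 0, size c = r & forall i, (i < r)%N -> L i u = q ^ (2 * c`_i) *: u].

Lemma invariant_L P i u : invariant P -> (i < r)%N -> P u -> P (L i u).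
Proof.
case=> _ hT; elim: i u => [|i IH] u hi Pu; first by rewrite L0.
by rewrite LS; apply: (hT) => //; apply: IH (ltnW hi) _; apply: hT.
Qed.

Lemma invariantB P c u w : invariant P -> P u -> P w -> P (u - c *: w).
Proof. by case=> hl _ Pu Pw; rewrite addrC -scaleNr; apply: hl. Qed.

Lemma invariantZ P c u : invariant P -> P u -> P (c *: u).
Proof.
case=> hl _ Pu; have P0 : P 0 by rewrite -(addNr u) -scaleN1r; apply: hl.
by rewrite -[c *: u]addr0; apply: hl.
Qed.

Lemma split_eigenvector A i (Q : V -> Prop) u : u != 0 -> Q u ->
  (forall c w, Q w -> Q (L i w - c *: w)) -> split_prod A (L i) u = 0 ->
  exists a w, [/\ w != 0, Q w & L i w = q ^ (2 * a) *: w].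
Proof.
move=> u0 Qu hQ; elim: A => [/= e|a A IH /=]; first by rewrite e eqxx in u0.
have [/IH//|x0 e] := eqVneq (split_prod A (L i) u) 0.
exists a, (split_prod A (L i) u); split=> //; last by apply/eqP; rewrite -subr_eq0; apply/eqP.
by elim: A {IH x0 e} => //= b A IH; apply: hQ.
Qed.

Lemma exists_spectral P u : invariant P -> P u -> u != 0 ->
  exists c w, spectral c w /\ P w.
Proof.
move=> iP Pu u0.
suff h k : (k <= r)%N -> exists c w, [/\ w != 0, P w, size c = k &
    forall i, (i < k)%N -> L i w = q ^ (2 * c`_i) *: w].
  by have [c [w [w0 Pw sc hc]]] := h r (leqnn r); exists c, w.
elim: k => [|k IH] hk; first by exists [::], u.
have [c [w [w0 Pw sc hc]]] := IH (ltnW hk); have [A hA] := L_split hk.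
pose Q x := P x /\ forall i, (i < k)%N -> L i x = q ^ (2 * c`_i) *: x.
have Qw : Q w by [].
have QL d x : Q x -> Q (L k x - d *: x).
  case=> Px Lx; split; first by apply: invariantB => //; apply: invariant_L.
  move=> i ik; rewrite LB LZ (@L_comm i k) ?(ltn_trans ik) // (Lx _ ik) LZ; modring.
have [a [x [x0 [Px Lx] e]]] := split_eigenvector w0 Qw QL (hA w).
exists (rcons c a), x; split=> //; first by rewrite size_rcons sc.
move=> j; rewrite ltnS leq_eqVlt nth_rcons sc => /orP[/eqP ->|jk]; first by rewrite ltnn eqxx.
by rewrite jk Lx.
Qed.

Lemma formBl u1 u2 w : form (u1 - u2) w = form u1 w - form u2 w.
Proof. by rewrite -scaleN1r formDl formZl mulN1r. Qed.
Lemma formBr u1 u2 w : form w (u1 - u2) = form w u1 - form w u2.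
Proof. by rewrite formC formBl !(formC w). Qed.

Lemma form_phi i u w : (i.+1 < r)%N -> form (phi i u) w = - form u (phi i w).
Proof.
move=> hi; have hi' := ltnW hi.
rewrite /phi !(formBl, formBr, formZl, formZr, TB) !T_adj // !form_L // L_TS // L_T //.
rewrite !(formBr, formDr, formZr); ring.
Qed.

Lemma form_eq0 u : form u u = 0 -> u = 0.
Proof. exact: anisotropic. Qed.

Section AdjacentEigenvalues.
Variables (i : nat) (u : V) (a b : int).
Hypotheses (hi : (i.+1 < r)%N) (u0 : u != 0).
Hypothesis La : L i u = q ^ (2 * a) *: u.
Hypothesis Lb : L i.+1 u = q ^ (2 * b) *: u.
Notation qa := (q ^ (2 * a)).
Notation qb := (q ^ (2 * b)).

Lemma qz_neq0 x : q ^ x != 0. Proof. exact: expfz_neq0. Qed.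

Lemma qz_eq1 x : q ^ x = 1 -> x = 0.
Proof.
suff h n : q ^ n%:Z = 1 -> n = 0%N.
  case: x => n e; first by rewrite (h n e).
  have : q ^ n.+1%:Z = 1 by rewrite -[RHS]invr1 -e NegzE -invr_expz invrK.
  by move/h.
case: n => // n /eqP; rewrite -exprnP => e.
by have := @q_root n.+1 isT; rewrite e.
Qed.

Lemma qz_inj x y : q ^ x = q ^ y -> x = y.
Proof.
move=> e; apply/eqP; rewrite -subr_eq0; apply/eqP/qz_eq1.
by rewrite expfzDr // e -invr_expz divff // qz_neq0.
Qed.

Lemma delta_neq0 : delta != 0.
Proof.
apply/eqP => e; have : q ^+ 2 = 1.
  by rewrite expr2 -{1}[q](subrK q^-1) e add0r mulVf.
by move/eqP; apply/negP/q_root.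
Qed.

Lemma phi_eigen : phi i u = (qb - qa) *: T i u - (delta * qb) *: u.
Proof. by rewrite /phi La Lb -scalerBl TZ scalerA. Qed.

Lemma adjacent_neq : a <> b.
Proof.
move=> ab; have e : L i (T i u) - qb *: T i u = - (delta * qb) *: u.
  by rewrite L_T // Lb TZ; modring.
have : form (L i (T i u) - qb *: T i u) (L i (T i u) - qb *: T i u) = 0.
  rewrite {2}e formZr formBl formZl form_L ?(ltnW hi) // La ab formZr; ring.
move/form_eq0; rewrite e => /eqP; rewrite scaler_eq0 oppr_eq0 mulf_eq0.
by rewrite (negbTE delta_neq0) (negbTE (qz_neq0 _)) (negbTE u0).
Qed.

Lemma qb_neq_qa : qb - qa != 0.
Proof.
apply/eqP => /eqP; rewrite subr_eq0 => /eqP /qz_inj h.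
by apply: adjacent_neq; lia.
Qed.

Lemma qz_succ x : q ^ (2 * (x + 1)) = q ^+ 2 * q ^ (2 * x).
Proof. by rewrite mulrDr expfzDr // mulrC. Qed.

Lemma qz_pred x : q ^ (2 * (x - 1)) = q ^- 2 * q ^ (2 * x).
Proof. by rewrite mulrBr expfzDr // mulrC. Qed.

Lemma phi_adjacent : b = a + 1 \/ b = a - 1 -> phi i u = 0.
Proof.
move=> hb; apply: form_eq0; rewrite form_phi // phi_phi // La Lb !LB !LZ La Lb.
set x := (X in form u X); suff -> : x = 0 by rewrite form0r oppr0.
suff e : (qb - q ^- 2 * qa) * (qb - q ^+ 2 * qa) = 0.
  transitivity (- ((qb - q ^- 2 * qa) * (qb - q ^+ 2 * qa)) *: u).
    by rewrite /x; modring.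
  by rewrite e oppr0 scale0r.
by case: hb => ->; rewrite ?qz_succ ?qz_pred subrr ?mul0r ?mulr0.
Qed.

Lemma T_adjacent t : t * (qb - qa) = delta * qb -> phi i u = 0 -> T i u = t *: u.
Proof.
move=> ht; rewrite phi_eigen => /eqP; rewrite subr_eq0 => /eqP e.
apply: (scalerI qb_neq_qa); rewrite e scalerA [_ * t]mulrC; by rewrite ht.
Qed.

Lemma adjacent_succ : b = a + 1 -> T i u = q *: u.
Proof.
move=> hb; apply: T_adjacent; last by apply: phi_adjacent; left.
by rewrite hb qz_succ; field.
Qed.

Lemma adjacent_pred : b = a - 1 -> T i u = - q^-1 *: u.
Proof.
move=> hb; apply: T_adjacent; last by apply: phi_adjacent; right.
by rewrite hb qz_pred; field.
Qed.

Lemma adjacent_swap : b <> a + 1 -> b <> a - 1 ->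
  [/\ phi i u != 0, L i (phi i u) = qb *: phi i u, L i.+1 (phi i u) = qa *: phi i u,
     (forall j c, (j < r)%N -> j != i -> j != i.+1 -> L j u = c *: u ->
        L j (phi i u) = c *: phi i u) &
     linked u (phi i u)].
Proof.
move=> b1 b2.
have phiZ c x : phi i (c *: x) = c *: phi i x by rewrite /phi !LZ -scalerBr TZ; modring.
pose c := - ((qb - q ^- 2 * qa) * (qb - q ^+ 2 * qa)).
have pp : phi i (phi i u) = c *: u.
  by rewrite phi_phi // La Lb !LB !LZ La Lb /c; modring.
have c0 : c != 0.
  rewrite oppr_eq0 mulf_eq0 negb_or -qz_succ -qz_pred !subr_eq0.
  by apply/andP; split; apply/eqP => /qz_inj; lia.
split.
- by apply/eqP => p0; move: pp; rewrite p0 /phi !linear0 !addr0 linear0 => /esym/eqP; rewrite scaler_eq0 (negbTE c0) (negbTE u0).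
- by rewrite phi_L // Lb phiZ.
- by rewrite phi_LS // La phiZ.
- move=> j d hj ji ji' e.
  have hT x : L j (T i x) = T i (L j x).
    have [lt|lt] := ltnP j i; first by rewrite T_L_gt.
    by rewrite T_L_lt //; lia.
  by rewrite /phi LB hT !LB LZ !(@L_comm j i.+1) ?(@L_comm j i) ?(ltnW hi) // e !LZ !TB !TZ; modring.
- have phiP P x : invariant P -> P x -> P (phi i x).
    move=> iP Px; rewrite /phi; have PL := invariant_L iP.
    apply: invariantB => //; last exact: PL.
    by case: (iP) => _; apply => //; rewrite -[L i x]scale1r; apply: invariantB => //; apply: PL => //; exact: ltnW.
  move=> P iP; split; first exact: phiP.
  move/(phiP _ _ iP); rewrite pp => /(invariantZ c^-1 iP).
  by rewrite scalerA mulVf // scale1r.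
Qed.

End AdjacentEigenvalues.

Lemma spectral_pair s1 a b s2 u : spectral (s1 ++ a :: b :: s2) u ->
  [/\ ((size s1).+1 < r)%N, u != 0, L (size s1) u = q ^ (2 * a) *: u &
      L (size s1).+1 u = q ^ (2 * b) *: u].
Proof.
case=> u0; rewrite size_cat /= => sz hL.
have hi : ((size s1).+1 < r)%N by lia.
split=> //; rewrite hL ?(ltnW hi) //; congr (q ^ (2 * _) *: _).
  by rewrite nth_cat ltnn subnn.
by rewrite nth_cat ltnNge leqnSn subSnn.
Qed.

Lemma spectral_T c u i : spectral c u -> (i.+1 < r)%N -> c`_i.+1 = c`_i + 1 -> T i u = q *: u.
Proof. by case=> u0 sz hL hi e; apply: (adjacent_succ hi u0 (hL _ (ltnW hi)) (hL _ hi)). Qed.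

Lemma linked_trans u w x : linked u w -> linked w x -> linked u x.
Proof. by move=> h1 h2 P iP; rewrite (h1 P iP) (h2 P iP). Qed.

Lemma exists_spectral_reading c0 u0 : spectral c0 u0 ->
  exists rows u, [/\ spectral (reading 0 rows) u, linked u0 u,
    perm_eq (reading 0 rows) c0 & decreasing_rows rows].
Proof.
move=> s0; pose C c := exists u, spectral c u /\ linked u0 u.
suff [rows [[u [su lu]] pr dr]] :
    exists rows, [/\ C (reading 0 rows), perm_eq (reading 0 rows) c0 & decreasing_rows rows].
  by exists rows, u.
apply: exists_reading; last by exists u0.
- move=> x s [u [[un sz hL] _]]; have hr : (0 < r)%N by rewrite -sz.
  have /= := hL _ hr; rewrite L0 => e; have /eqP : (1 - q ^ (2 * x)) *: u = 0.
    by rewrite scalerBl scale1r -e subrr.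
  rewrite scaler_eq0 (negbTE un) orbF subr_eq0 eq_sym => /eqP/qz_eq1; lia.
- by move=> s1 a b s2 [u [/spectral_pair[hi un La Lb] _]]; apply: adjacent_neq hi un La Lb.
- move=> s1 a b s2 [u [su _]]; have [hi un La Lb] := spectral_pair su.
  have su' : spectral ((s1 ++ [:: a]) ++ b :: a :: s2) u by rewrite -catA.
  have [] := spectral_pair su'; rewrite size_cat addn1 => hi' _ Lb' La'.
  set i := size s1 in hi La Lb hi' Lb' La' *.
  have contra (x y : F) : x != y -> T i u = x *: u -> T i.+1 u = y *: u -> x * y = -1 -> False.
    move=> xy Tx Ty e; have := @T_braid i u hi'; rewrite !(Tx, Ty, TZ) !scalerA => /eqP.
    rewrite -subr_eq0 -scalerBl scaler_eq0 (negbTE un) orbF.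
    have -> : x * y * x - y * x * y = - (x - y).
      by rewrite -[RHS]mulN1r -e; ring.
    by rewrite oppr_eq0 subr_eq0 (negbTE xy).
  have qd : q != - q^-1.
    apply/eqP => e; have : q ^+ 4 = 1.
      have e2 : q ^+ 2 = -1 by rewrite expr2 {2}e mulrN divff.
      by rewrite (exprM q 2 2) e2 sqrrN expr1n.
    by move/eqP; apply/negP/q_root.
  split=> e.
    apply: (contra q (- q^-1)) => //; [exact: adjacent_succ La Lb _| |by rewrite mulrN divff].
    by apply: adjacent_pred Lb' La' _ => //; lia.
  apply: (contra (- q^-1) q) => //; [by rewrite eq_sym|exact: adjacent_pred La Lb _| |by rewrite mulNr mulVf].
  by apply: adjacent_succ Lb' La' _ => //; lia.
- move=> s1 a b s2 [u [su lu]] nab b1 b2; have [hi un La Lb] := spectral_pair su.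
  have [p0 pL pLS pLj lp] := adjacent_swap hi un La Lb b1 b2.
  exists (phi (size s1) u); split; last exact: linked_trans lu lp.
  case: su => _ sz hL; split=> // [|j hj].
    by rewrite -sz !size_cat.
  rewrite nth_cat; have [lt|ge] := ltnP j (size s1).
    by apply: pLj => //; [lia|lia|]; rewrite hL // nth_cat lt.
  have [->|ne] := eqVneq j (size s1); first by rewrite subnn.
  have [->|ne'] := eqVneq j (size s1).+1; first by rewrite subSnn.
  apply: pLj => //; rewrite hL // nth_cat ltnNge ge /=.
  by have -> : (j - size s1 = (j - size s1 - 2).+2)%N by lia.
Qed.

End JucysMurphy.

(* Read with [- q^-1] in place of [q], the same operators have the opposite contents; the two
   readings give transposed diagrams. *)
Theorem row_and_column_eigenvectors (F : fieldType) (B : finType) (r : nat)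
    (T : nat -> {linear {ffun B -> F^o} -> {ffun B -> F^o}}) (q : F) :
  q != 0 -> (forall n, (0 < n)%N -> q ^+ n != 1) ->
  (forall u : {ffun B -> F^o}, \sum_s u s * u s = 0 -> u = 0) ->
  (forall i u, (i.+1 < r)%N -> T i (T i u) = (q - q^-1) *: T i u + u) ->
  (forall i u, (i.+2 < r)%N -> T i (T i.+1 (T i u)) = T i.+1 (T i (T i.+1 u))) ->
  (forall i j u, (i.+1 < j)%N -> (j.+1 < r)%N -> T i (T j u) = T j (T i u)) ->
  (forall i u w, (i.+1 < r)%N -> form (T i u) w = form u (T i w)) ->
  forall (P : {ffun B -> F^o} -> Prop) u0, invariant r T P -> P u0 -> u0 != 0 ->
  exists rows rows' u u',
    [/\ decreasing_rows rows, sumn rows = r, decreasing_rows rows', sumn rows' = r &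
        forall i j, (j < nth 0%N rows i)%N = (i < nth 0%N rows' j)%N] /\
    [/\ P u, u != 0, u' != 0 & linked r T u u'] /\
    (forall i, (i.+1 < r)%N ->
       (reading 0 rows)`_i.+1 = (reading 0 rows)`_i + 1 -> T i u = q *: u) /\
    (forall i, (i.+1 < r)%N ->
       (reading 0 rows')`_i.+1 = (reading 0 rows')`_i + 1 -> T i u' = - q^-1 *: u').
Proof.
move=> q0 qr an quad braid comm adj P u0 iP Pu0 nz.
have qn0 : - q^-1 != 0 by rewrite oppr_eq0 invr_eq0.
have qnr n : (0 < n)%N -> (- q^-1) ^+ n != 1.
  move=> n0; apply/eqP => /(congr1 (fun x => x ^+ 2)).
  rewrite -exprM mulnC exprM sqrrN -exprM exprVn expr1n => /eqP; rewrite invr_eq1.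
  by apply/negP/qr; lia.
have qq : - q^-1 - (- q^-1)^-1 = q - q^-1 by rewrite invrN invrK opprK addrC.
have quad' i u : (i.+1 < r)%N -> T i (T i u) = (- q^-1 - (- q^-1)^-1) *: T i u + u.
  by rewrite qq; apply: quad.
have [c0 [w [sw Pw]]] := exists_spectral q0 quad braid comm iP Pu0 nz.
have [rows [u [su lu pu du]]] := exists_spectral_reading q0 qr an quad braid comm adj sw.
have sw' : spectral r T (- q^-1) [seq - x | x <- c0] w.
  case: sw => w0 sz hL; split=> //; first by rewrite size_map.
  move=> i hi; rewrite hL // (nth_map 0) ?sz //; congr (_ *: _).
  rewrite -!exprz_exp.
  have -> : (- q^-1) ^ 2%:Z = (q ^ 2%:Z)^-1 by rewrite -!exprnP sqrrN exprVn.
  by rewrite exprz_inv opprK.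
have [rows' [u' [su' lu' pu' du']]] := exists_spectral_reading qn0 qnr an quad' braid comm adj sw'.
exists rows, rows', u, u'; split; last split; last split.
- case: (su) => u1 sz _; case: (su') => u1' sz' _.
  rewrite !size_reading in sz sz'; split=> // i j.
  apply: reading_opp_conjugate => //; apply: perm_trans pu' _.
  by apply: perm_map; rewrite perm_sym.
- case: (su) => u1 _ _; case: (su') => u1' _ _; split=> //; first by apply/(lu _ iP).
  by move=> Q iQ; rewrite -(lu Q iQ) (lu' Q iQ).
- move=> i hi e; exact: (spectral_T q0 qr an quad braid comm adj su hi e).
- move=> i hi e; exact: (spectral_T qn0 qnr an quad' braid comm adj su' hi e).
Qed.

(* The definitions of [Defs], read over an arbitrary field: conversion over [Defs.K] would
   compute with fractions of polynomials. At [Defs.K] and [Defs.v] they are convertible to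
   the originals. *)
Module Gen.
Section Gen.
Variables (K : fieldType) (v : K).

Definition Vec (r : nat) := Idx r -> K.

Definition Mat r := Idx r -> Idx r -> K.

Definition vecmat r (x : Vec r) (F : Mat r) : Vec r :=
  fun k => \sum_(i \in [set: Idx r]) x i * F i k.

Definition mulR r (A B : Mat r) : Mat r := fun i => vecmat (A i) B.

Definition comp r (F G : Mat r) : Mat r := mulR G F.

Definition idM r : Mat r := fun i k => (i == k)%:R.
Definition addM r (F G : Mat r) : Mat r := fun i k => F i k + G i k.

Definition rowfin r (F : Mat r) := forall i, finite_set [set k | F i k != 0].

Definition Hgen r (a : 'I_r) : Mat r := fun i k =>
  let b := adjT a a in
  let si : Idx r := [ffun p => i (adjT a p)] in
  if (i a < i b)%R then (k == si)%:R
  else if i a == i b then v * (k == i)%:R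
  else (v - v^-1) * (k == i)%:R + (k == si)%:R.

Fixpoint wordmat r (ws : seq 'I_r) : Mat r :=
  if ws is a :: ws' then mulR (Hgen a) (wordmat ws') else @idM r.

Definition calT r (w : {perm 'I_r}) : Mat r := wordmat (redw w).
Definition Tw r (w : {perm 'I_r}) : Mat r := fun i k => v ^+ len w * calT w i k.

Definition inS r (F : Mat r) : Prop :=
  rowfin F /\ forall a : 'I_r, is_gen a -> mulR (Hgen a) F = mulR F (Hgen a).

Definition kproj r (lam : int -> nat) : Mat r := fun i k =>
  if pselect (content i = lam) is left _ then (i == k)%:R else 0.

Definition ymat r (lam : int -> nat) : Mat r := fun i k =>
  \sum_(w in young r (conjp r lam)) (- v ^+ 2) ^- len w * Tw w i k.

Definition zvec r (mu : int -> nat) : Vec r :=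
  mulR (Tw (wlam r mu)) (@ymat r mu) (omega r mu).

Definition is_z r (mu : int -> nat) (Z : Mat r) : Prop :=
  [/\ inS Z,
      (forall i, content i <> varpi r -> forall k, Z i k = 0)
    & forall w : {perm 'I_r},
        vecmat (calT w (omega r (varpi r))) Z = vecmat (@zvec r mu) (calT w)].

Definition MatZ (r : nat) : zmodType := (Idx r -> Idx r -> K : zmodType).
Definition regact r (F : Mat r) (X : MatZ r) : MatZ r := comp F X.

Definition Weyl r (mu : int -> nat) : MatZ r -> Prop := fun X =>
  exists G Z, [/\ inS G, is_z mu Z & X = comp G Z].

Section Modules.
Variable r : nat.
Variable M : zmodType.
Variable act : Mat r -> M -> M.

Definition Smodule : Prop :=
  [/\ forall F G m, inS F -> inS G -> act (addM F G) m = act F m + act G m,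
      forall F m n, inS F -> act F (m + n) = act F m + act F n,
      forall F G m, inS F -> inS G -> act (comp F G) m = act F (act G m)
    & forall m, act (@idM r) m = m].

Definition submod (N : M -> Prop) : Prop :=
  [/\ N 0, forall a b, N a -> N b -> N (a + b)
    & forall F m, inS F -> N m -> N (act F m)].

Definition irred (N : M -> Prop) : Prop :=
  [/\ submod N, exists m, N m /\ m <> 0
    & forall P, submod P -> (forall m, P m -> N m) ->
         (forall m, P m -> m = 0) \/ (forall m, N m -> P m)].

Definition weightmod (N : M -> Prop) : Prop :=
  dsum (fun (lam : int -> nat) m =>
          is_weight r lam /\ exists n, N n /\ m = act (@kproj r lam) n) N.

Definition compred (N : M -> Prop) : Prop :=
  exists (J : Type) (Nf : J -> M -> Prop),
    (forall j, irred (Nf j)) /\ dsum Nf N.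
End Modules.

Definition iso r (M1 M2 : zmodType) (act1 : Mat r -> M1 -> M1) (N1 : M1 -> Prop)
    (act2 : Mat r -> M2 -> M2) (N2 : M2 -> Prop) : Prop :=
  exists phi : M1 -> M2,
    [/\ forall a b, N1 a -> N1 b -> phi (a + b) = phi a + phi b,
        forall m, N1 m -> N2 (phi m),
        forall m m', N1 m -> N1 m' -> phi m = phi m' -> m = m',
        forall n, N2 n -> exists m, N1 m /\ phi m = n
      & forall F m, inS F -> N1 m -> phi (act1 F m) = act2 F (phi m)].

End Gen.
End Gen.

(** * Row-finite matrices *)

Section RowFinite.
Import Gen.
Variable K : fieldType.
Notation Mat r := (Gen.Mat K r).
Notation Vec r := (Gen.Vec K r).

Lemma vecmat_seq r (x : Vec r) (F : Mat r) (s : seq (Idx r)) k :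
  uniq s -> (forall i, x i != 0 -> i \in s) ->
  vecmat x F k = \sum_(i <- s) x i * F i k.
Proof.
move=> us hs; rewrite /vecmat (fsbigE s) //; first by apply: eq_bigl => i; rewrite in_setT.
move=> i _; apply: contraNeq => h; apply: hs.
by apply: contraNneq h => ->; rewrite mul0r.
Qed.

Lemma rowfin_seq r (F : Mat r) i : rowfin F ->
  exists s : seq (Idx r), uniq s /\ forall k, F i k != 0 -> k \in s.
Proof.
move/(_ i)/finite_seqP => [s e]; exists (undup s); split; first exact: undup_uniq.
move=> k Fk; rewrite mem_undup.
by have : [set k | F i k != 0]%classic k by []; rewrite e.
Qed.

Lemma finite_seq_sub r (A : set (Idx r)) (s : seq (Idx r)) :
  (forall k, A k -> k \in s) -> finite_set A.
Proof. by move=> h; apply: sub_finite_set (finite_seq s) => k /h. Qed.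

Lemma rowfin_mul r (F G : Mat r) : rowfin F -> rowfin G -> rowfin (mulR F G).
Proof.
move=> hF hG i; have [s [us hs]] := rowfin_seq i hF.
pose t j := xget [::] [set t : seq (Idx r) | forall k, G j k != 0 -> k \in t].
have ht j k : G j k != 0 -> k \in t j.
  rewrite /t; case: xgetP => [u _ hu|hn]; first exact: hu.
  by have [u [_ hu]] := rowfin_seq j hG; case: (hn u).
apply: (@finite_seq_sub _ _ (flatten [seq t j | j <- s])) => k /=.
rewrite /mulR (vecmat_seq _ _ us hs) => h.
have /hasP[j js hj] : has (fun j => F i j * G j k != 0) s.
  apply: contraNT h => /hasPn h; apply/eqP; rewrite big_seq big1 // => j /h.
  by rewrite negbK => /eqP.
apply/flatten_mapP; exists j => //; apply: ht.
by apply: contraNneq hj => ->; rewrite mulr0.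
Qed.

(* Row-finite matrices form an algebra under [mulR]; in this order a product acts on row
   vectors from the right, so that [comp F G] is [G * F]. *)
Definition rfm r := {F : Mat r | rowfin F}.
Definition mx r (A : rfm r) : Mat r := sval A.
Arguments mx : simpl never.

Lemma mx_inj r (A B : rfm r) : (forall i k, mx A i k = mx B i k) -> A = B.
Proof.
case: A B => [F hF] [G hG] /= e; have FG : F = G by apply/funext => i; apply/funext => k; exact: e.
by subst G; congr exist; exact: Prop_irrelevance.
Qed.

HB.instance Definition _ r := gen_eqMixin (rfm r).
HB.instance Definition _ r := gen_choiceMixin (rfm r).

Section RowFiniteAlgebra.
Variable r : nat.
Notation RF := (rfm r).

Fact rowfin_add (A B : RF) : rowfin (fun i k => mx A i k + mx B i k).
Proof.
move=> i; have [s [_ hs]] := rowfin_seq i (svalP A); have [t [_ ht]] := rowfin_seq i (svalP B).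
apply: (@finite_seq_sub _ _ (s ++ t)) => k /=; rewrite mem_cat => h.
have [e|/hs ->//] := eqVneq (mx A i k) 0; rewrite (ht k) ?orbT //.
by move: h; rewrite e add0r.
Qed.
Definition rf_add (A B : RF) : RF := exist _ _ (rowfin_add A B).

Fact rowfin_scale (c : K) (A : RF) : rowfin (fun i k => c * mx A i k).
Proof.
move=> i; have [s [_ hs]] := rowfin_seq i (svalP A).
by apply: (@finite_seq_sub _ _ s) => k /=; rewrite mulf_eq0 negb_or => /andP[_ /hs].
Qed.
Definition rf_scale (c : K) (A : RF) : RF := exist _ _ (rowfin_scale c A).

Fact rowfin0 : rowfin (fun _ _ : Idx r => (0 : K)).
Proof. by move=> i; apply: (@finite_seq_sub _ _ [::]) => k /=; rewrite eqxx. Qed.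
Definition rf_zero : RF := exist _ _ rowfin0.

Fact rowfin1 : rowfin (@idM K r).
Proof.
move=> i; apply: (@finite_seq_sub _ _ [:: i]) => k /=.
by rewrite inE /idM (eq_sym k); case: (i == k) => //=; rewrite eqxx.
Qed.
Definition rf_one : RF := exist _ _ rowfin1.

Definition rf_opp (A : RF) : RF := rf_scale (-1) A.

Definition rf_mul (A B : RF) : RF := exist _ _ (rowfin_mul (svalP A) (svalP B)).

Fact rf_addA : associative rf_add. Proof. by move=> A B C; apply: mx_inj => i k; rewrite /mx /= addrA. Qed.

Fact rf_addC : commutative rf_add. Proof. by move=> A B; apply: mx_inj => i k; rewrite /mx /= [LHS]addrC. Qed.
Fact rf_add0 : left_id rf_zero rf_add. Proof. by move=> A; apply: mx_inj => i k; rewrite /mx /= add0r. Qed.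
Fact rf_addN : left_inverse rf_zero rf_opp rf_add.
Proof. by move=> A; apply: mx_inj => i k; rewrite -[LHS]/(-1 * mx A i k + mx A i k) mulN1r addNr. Qed.
HB.instance Definition _ := GRing.isZmodule.Build RF rf_addA rf_addC rf_add0 rf_addN.

Lemma mxM_seq (A B : RF) s i k : uniq s -> (forall j, mx A i j != 0 -> j \in s) ->
  mx (rf_mul A B) i k = \sum_(j <- s) mx A i j * mx B j k.
Proof. exact: vecmat_seq. Qed.

Fact rf_mulA : associative rf_mul.
Proof.
move=> A B C; apply: mx_inj => i k.
have [s [us hs]] := rowfin_seq i (svalP A).
have [t [ut ht]] := rowfin_seq i (svalP (rf_mul A B)).
pose U j := xget [::] [set u : seq (Idx r) | forall k, mx B j k != 0 -> k \in u].
have hU j l : mx B j l != 0 -> l \in U j.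
  rewrite /U; case: xgetP => [u _ hu|hn]; first exact: hu.
  by have [u [_ hu]] := rowfin_seq j (svalP B); case: (hn u).
pose w := undup (t ++ flatten [seq U j | j <- s]).
rewrite (mxM_seq _ _ us hs) (@mxM_seq _ _ w) ?undup_uniq //; last first.
  by move=> l /ht lt; rewrite mem_undup mem_cat lt.
transitivity (\sum_(l <- w) \sum_(j <- s) mx A i j * mx B j l * mx C l k); last first.
  by apply: eq_bigr => l _; rewrite (mxM_seq _ _ us hs) mulr_suml.
rewrite exchange_big !big_seq; apply: eq_bigr => j js.
rewrite (@mxM_seq _ _ w) ?undup_uniq //; last first.
  by move=> l /hU lU; rewrite mem_undup mem_cat; apply/orP; right; apply/flatten_mapP; exists j.
by rewrite mulr_sumr; apply: eq_bigr => l _; rewrite mulrA.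
Qed.

Fact rf_mul1 : left_id rf_one rf_mul.
Proof.
move=> A; apply: mx_inj => i k; rewrite (@mxM_seq _ _ [:: i]) //; last first.
  by move=> j; rewrite inE /mx /= /idM (eq_sym j); case: (i == j) => //=; rewrite eqxx.
by rewrite big_seq1 /mx /= /idM eqxx mul1r.
Qed.

Fact rf_mulr1 : right_id rf_one rf_mul.
Proof.
move=> A; apply: mx_inj => i k; have [s [us hs]] := rowfin_seq i (svalP A).
rewrite (mxM_seq _ _ us hs); have [ks|ks] := boolP (k \in s).
  rewrite (bigD1_seq k) //= big1 ?addr0 => [|j jk]; first by rewrite /mx /= /idM eqxx mulr1.
  by rewrite /mx /= /idM (negbTE jk) mulr0.
rewrite big_seq big1 => [|j js].
  by apply/esym/eqP/negPn/negP => /hs; apply/negP.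
by rewrite /mx /= /idM; case: eqP => [e|_]; rewrite ?mulr0 //; move: ks; rewrite -e js.
Qed.

Fact rf_mulDl : left_distributive rf_mul rf_add.
Proof.
move=> A B C; apply: mx_inj => i k.
have [s [_ hs]] := rowfin_seq i (svalP A); have [t [_ ht]] := rowfin_seq i (svalP B).
have [u [_ hu]] := rowfin_seq i (svalP (rf_add A B)).
pose w := undup (s ++ t ++ u).
have e (X : RF) : (forall j, mx X i j != 0 -> j \in s ++ t ++ u) ->
    mx (rf_mul X C) i k = \sum_(j <- w) mx X i j * mx C j k.
  by move=> h; apply: mxM_seq => [|j /h]; rewrite ?undup_uniq // mem_undup.
transitivity (mx (rf_mul A C) i k + mx (rf_mul B C) i k); last by [].
rewrite !e.
- by rewrite -big_split /=; apply: eq_bigr => j _; rewrite -mulrDl.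
- by move=> j /ht; rewrite !mem_cat => ->; rewrite orbT.
- by move=> j /hs; rewrite !mem_cat => ->.
- by move=> j /hu; rewrite !mem_cat => ->; rewrite !orbT.
Qed.

Fact rf_mulDr : right_distributive rf_mul rf_add.
Proof.
move=> A B C; apply: mx_inj => i k; have [s [us hs]] := rowfin_seq i (svalP A).
transitivity (mx (rf_mul A B) i k + mx (rf_mul A C) i k); last by [].
rewrite !(mxM_seq _ _ us hs).
by rewrite -big_split /=; apply: eq_bigr => j _; rewrite -mulrDr.
Qed.

Fact rf_one_neq0 : rf_one != 0.
Proof.
apply/eqP => /(congr1 (fun A : RF => mx A [ffun=> 0] [ffun=> 0])).
by rewrite /mx /= /idM eqxx => /eqP; rewrite oner_eq0.
Qed.

HB.instance Definition _ := GRing.Zmodule_isNzRing.Build RF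
  rf_mulA rf_mul1 rf_mulr1 rf_mulDl rf_mulDr rf_one_neq0.

Fact rf_scaleA a b A : rf_scale a (rf_scale b A) = rf_scale (a * b) A.
Proof. by apply: mx_inj => i k; rewrite /mx /= mulrA. Qed.
Fact rf_scale1 : left_id 1 rf_scale. Proof. by move=> A; apply: mx_inj => i k; rewrite /mx /= mul1r. Qed.
Fact rf_scaleDr : right_distributive rf_scale +%R.
Proof. by move=> c A B; apply: mx_inj => i k; rewrite /mx /= mulrDr. Qed.
Fact rf_scaleDl A : {morph rf_scale^~ A : a b / a + b}.
Proof. by move=> a b; apply: mx_inj => i k; rewrite /mx /= mulrDl. Qed.
HB.instance Definition _ := GRing.Zmodule_isLmodule.Build K RF
  rf_scaleA rf_scale1 rf_scaleDr rf_scaleDl.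

Fact rf_scaleAl (c : K) (A B : RF) : c *: (A * B) = c *: A * B.
Proof.
apply: mx_inj => i k; have [s [us hs]] := rowfin_seq i (svalP A).
transitivity (c * mx (rf_mul A B) i k); first by [].
transitivity (mx (rf_mul (rf_scale c A) B) i k); last by [].
rewrite !(@mxM_seq _ _ s) // => [|j]; last first.
  by rewrite /mx /= mulf_eq0 negb_or => /andP[_ /hs].
by rewrite mulr_sumr; apply: eq_bigr => j _; rewrite mulrA.
Qed.
HB.instance Definition _ := GRing.Lmodule_isLalgebra.Build K RF rf_scaleAl.

Fact rf_scaleAr (c : K) (A B : RF) : c *: (A * B) = A * (c *: B).
Proof.
apply: mx_inj => i k; have [s [us hs]] := rowfin_seq i (svalP A).
transitivity (c * mx (rf_mul A B) i k); first by [].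
transitivity (mx (rf_mul A (rf_scale c B)) i k); last by [].
rewrite !(@mxM_seq _ _ s) // mulr_sumr; apply: eq_bigr => j _.
by rewrite /mx /= mulrCA.
Qed.
HB.instance Definition _ := GRing.Lalgebra_isAlgebra.Build K RF rf_scaleAr.

Lemma mxD (A B : RF) i k : mx (A + B) i k = mx A i k + mx B i k. Proof. by []. Qed.
Lemma mxZ c (A : RF) i k : mx (c *: A) i k = c * mx A i k. Proof. by []. Qed.
Lemma mx0 i k : mx (0 : RF) i k = 0. Proof. by []. Qed.
Lemma mx1 i k : mx (1 : RF) i k = (i == k)%:R. Proof. by []. Qed.
Lemma mxM (A B : RF) : mx (A * B) = mulR (mx A) (mx B). Proof. by []. Qed.
Lemma mx_sum (I : Type) (s : seq I) (P : pred I) (F : I -> RF) i k :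
  mx (\sum_(j <- s | P j) F j) i k = \sum_(j <- s | P j) mx (F j) i k.
Proof. by elim/big_rec2: _ => [|j x X _ <-]; rewrite ?mx0 ?mxD. Qed.

Lemma mxM_sum (A B : RF) s i k : uniq s -> (forall j, mx A i j != 0 -> j \in s) ->
  mx (A * B) i k = \sum_(j <- s) mx A i j * mx B j k.
Proof. exact: mxM_seq. Qed.

Lemma vecmat_mx (A B : RF) i k : vecmat (mx A i) (mx B) k = mx (A * B) i k.
Proof. by []. Qed.

Lemma mx_row_ext (A A' B : RF) i k : mx A i = mx A' i -> mx (A * B) i k = mx (A' * B) i k.
Proof. by rewrite -!vecmat_mx => ->. Qed.

Lemma mx_col_ext (A B B' : RF) i k : (forall j, mx A i j != 0 -> mx B j k = mx B' j k) ->
  mx (A * B) i k = mx (A * B') i k.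
Proof.
have [s [us hs]] := rowfin_seq i (svalP A); rewrite !(mxM_sum _ _ us hs) => h.
apply: eq_bigr => j _; have [->|/h ->//] := eqVneq (mx A i j) 0; by rewrite !mul0r.
Qed.

Lemma mx_row_delta (A B : RF) i j c k : (forall l, mx A i l = c * (j == l)%:R) ->
  mx (A * B) i k = c * mx B j k.
Proof.
move=> h; rewrite (@mxM_sum _ _ [:: j]) // => [|l].
  by rewrite big_seq1 h eqxx mulr1.
by rewrite h inE (eq_sym l); case: (j == l) => //=; rewrite mulr0 eqxx.
Qed.

Lemma mx_row_delta2 (A B : RF) i j j' c c' k :
  (forall l, mx A i l = c * (j == l)%:R + c' * (j' == l)%:R) ->
  mx (A * B) i k = c * mx B j k + c' * mx B j' k.
Proof.
move=> h; have [e|ne] := eqVneq j j'.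
  subst j'; rewrite -mulrDl; apply: mx_row_delta => l; by rewrite h mulrDl.
rewrite (@mxM_sum _ _ [:: j; j']) //= => [||l]; last 1 first.
- by rewrite h !inE !(eq_sym l); case: (j == l); case: (j' == l) => //=; rewrite !mulr0 addr0 eqxx.
- by rewrite big_cons big_seq1 !h !eqxx (negbTE ne) eq_sym (negbTE ne) !mulr1 !mulr0 addr0 add0r.
- by rewrite inE ne.
Qed.

Lemma mx_row0 (A B : RF) i k : (forall l, mx A i l = 0) -> mx (A * B) i k = 0.
Proof.
by move=> h; rewrite (@mxM_sum _ _ [::]) ?big_nil // => j; rewrite h eqxx.
Qed.

Definition trM (F : Mat r) : Mat r := fun i k => F k i.

Lemma trM_mulR (F G : Mat r) : trM (mulR F G) = mulR (trM G) (trM F).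
Proof.
apply/funext => i; apply/funext => k; rewrite /trM /mulR /vecmat.
by apply: eq_fsbigr => j _; rewrite mulrC.
Qed.

End RowFiniteAlgebra.
End RowFinite.
Arguments mx : simpl never.

(* Unification must not compare the entries of distinct matrices. *)
#[global] Opaque rf_mul rf_add rf_scale rf_one rf_zero.

(** * The Hecke action and its commutant *)

Section Hecke.
Import Gen.
Variables (K : fieldType) (v : K) (r : nat).
Notation RF := (rfm K r).
Notation S := {perm 'I_r}.
Notation delta := (v - v^-1).
Implicit Types (a : 'I_r) (w s : S) (i k : Idx r).

Definition idxM (i : Idx r) (w : S) : Idx r := [ffun p => i (w p)].

Lemma idxM_mul i s w : idxM (idxM i s) w = idxM i (w * s)%g.
Proof. by apply/ffunP => p; rewrite !ffunE permM. Qed.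
Lemma idxM1 i : idxM i 1%g = i.
Proof. by apply/ffunP => p; rewrite !ffunE perm1. Qed.

Definition hdiag a i : K :=
  if i a < i (nxt a) then 0 else if i a == i (nxt a) then v else delta.
Definition hoff a i : K := (i a != i (nxt a))%:R.

Lemma HgenE a i k :
  Hgen v a i k = hdiag a i * (i == k)%:R + hoff a i * (idxM i (adjT a) == k)%:R.
Proof.
rewrite /Hgen /hdiag /hoff -/(nxt a) -/(idxM i (adjT a)) !(eq_sym k).
by case: ltgtP => _ /=; rewrite ?mul0r ?mul1r ?add0r ?addr0.
Qed.

Fact rowfin_Hgen a : rowfin (@Hgen K v r a).
Proof.
move=> i; apply: (@finite_seq_sub _ _ [:: i; idxM i (adjT a)]) => k /=; rewrite HgenE !inE !(eq_sym k).
by case: (i == k) => //=; case: (_ == k) => //=; rewrite !mulr0 addr0 eqxx.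
Qed.
Definition Hm a : RF := exist _ _ (rowfin_Hgen a).

Lemma mx_Hm a i k :
  mx (Hm a) i k = hdiag a i * (i == k)%:R + hoff a i * (idxM i (adjT a) == k)%:R.
Proof. exact: HgenE. Qed.

Lemma mx_HmM a (A : RF) i k :
  mx (Hm a * A) i k = hdiag a i * mx A i k + hoff a i * mx A (idxM i (adjT a)) k.
Proof. by apply: mx_row_delta2 => l; exact: mx_Hm. Qed.

Lemma trM_Hgen a : is_gen a -> trM (@Hgen K v r a) = Hgen v a.
Proof.
move=> ga; apply/funext => i; apply/funext => k; rewrite /trM !HgenE.
have [<-|ik] := eqVneq k i.
  by congr (_ + _ * _%:R).
rewrite !mulr0 !add0r.
have [e|ne] := eqVneq (idxM k (adjT a)) i.
  have e' : idxM i (adjT a) = k by rewrite -e idxM_mul adjT2 // idxM1.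
  by rewrite e' eqxx /hoff -e !ffunE adjTR // eq_sym.
rewrite (_ : idxM i (adjT a) == k = false) ?mulr0 //.
by apply/eqP => e; move: ne; rewrite -e idxM_mul adjT2 // idxM1 eqxx.
Qed.

Fact rowfin_wordmat (ws : seq 'I_r) : rowfin (wordmat v ws).
Proof.
elim: ws => [|a ws IH] /=; first exact: (@rowfin1 K r).
exact: rowfin_mul (rowfin_Hgen a) IH.
Qed.
Definition Wm ws : RF := exist _ _ (rowfin_wordmat ws).

Lemma Wm_nil : Wm [::] = 1. Proof. by apply: mx_inj. Qed.
Lemma Wm_cons a ws : Wm (a :: ws) = Hm a * Wm ws. Proof. by apply: mx_inj. Qed.
Lemma Wm_cat (s1 s2 : seq _) : Wm (s1 ++ s2) = Wm s1 * Wm s2.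
Proof. by elim: s1 => [|a s IH]; rewrite ?Wm_nil ?mul1r // !Wm_cons IH mulrA. Qed.
Lemma Wm_rcons (s : seq _) a : Wm (rcons s a) = Wm s * Hm a.
Proof. by rewrite -cats1 Wm_cat Wm_cons Wm_nil mulr1. Qed.

Definition Tm w : RF := Wm (redw w).
Lemma mx_Tm w : mx (Tm w) = calT v w. Proof. by []. Qed.

Lemma Wm_monotone i ws : reduced ws -> (forall p q : 'I_r, (p <= q)%N -> i p <= i q) ->
  (forall p q : 'I_r, (p < q)%N -> i p = i q ->
     ((wordperm ws)^-1%g p < (wordperm ws)^-1%g q)%N) ->
  forall k, mx (Wm ws) i k = (idxM i (wordperm ws) == k)%:R.
Proof.
elim/last_ind: ws => [|ws a IH] red mono fib k; first by rewrite Wm_nil idxM1.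
have [rws ga up] := reduced_rcons red.
set w := wordperm ws in IH up *.
have lt : i (w a) < i (w (nxt a)).
  rewrite lt_neqAle mono ?(ltnW up) // andbT; apply/eqP => e.
  have := fib _ _ up e; rewrite wordperm_rcons invMg !permM !permK adjTV // adjTL val_nxt //.
  by lia.
have fw (p q : 'I_r) : (p < q)%N -> i p = i q -> (w^-1%g p < w^-1%g q)%N.
  move=> pq e0; have := fib p q pq e0; rewrite wordperm_rcons invMg !permM adjTV // adjT_lt //.
    apply/eqP => -[ep eq]; move: e0 lt; rewrite -eq -ep !permKV => ->.
    by rewrite ltxx.
  apply/eqP => -[ep eq]; move: pq up; rewrite -ep -eq !permKV; lia.
rewrite Wm_rcons (@mx_row_delta _ _ _ _ _ (idxM i w) 1) => [|l]; last by rewrite IH // mul1r.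
rewrite mul1r mx_Hm /hdiag /hoff !ffunE lt (lt_eqF lt) mul0r add0r mul1r.
by rewrite idxM_mul wordperm_rcons.
Qed.

Lemma Tm_monotone i w : (forall p q : 'I_r, (p <= q)%N -> i p <= i q) ->
  (forall p q : 'I_r, (p < q)%N -> i p = i q -> (w^-1%g p < w^-1%g q)%N) ->
  forall k, mx (Tm w) i k = (idxM i w == k)%:R.
Proof.
have [red e] := reduced_redw w; move=> mono fib k.
by rewrite /Tm Wm_monotone // e.
Qed.

Definition centralizes (A : RF) := forall a, is_gen a -> Hm a * A = A * Hm a.

Lemma inS_mx (A : RF) : inS v (mx A) <-> centralizes A.
Proof.
split=> [[_ h] a ga|h]; first by apply: mx_inj => i k; rewrite !mxM; have -> := h a ga.
by split=> [|a ga]; [exact: svalP | have := h a ga => /(congr1 (@mx _ _))].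
Qed.

Lemma inS_rfm F : inS v F -> exists2 A : RF, centralizes A & mx A = F.
Proof.
case=> rf h; exists (exist _ F rf) => //; apply/inS_mx; split; [exact: rf|exact: h].
Qed.

Lemma centralizesM A B : centralizes A -> centralizes B -> centralizes (A * B).
Proof. by move=> hA hB a ga; rewrite mulrA hA // -mulrA hB // mulrA. Qed.
Lemma centralizesD A B : centralizes A -> centralizes B -> centralizes (A + B).
Proof. by move=> hA hB a ga; rewrite mulrDr hA // hB // mulrDl. Qed.
Lemma centralizesZ c A : centralizes A -> centralizes (c *: A).
Proof. by move=> hA a ga; rewrite -scalerAr hA // scalerAl. Qed.
Lemma centralizes1 : centralizes 1.
Proof. by move=> a ga; rewrite mulr1 mul1r. Qed.
Lemma centralizes0 : centralizes 0.
Proof. by move=> a ga; rewrite mulr0 mul0r. Qed.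
Lemma centralizes_Wm A ws : all (@is_gen r) ws -> centralizes A -> Wm ws * A = A * Wm ws.
Proof.
move=> g hA; elim: ws g => [|a ws IH] /=; first by rewrite Wm_nil mulr1 mul1r.
by case/andP=> ga /IH h; rewrite Wm_cons -mulrA h !mulrA hA.
Qed.

Lemma centralizes_Tm A w : centralizes A -> Tm w * A = A * Tm w.
Proof. by apply: centralizes_Wm; have [/andP[]] := reduced_redw w. Qed.

Definition emb (s : S) : Idx r := [ffun p => (s p).+1%:Z].

Lemma emb_inj : injective emb.
Proof.
move=> s t /ffunP e; apply/permP => p; have := e p; rewrite !ffunE => -[h].
exact: val_inj.
Qed.

Lemma emb_eq s t : (emb s == emb t) = (s == t). Proof. exact: (inj_eq emb_inj). Qed.

Lemma idxM_emb s w : idxM (emb s) w = emb (w * s)%g.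
Proof. by apply/ffunP => p; rewrite !ffunE permM. Qed.

Lemma Tm_emb w k : mx (Tm w) (emb 1%g) k = (emb w == k)%:R.
Proof.
rewrite Tm_monotone ?idxM_emb ?mulg1 // => p q.
  by rewrite !ffunE !perm1 => h; lia.
by rewrite !ffunE !perm1 => h [e]; lia.
Qed.

(* Rows outside the weight space [varpi] vanish; on it a centralizing matrix is determined by
   its row at [emb 1]. *)
Definition on_varpi (A : RF) := forall i k, ~~ [exists s, emb s == i] -> mx A i k = 0.

Lemma on_varpiM A B : on_varpi A -> on_varpi (A * B).
Proof. by move=> h i k ni; apply: mx_row0 => l; exact: h. Qed.
Lemma on_varpiD A B : on_varpi A -> on_varpi B -> on_varpi (A + B).
Proof. by move=> hA hB i k ni; rewrite mxD hA // hB // addr0. Qed.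
Lemma on_varpiZ c A : on_varpi A -> on_varpi (c *: A).
Proof. by move=> hA i k ni; rewrite mxZ hA // mulr0. Qed.

Lemma mx_emb A s k : centralizes A -> mx A (emb s) k = mx (A * Tm s) (emb 1%g) k.
Proof.
move=> hA; rewrite -centralizes_Tm // (@mx_row_delta _ _ _ _ _ (emb s) 1) ?mul1r // => l.
by rewrite Tm_emb mul1r.
Qed.

Lemma centralizes_ext A A' : centralizes A -> centralizes A' -> on_varpi A -> on_varpi A' ->
  (forall k, mx A (emb 1%g) k = mx A' (emb 1%g) k) -> A = A'.
Proof.
move=> hA hA' oA oA' e; apply: mx_inj => i k.
have [/existsP[s /eqP <-]|ni] := boolP [exists s, emb s == i]; last by rewrite oA ?oA'.
rewrite (mx_emb s k hA) (mx_emb s k hA'); apply: mx_row_ext; exact/funext.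
Qed.

Definition unit_mx (c : K) (i j : Idx r) : Mat K r :=
  fun i' k' => c * ((i == i')%:R * (j == k')%:R).

Fact rowfin_unit c i j : rowfin (unit_mx c i j).
Proof.
move=> i'; apply: (@finite_seq_sub _ _ [:: j]) => k /=; rewrite inE (eq_sym k) /unit_mx.
by case: (j == k) => //=; rewrite !mulr0 eqxx.
Qed.
Definition Um c i j : RF := exist _ _ (rowfin_unit c i j).
Lemma mx_Um c i j i' k' : mx (Um c i j) i' k' = c * ((i == i')%:R * (j == k')%:R).
Proof. by []. Qed.

Definition block (c : S -> K) (h : S -> Idx r) : RF := \sum_s Um (c s) (emb s) (h s).

Lemma block_emb c h s k : mx (block c h) (emb s) k = c s * (h s == k)%:R.
Proof.
rewrite mx_sum (bigD1 s) //= mx_Um eqxx mul1r big1 ?addr0 // => t ts.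
by rewrite mx_Um emb_eq (negbTE ts) mul0r mulr0.
Qed.

Lemma block_on_varpi c h : on_varpi (block c h).
Proof.
move=> i k; rewrite negb_exists => /forallP ni; rewrite mx_sum big1 // => s _.
by rewrite mx_Um (negbTE (ni s)) mul0r mulr0.
Qed.

Lemma block_mul c h (A : RF) s k : mx (block c h * A) (emb s) k = c s * mx A (h s) k.
Proof. by apply: mx_row_delta => l; exact: block_emb. Qed.

End Hecke.

#[global] Opaque Hm Wm Um block.

Section Intertwiners.
Import Gen.
Variables (K : fieldType) (v : K) (r : nat).
Hypothesis v0 : v != 0.
Hypothesis sum_sqr : forall (I : eqType) (s : seq I) (f : I -> K),
  \sum_(i <- s) f i * f i = 0 -> forall i, i \in s -> f i = 0.
Notation RF := (rfm K r).
Notation S := {perm 'I_r}.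
Notation delta := (v - v^-1).
Notation Hm := (@Hm K v r).
Notation centralizes := (@centralizes K v r).
Implicit Types (a : 'I_r) (w s t : S) (i k g : Idx r).

Definition monotone g := forall p q : 'I_r, (p <= q)%N -> g p <= g q.

Lemma not_emb_idxM i a : is_gen a -> ~~ [exists s, emb s == i] -> ~~ [exists s, emb s == idxM i (adjT a)].
Proof.
move=> ga; apply: contra => /existsP[s /eqP e]; apply/existsP; exists (adjT a * s)%g.
by rewrite -idxM_emb e idxM_mul adjT2 // idxM1.
Qed.

Lemma centralizes_on_varpi (A : RF) : on_varpi A ->
  (forall a s k, is_gen a -> mx (Hm a * A) (emb s) k = mx (A * Hm a) (emb s) k) ->
  centralizes A.
Proof.
move=> oA h a ga; apply: mx_inj => i k.
have [/existsP[s /eqP <-]|ni] := boolP [exists s, emb s == i]; first exact: h.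
by rewrite mx_HmM !oA ?not_emb_idxM // !mulr0 addr0 on_varpiM.
Qed.

Lemma hdiag_emb a s : is_gen a ->
  hdiag v a (emb s) = if (s a < s (nxt a))%N then 0 else delta.
Proof.
move=> ga; rewrite /hdiag !ffunE ltz_nat ltnS; case: ifP => // _.
by rewrite eqz_nat eqSS (inj_eq val_inj) (inj_eq perm_inj) (negbTE (nxt_neq ga)).
Qed.

Lemma hoff_emb a s : is_gen a -> hoff K a (emb s) = 1.
Proof.
by move=> ga; rewrite /hoff !ffunE eqz_nat eqSS (inj_eq val_inj) (inj_eq perm_inj) nxt_neq.
Qed.

Lemma mx_HmM_emb a s (A : RF) k : is_gen a -> mx (Hm a * A) (emb s) k =
  (if (s a < s (nxt a))%N then 0 else delta) * mx A (emb s) k + mx A (emb (adjT a * s)%g) k.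
Proof. by move=> ga; rewrite mx_HmM hdiag_emb // hoff_emb // mul1r idxM_emb. Qed.

(* The map [omega_varpi h |-> omega_g h], for monotone [g]. *)
Definition collapse g : RF := block (fun s => v ^+ inv g s) (fun s => idxM g s).

Lemma collapse_emb g s k : mx (collapse g) (emb s) k = v ^+ inv g s * (idxM g s == k)%:R.
Proof. exact: block_emb. Qed.

Lemma centralizes_collapse g : monotone g -> centralizes (collapse g).
Proof.
move=> mg; apply: centralizes_on_varpi => [|a s k ga]; first exact: block_on_varpi.
rewrite mx_HmM_emb // block_mul !collapse_emb mx_Hm idxM_mul.
rewrite /hdiag /hoff !ffunE.
have [up|dn] := boolP (s a < s (nxt a))%N.
  rewrite mul0r add0r inv_adjT //.
  have /= := mg (s a) (s (nxt a)) (ltnW up); rewrite le_eqVlt; case: eqP => [e _|ne /= lt].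
    rewrite e ltxx mul0r addr0 /= exprS [v * _]mulrC -!mulrA; congr (_ * (_ * _)).
    suff -> : idxM g (adjT a * s)%g = idxM g s by [].
    apply/ffunP => p; rewrite !ffunE permM.
    have [->|pa] := eqVneq p a; first by rewrite adjTL e.
    have [->|pb] := eqVneq p (nxt a); first by rewrite adjTR // e.
    by rewrite adjTD.
  by rewrite lt mul0r add0r mul1r add0n.
set s' := (adjT a * s)%g.
have up' : (s' a < s' (nxt a))%N by rewrite up_adjT.
have es : s = (adjT a * s')%g by rewrite adjTKl.
have sa : s a = s' (nxt a) by rewrite permM adjTR.
have sb : s (nxt a) = s' a by rewrite permM adjTL.
have -> : inv g s = ((g (s' a) == g (s' (nxt a))) + inv g s')%N by rewrite {1}es inv_adjT.
rewrite sa sb; have /= := mg (s' a) (s' (nxt a)) (ltnW up').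
rewrite le_eqVlt; case: eqP => [e _|ne /= lt].
  rewrite e ltxx eqxx mul0r addr0 /= add1n exprS.
  have -> : idxM g s' = idxM g s.
    apply/ffunP => p; rewrite !ffunE permM.
    have [->|pa] := eqVneq p a; first by rewrite adjTL sb e sa.
    have [->|pb] := eqVneq p (nxt a); first by rewrite adjTR // sa -e sb.
    by rewrite adjTD.
  by move: (v ^+ inv g s') (idxM g s == k)%:R => x y; field.
rewrite ltNge (ltW lt) /= gt_eqF // add0n mul1r.
by move: (v ^+ inv g s') (idxM g s == k)%:R (idxM g s' == k)%:R => x y z; ring.
Qed.

Lemma on_varpi_transpose (A : RF) : on_varpi A -> exists A' : RF, mx A' = trM (mx A).
Proof.
move=> oA; suff h : rowfin (trM (mx A)) by exists (exist _ _ h).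
move=> k; apply: (@finite_seq_sub _ _ [seq emb s | s : S]) => i /=; rewrite /trM => ne.
have [/existsP[s /eqP <-]|ni] := boolP [exists s, emb s == i]; first exact: codom_f.
by rewrite oA // eqxx in ne.
Qed.

Lemma centralizes_transpose (A A' : RF) : mx A' = trM (mx A) -> centralizes A -> centralizes A'.
Proof.
move=> e hA a ga; suff : mx (Hm a * A') = mx (A' * Hm a).
  by move=> h; apply: mx_inj => i k; rewrite h.
have t : trM (mx (Hm a)) = mx (Hm a) by exact: trM_Hgen.
have := congr1 (fun B => trM (mx B)) (hA a ga).
by rewrite !mxM !trM_mulR -e t => ->.
Qed.

Definition gram g i : K := \sum_(s | idxM g s == i) v ^+ inv g s * v ^+ inv g s.

Lemma gram_neq0 g s : gram g (idxM g s) != 0.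
Proof.
apply/eqP; rewrite /gram -big_filter => /sum_sqr/(_ s).
rewrite mem_filter eqxx mem_index_enum => /(_ isT)/eqP.
by apply/negP; rewrite expf_neq0.
Qed.

Lemma gramE g (C : RF) i k : mx C = trM (mx (collapse g)) ->
  mx (C * collapse g) i k = gram g i * (i == k)%:R.
Proof.
move=> e; rewrite (@mxM_sum _ _ _ _ [seq emb s | s : S]).
- rewrite big_map big_enum /= /gram big_distrl /= [RHS]big_mkcond /=.
  apply: eq_bigr => s _; rewrite e /trM !collapse_emb.
  by case: eqP => [->|_] /=; rewrite ?mulr1 ?mulr0 ?mul0r ?mulrA.
- by rewrite map_inj_uniq ?enum_uniq //; exact: emb_inj.
- move=> j; rewrite e /trM => ne.
  have [/existsP[s /eqP <-]|ni] := boolP [exists s, emb s == j]; first exact: codom_f.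
  by rewrite block_on_varpi // eqxx in ne.
Qed.

Fact rowfin_diag (d : Idx r -> K) : rowfin (fun i k => d i * (i == k)%:R).
Proof.
move=> i; apply: (@finite_seq_sub _ _ [:: i]) => k /=; rewrite inE (eq_sym k).
by case: (i == k) => //=; rewrite mulr0 eqxx.
Qed.
Definition diag_rf (d : Idx r -> K) : RF := exist _ _ (rowfin_diag d).
Lemma mx_diag d i k : mx (diag_rf d) i k = d i * (i == k)%:R. Proof. by []. Qed.
#[local] Opaque diag_rf.
Lemma mx_diagM d (A : RF) i k : mx (diag_rf d * A) i k = d i * mx A i k.
Proof. by apply: mx_row_delta => l; exact: mx_diag. Qed.
Lemma mx_Mdiag d (A : RF) i k : mx (A * diag_rf d) i k = mx A i k * d k.
Proof.
rewrite (@mx_col_ext _ _ A _ (d k *: 1)) => [|j _].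
  by rewrite -scalerAr mulr1 mxZ mulrC.
by rewrite mx_diag mxZ mx1; case: eqP => [->|]; rewrite ?mulr0.
Qed.

Lemma kproj_factor lam g : monotone g ->
  (forall i, content i = lam <-> exists s, idxM g s = i) ->
  exists C B : RF, [/\ centralizes C, centralizes B, on_varpi B & mx (C * B) = kproj K lam].
Proof.
move=> mg hc; have [C eC] := on_varpi_transpose (@block_on_varpi K r (fun s => v ^+ inv g s) (fun s => idxM g s)).
have cB := centralizes_collapse mg; have cC := centralizes_transpose eC cB.
pose D := diag_rf (fun i => (gram g i)^-1).
have cD : centralizes D.
  move=> a ga; apply: mx_inj => i k.
  have eG : C * collapse g = diag_rf (gram g) by apply: mx_inj => i' k'; rewrite (gramE _ _ eC).
  have := centralizesM cC cB ga => /(congr1 (fun A => mx A i k)); rewrite eG.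
  have e1 d : mx (Hm a * diag_rf d) i k = mx (Hm a) i k * d k := mx_Mdiag _ _ _ _.
  have e2 d : mx (diag_rf d * Hm a) i k = d i * mx (Hm a) i k := mx_diagM _ _ _ _.
  rewrite !e1 !e2; have [->|ne] := eqVneq (mx (Hm a) i k) 0; first by rewrite !mulr0 !mul0r.
  by move=> e; have/(mulfI ne) -> : mx (Hm a) i k * gram g k = mx (Hm a) i k * gram g i; rewrite [RHS]mulrC.
exists (D * C), (collapse g); split=> //; [exact: centralizesM|exact: block_on_varpi|].
apply/funext => i; apply/funext => k; rewrite -mulrA mx_diagM (gramE _ _ eC) mulrA /kproj.
case: pselect => [/hc[s <-]|nc]; first by rewrite mulVf ?gram_neq0 // mul1r.
suff -> : gram g i = 0 by rewrite mulr0 mul0r.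
by rewrite /gram big1 // => s /eqP e; case: nc; apply/hc; exists s.
Qed.

Lemma monotone_emb1 : monotone (emb 1%g).
Proof. by move=> p q pq; rewrite !ffunE !perm1. Qed.

Definition proj_varpi : RF := block (fun=> 1) (@emb r).

Lemma proj_varpi_collapse : proj_varpi = collapse (emb 1%g).
Proof.
apply: eq_bigr => s _; rewrite idxM_emb mulg1 /inv.
rewrite (_ : inv_set _ _ = finset.set0) ?cards0 //; apply/setP => -[p q].
rewrite !inE /=; apply/negbTE/negP => /and3P[_ gt /eqP].
by rewrite !ffunE !perm1 => -[e]; move: gt; rewrite e ltnn.
Qed.

Lemma centralizes_proj_varpi : centralizes proj_varpi.
Proof. rewrite proj_varpi_collapse; exact/centralizes_collapse/monotone_emb1. Qed.

Lemma on_varpi_proj : on_varpi proj_varpi. Proof. exact: block_on_varpi. Qed.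

Lemma proj_varpi_mul (A : RF) : on_varpi A <-> proj_varpi * A = A.
Proof.
split=> [oA|<-]; last by apply: on_varpiM; exact: on_varpi_proj.
apply: mx_inj => i k.
have [/existsP[s /eqP <-]|ni] := boolP [exists s, emb s == i]; last first.
  by rewrite (on_varpiM _ on_varpi_proj) // oA.
by rewrite block_mul mul1r.
Qed.

End Intertwiners.

Section LeftHecke.
Import Gen.
Variables (K : fieldType) (v : K) (r : nat).
Hypothesis v0 : v != 0.
Notation RF := (rfm K r).
Notation S := {perm 'I_r}.
Notation delta := (v - v^-1).
Notation Hm := (@Hm K v r).
Notation Tm := (@Tm K v r).
Notation Wm := (@Wm K v r).
Notation centralizes := (@centralizes K v r).
Notation P := (proj_varpi K r).
Implicit Types (a : 'I_r) (w s t : S) (i k g : Idx r).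

(* Left multiplication by a generator on the weight space [varpi] (the regular representation):
   it exchanges values instead of positions. *)
Definition theta_diag a s : K := if (s^-1%g a < s^-1%g (nxt a))%N then 0 else delta.
Definition theta a : RF :=
  block (theta_diag a) (@emb r) + block (fun=> 1) (fun s => emb (s * adjT a)%g).

Lemma theta_on_varpi a : on_varpi (theta a).
Proof. by apply: on_varpiD; exact: block_on_varpi. Qed.

Lemma theta_mul a (A : RF) s k :
  mx (theta a * A) (emb s) k = theta_diag a s * mx A (emb s) k + mx A (emb (s * adjT a)%g) k.
Proof. by rewrite mulrDl mxD !block_mul mul1r. Qed.

Lemma theta_emb a s k :
  mx (theta a) (emb s) k = theta_diag a s * (emb s == k)%:R + (emb (s * adjT a)%g == k)%:R.
Proof. by rewrite mxD !block_emb mul1r. Qed.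

#[local] Opaque theta.

Lemma theta_up a (A : RF) s k : (s^-1%g a < s^-1%g (nxt a))%N ->
  mx (theta a * A) (emb s) k = mx A (emb (s * adjT a)%g) k.
Proof. by move=> up; rewrite theta_mul /theta_diag up mul0r add0r. Qed.

Definition hecke_diag c s : K := if (s c < s (nxt c))%N then 0 else delta.

Lemma left_right_diag a c s : is_gen a -> is_gen c ->
  ((adjT c * s = s * adjT a)%g /\ hecke_diag c s = theta_diag a s) \/
  (theta_diag a (adjT c * s)%g = theta_diag a s /\ hecke_diag c (s * adjT a)%g = hecke_diag c s).
Proof.
move=> ga gc; rewrite /theta_diag /hecke_diag invMg !permM adjTV //.
have conj : (adjT c * s = s * tperm (s c) (s (nxt c)))%g by rewrite (adjTE gc) -tpermJ /conjg !mulgA mulgV mul1g.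
have [[e1 e2]|ne] := eqVneq (s c, s (nxt c)) (a, nxt a).
  left; split; first by rewrite conj e1 e2 -adjTE.
  have e1' : s^-1%g a = c by rewrite -e1 permK.
  have e2' : s^-1%g (nxt a) = nxt c by rewrite -e2 permK.
  by rewrite e1 e2 e1' e2' !val_nxt // !ltnSn.
have [[e1 e2]|ne'] := eqVneq (s c, s (nxt c)) (nxt a, a).
  left; split; first by rewrite conj e1 e2 tpermC -adjTE.
  have e1' : s^-1%g (nxt a) = c by rewrite -e1 permK.
  have e2' : s^-1%g a = nxt c by rewrite -e2 permK.
  by rewrite e1 e2 e1' e2' !val_nxt // !ltnNge !leqnSn.
right; split; rewrite ?permM adjT_lt //.
  by apply: contra ne => /eqP[e1 e2]; rewrite -e2 -e1 !permKV.
by apply: contra ne' => /eqP[e1 e2]; rewrite -e1 -e2 !permKV.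
Qed.

Lemma theta_diag_down a s : is_gen a -> theta_diag a s + theta_diag a (s * adjT a)%g = delta.
Proof.
move=> ga; rewrite /theta_diag invMg !permM adjTV // adjTL adjTR //.
have ne : s^-1%g a != s^-1%g (nxt a) by rewrite (inj_eq perm_inj) nxt_neq.
by rewrite (lt_or_gt s^-1%g (nxt_neq ga)); case: ifP => _; rewrite ?add0r ?addr0.
Qed.

Lemma centralizes_theta a : is_gen a -> centralizes (theta a).
Proof.
move=> ga; apply: centralizes_on_varpi => [|c s k gc]; first exact: theta_on_varpi.
rewrite mx_HmM_emb // theta_mul -[Hm c]mulr1 !mx_HmM_emb // !mx1 !theta_emb.
rewrite mulgA.
rewrite -/(hecke_diag c s) -/(hecke_diag c (s * adjT a)%g).
case: (left_right_diag s ga gc) => -[e1 e2]; last first.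
  by rewrite e1 e2; move: (theta_diag a s) (hecke_diag c s) => x y; ring.
have hd : hecke_diag c s + hecke_diag c (adjT c * s)%g = delta.
  by rewrite /hecke_diag up_adjT //; case: ifP; rewrite ?addr0 ?add0r.
have -> : hecke_diag c (s * adjT a)%g = delta - hecke_diag c s by rewrite -e1 -hd addrAC subrr add0r.
have -> : theta_diag a (adjT c * s)%g = delta - theta_diag a s.
  by rewrite e1 -(theta_diag_down s ga) addrAC subrr add0r.
by rewrite -e1 e2; move: (theta_diag a s) => x; ring.
Qed.

Lemma P_emb s k : mx P (emb s) k = (emb s == k)%:R.
Proof. by rewrite /proj_varpi block_emb mul1r. Qed.

Lemma mulP_on_varpi (A : RF) : on_varpi A -> P * A = A.
Proof. by move/proj_varpi_mul. Qed.

Lemma mx_emb_eq (A B : RF) : on_varpi A -> on_varpi B ->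
  (forall s k, mx A (emb s) k = mx B (emb s) k) -> A = B.
Proof.
move=> oA oB h; apply: mx_inj => i k.
have [/existsP[s /eqP <-]|ni] := boolP [exists s, emb s == i]; first exact: h.
by rewrite oA ?oB.
Qed.

(* The corner of the centralizer cut out by [varpi], that is the left regular
   representation of the Hecke algebra. *)
Definition corner (A : RF) := [/\ centralizes A, on_varpi A & A * P = A].

Lemma cornerM A B : corner A -> corner B -> corner (A * B).
Proof.
case=> cA oA eA [cB oB eB].
by split; [exact: centralizesM|exact: on_varpiM|rewrite -mulrA eB].
Qed.
Lemma cornerD A B : corner A -> corner B -> corner (A + B).
Proof.
case=> cA oA eA [cB oB eB].
by split; [exact: centralizesD|exact: on_varpiD|rewrite mulrDl eA eB].
Qed.
Lemma cornerZ c A : corner A -> corner (c *: A).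
Proof.
case=> cA oA eA.
by split; [exact: centralizesZ|exact: on_varpiZ|rewrite -scalerAl eA].
Qed.
Lemma corner_P : corner P.
Proof.
split; [exact: centralizes_proj_varpi|exact: on_varpi_proj|].
exact/mulP_on_varpi/on_varpi_proj.
Qed.
Lemma corner_sum (I : Type) (l : seq I) (Q : pred I) (F : I -> RF) :
  (forall j, Q j -> corner (F j)) -> corner (\sum_(j <- l | Q j) F j).
Proof.
move=> h; elim/big_ind: _ => //; last exact: cornerD.
by have := cornerZ 0 corner_P; rewrite scale0r.
Qed.

Lemma corner_ext A B : corner A -> corner B ->
  (forall k, mx A (emb 1%g) k = mx B (emb 1%g) k) -> A = B.
Proof. by case=> cA oA _ [cB oB _]; exact: centralizes_ext cA cB oA oB. Qed.

Lemma corner_theta a : is_gen a -> corner (theta a).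
Proof.
move=> ga; split; [exact: centralizes_theta|exact: theta_on_varpi|].
apply: mx_emb_eq => [||s k]; [exact/on_varpiM/theta_on_varpi|exact: theta_on_varpi|].
by rewrite theta_mul theta_emb !P_emb.
Qed.

Lemma theta_diag1 a : is_gen a -> theta_diag a 1%g = 0.
Proof. by move=> ga; rewrite /theta_diag invg1 !perm1 val_nxt // ltnSn. Qed.

Lemma theta_quad a : is_gen a -> theta a * theta a = delta *: theta a + P.
Proof.
move=> ga; have ct := corner_theta ga; apply: corner_ext => [||k].
- exact: cornerM.
- by apply: cornerD; [exact: cornerZ|exact: corner_P].
rewrite theta_mul [RHS]mxD mxZ !theta_emb P_emb theta_diag1 // !mul1g adjT2 //.
have -> : theta_diag a (adjT a) = delta.
  by have := theta_diag_down 1%g ga; rewrite theta_diag1 // add0r mul1g.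
by ring.
Qed.

Lemma theta_braid a c : is_gen a -> is_gen c -> nxt a = c ->
  theta a * theta c * theta a = theta c * theta a * theta c.
Proof.
move=> ga gc e; have [va vc] := (val_nxt ga, val_nxt gc).
have ct x y : is_gen x -> is_gen y -> corner (theta x * theta y * theta x).
  by move=> gx gy; apply: cornerM; [apply: cornerM|]; exact: corner_theta.
have ac : nxt c != a by rewrite -val_eqE /= vc -e va; lia.
have ac' : nxt c != nxt a by rewrite -val_eqE /= vc -e va; lia.
have ca : a != c by rewrite -val_eqE /= -e va; lia.
have ca' : a != nxt c by rewrite eq_sym.
have ab : adjT a c = a by rewrite -e adjTR.
have ac2 : adjT a (nxt c) = nxt c by rewrite adjTD.
have cb : adjT c c = nxt c by [].
have cc : adjT c (nxt c) = c by rewrite adjTR.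
have ca2 : adjT c a = a by rewrite adjTD.
have aa : adjT a a = c by [].
apply: corner_ext => [||k]; [exact: ct|exact: ct|].
rewrite -!mulrA theta_up ?invg1 ?perm1 ?va // mul1g.
rewrite theta_up; last by rewrite adjTV // ab ac2 vc -e va; lia.
rewrite -[theta a in LHS]mulr1 theta_up; last first.
  by rewrite invMg !adjTV // !permM e ca2 cb aa ac2 vc; lia.
rewrite [RHS]theta_up ?invg1 ?perm1 ?vc // mul1g.
rewrite [RHS]theta_up; last by rewrite adjTV // e ca2 cb vc -e va; lia.
rewrite -[theta c in RHS]mulr1 theta_up; last first.
  by rewrite invMg !adjTV // !permM ab ac2 ca2 cc -e va; lia.
congr (mx 1 (emb _) k).
have conj x y : is_gen x -> is_gen y -> (adjT x * adjT y * adjT x)%g = tperm (adjT x y) (adjT x (nxt y)).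
  by move=> gx gy; rewrite -tpermJ -adjTE // /conjg adjTV // mulgA.
by rewrite !conj // ab ac2 ca2 e cb.
Qed.

Lemma theta_comm a c : is_gen a -> is_gen c -> (a.+1 < c)%N ->
  theta a * theta c = theta c * theta a.
Proof.
move=> ga gc lt; have [va vc] := (val_nxt ga, val_nxt gc).
have n1 : c != a by rewrite -val_eqE /=; lia.
have n2 : c != nxt a by rewrite -val_eqE /= va; lia.
have n3 : nxt c != a by rewrite -val_eqE /= vc; lia.
have n4 : nxt c != nxt a by rewrite -val_eqE /= vc va; lia.
have ct x y : is_gen x -> is_gen y -> corner (theta x * theta y).
  by move=> gx gy; apply: cornerM; exact: corner_theta.
apply: corner_ext => [||k]; [exact: ct|exact: ct|].
rewrite theta_up ?invg1 ?perm1 ?va // mul1g -[theta c in LHS]mulr1 theta_up; last first.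
  by rewrite adjTV // !adjTD // vc.
rewrite [RHS]theta_up ?invg1 ?perm1 ?vc // mul1g -[theta a in RHS]mulr1 theta_up; last first.
  by rewrite adjTV // !adjTD ?va // eq_sym.
congr (mx 1 (emb _) k); rewrite [RHS]conjgC.
by rewrite (adjTE gc) tpermJ !adjTD.
Qed.

Fixpoint theta_word (ws : seq 'I_r) : RF :=
  if ws is a :: ws' then theta_word ws' * theta a else P.

Lemma corner_theta_word ws : all (@is_gen r) ws -> corner (theta_word ws).
Proof.
elim: ws => [|a ws IH] /=; first by move=> _; exact: corner_P.
by case/andP=> ga /IH h; apply: cornerM => //; exact: corner_theta.
Qed.

Lemma theta_word_row ws k : all (@is_gen r) ws ->
  mx (theta_word ws) (emb 1%g) k = mx (Wm ws) (emb 1%g) k.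
Proof.
elim: ws k => [|a ws IH] k /=; first by rewrite Wm_nil P_emb mx1.
case/andP=> ga gws; rewrite (@mx_row_ext _ _ _ (Wm ws)); last by apply/funext => l; exact: IH.
rewrite centralizes_Wm //; last exact: centralizes_theta.
rewrite Wm_cons; apply: mx_row_ext; apply/funext => l.
rewrite -[Hm a]mulr1 mx_HmM_emb // theta_emb theta_diag1 // !perm1 val_nxt // ltnSn.
by rewrite !mx1 !mul0r mul1g mulg1.
Qed.

Definition theta_perm w : RF := theta_word (redw w).

Lemma corner_theta_perm w : corner (theta_perm w).
Proof. by apply: corner_theta_word; have [/andP[]] := reduced_redw w. Qed.

Lemma theta_perm_row w k : mx (theta_perm w) (emb 1%g) k = mx (Tm w) (emb 1%g) k.
Proof. by apply: theta_word_row; have [/andP[]] := reduced_redw w. Qed.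

End LeftHecke.

Section Columns.
Import Gen.
Variables (K : fieldType) (v : K) (r : nat).
Hypothesis v0 : v != 0.
Hypothesis v_root : forall n, (0 < n)%N -> v ^+ n != 1.
Hypothesis sum_sqr : forall (I : eqType) (s : seq I) (f : I -> K),
  \sum_(i <- s) f i * f i = 0 -> forall i, i \in s -> f i = 0.
Notation RF := (rfm K r).
Notation S := {perm 'I_r}.
Notation V := {ffun S -> K^o}.
Notation delta := (v - v^-1).
Notation corner := (@corner K v r).
Notation theta := (@theta K v r).
Notation P := (proj_varpi K r).
Implicit Types (a : 'I_r) (w s t : S) (i k g : Idx r).

Definition colact (A : RF) (f : V) : V := [ffun s => \sum_t mx A (emb s) (emb t) * f t].

Lemma col_linear A c (f h : V) : colact A (c *: f + h) = c *: colact A f + colact A h.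
Proof.
apply/ffunP => s; rewrite !ffunE /GRing.scale /= mulr_sumr -big_split /=.
by apply: eq_bigr => t _; rewrite !ffunE /GRing.scale /= mulrDr mulrCA.
Qed.

HB.instance Definition _ A := GRing.isLinear.Build K V V _ (colact A) (col_linear A).

Lemma colD A B f : colact (A + B) f = colact A f + colact B f.
Proof.
apply/ffunP => s; rewrite !ffunE -big_split /=.
by apply: eq_bigr => t _; rewrite mxD mulrDl.
Qed.

Lemma colZ c A f : colact (c *: A) f = c *: colact A f.
Proof.
apply/ffunP => s; rewrite !ffunE /GRing.scale /= mulr_sumr.
by apply: eq_bigr => t _; rewrite mxZ mulrA.
Qed.

Lemma col0 f : colact 0 f = 0.
Proof. by rewrite -[0 in LHS](scale0r (0 : RF)) colZ scale0r. Qed.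

Lemma col_sum (I : Type) (l : seq I) (Q : pred I) (F : I -> RF) f :
  colact (\sum_(j <- l | Q j) F j) f = \sum_(j <- l | Q j) colact (F j) f.
Proof. by elim/big_rec2: _ => [|j x X _ <-]; rewrite ?col0 ?colD. Qed.

Lemma mulP_support (A : RF) i j : A * P = A -> ~~ [exists s, emb s == j] -> mx A i j = 0.
Proof.
move=> <- nj; rewrite (@mx_col_ext _ _ A _ 0) => [|l _]; first by rewrite mulr0 mx0.
rewrite mx0; have [/existsP[s /eqP <-]|nl] := boolP [exists s, emb s == l]; last by rewrite on_varpi_proj.
rewrite P_emb; case: eqP => // e; case/existsP: nj; by exists s; apply/eqP.
Qed.

Lemma colM A B f : A * P = A -> colact (A * B) f = colact A (colact B f).
Proof.
move=> eA; apply/ffunP => s; rewrite !ffunE.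
under [RHS]eq_bigr do rewrite ffunE mulr_sumr.
rewrite exchange_big /=; apply: eq_bigr => t _.
rewrite (@mxM_sum _ _ _ _ [seq emb t | t : S]).
- rewrite big_map big_enum /= mulr_suml; apply: eq_bigr => w _; by rewrite mulrA.
- by rewrite map_inj_uniq ?enum_uniq //; exact: emb_inj.
- move=> j ne; have [/existsP[w /eqP <-]|nj] := boolP [exists s, emb s == j]; first exact: codom_f.
  by rewrite mulP_support // eqxx in ne.
Qed.

Lemma col_P f : colact P f = f.
Proof.
apply/ffunP => s; rewrite ffunE (bigD1 s) //= P_emb eqxx mul1r big1 ?addr0 // => t ts.
by rewrite P_emb emb_eq eq_sym (negbTE ts) mul0r.
Qed.

Lemma col_theta a f s : colact (theta a) f s = theta_diag v a s * f s + f (s * adjT a)%g.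
Proof.
rewrite ffunE; under eq_bigr do rewrite theta_emb !emb_eq mulrDl.
rewrite big_split /= (bigD1 s) //= eqxx mulr1 big1 ?addr0 => [|t ts]; last first.
  by rewrite eq_sym (negbTE ts) mulr0 mul0r.
rewrite (bigD1 (s * adjT a)%g) //= eqxx mul1r big1 ?addr0 // => t ts.
by rewrite eq_sym (negbTE ts) mul0r.
Qed.

Lemma form_col_theta a (f h : V) : is_gen a -> form (colact (theta a) f) h = form f (colact (theta a) h).
Proof.
move=> ga; rewrite /form.
under eq_bigr do rewrite col_theta mulrDl.
under [RHS]eq_bigr do rewrite col_theta mulrDr.
rewrite !big_split /=; congr (_ + _); first by apply: eq_bigr => s _; rewrite mulrCA mulrA.
rewrite (reindex_inj (mulIg (adjT a))) /=; apply: eq_bigr => s _.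
by rewrite -mulgA adjT2 // mulg1.
Qed.

Definition gen_theta (i : nat) : RF := if insub i is Some a then theta a else 0.

Lemma gen_thetaE (i : nat) (h : (i.+1 < r)%N) : exists a : 'I_r, [/\ is_gen a, a = i :> nat & gen_theta i = theta a].
Proof.
exists (Ordinal (ltnW h)); split=> //; rewrite /gen_theta; case: insubP => [a _ e|]; last by rewrite (ltnW h).
by congr (theta _); apply: val_inj.
Qed.

Lemma val_gen_theta a : gen_theta a = theta a.
Proof. by rewrite /gen_theta -[nat_of_ord a]/(val a) valK. Qed.

Lemma jucys_murphy_columns (n : V) : n != 0 ->
  exists rows rows' (A1 A2 : RF),
    [/\ decreasing_rows rows, sumn rows = r, decreasing_rows rows', sumn rows' = r &
        forall i j : nat, (j < nth 0%N rows i)%N = (i < nth 0%N rows' j)%N] /\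
    [/\ corner A1, corner A2, colact A1 n != 0 & colact A2 (colact A1 n) != 0] /\
    (forall a, is_gen a -> (reading 0 rows)`_a.+1 = (reading 0 rows)`_a + 1 ->
       colact (theta a) (colact A1 n) = v *: colact A1 n) /\
    (forall a, is_gen a -> (reading 0 rows')`_a.+1 = (reading 0 rows')`_a + 1 ->
       colact (theta a) (colact A2 (colact A1 n)) = - v^-1 *: colact A2 (colact A1 n)).
Proof.
move=> n0; pose T (i : nat) : {linear V -> V} := colact (gen_theta i).
have an (u : V) : \sum_s u s * u s = 0 -> u = 0.
  by move=> /sum_sqr h; apply/ffunP => s; rewrite ffunE h // mem_index_enum.
have quad (i : nat) u : (i.+1 < r)%N -> T i (T i u) = delta *: T i u + u.
  move=> hi; rewrite /T /=; have [a [ga _ ->]] := gen_thetaE hi.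
  have [_ _ eP] := corner_theta v ga.
  by rewrite -colM // theta_quad // colD colZ col_P.
have braid (i : nat) u : (i.+2 < r)%N -> T i (T i.+1 (T i u)) = T i.+1 (T i (T i.+1 u)).
  move=> hi; rewrite /T /=; have [a [ga va ->]] := gen_thetaE (ltnW hi); have [c [gc vc ->]] := gen_thetaE hi.
  have [ca cc] := (corner_theta v ga, corner_theta v gc).
  have [[_ _ ea] [_ _ ec]] := (ca, cc).
  rewrite -(colM _ _ ec) -(colM _ _ ea) -(colM _ _ ea) -(colM _ _ ec) !mulrA theta_braid //.
  by apply: val_inj; rewrite /= val_nxt // va vc.
have comm (i j : nat) u : (i.+1 < j)%N -> (j.+1 < r)%N -> T i (T j u) = T j (T i u).
  move=> ij hj; have hi : (i.+1 < r)%N by lia.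
  rewrite /T /=; have [a [ga va ->]] := gen_thetaE hi; have [c [gc vc ->]] := gen_thetaE hj.
  have [[_ _ ea] [_ _ ec]] := (corner_theta v ga, corner_theta v gc).
  by rewrite -!colM // theta_comm // va vc.
have adj (i : nat) u (w : V) : (i.+1 < r)%N -> form (T i u) w = form u (T i w).
  by move=> hi; rewrite /T /=; have [a [ga _ ->]] := gen_thetaE hi; exact: form_col_theta.
have inv (u : V) : invariant r T (fun x => exists2 A, corner A & x = colact A u).
  split=> [c x y [A cA ->] [B cB ->]|i x hi [A cA ->]].
    by exists (c *: A + B); [apply: cornerD => //; exact: cornerZ | rewrite colD colZ].
  rewrite /T /=; have [a [ga _ ->]] := gen_thetaE hi.
  have ca := corner_theta v ga; have [_ _ ea] := ca.
  by exists (theta a * A); [exact: cornerM | rewrite colM].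
have cP := corner_P r v0.
have [|rows [rows' [u [u' [h1 [[[A1 c1 e1] u0 u0' lk] [h2 h3]]]]]]] :=
  row_and_column_eigenvectors v0 v_root an quad braid comm adj (inv n) _ n0.
  by exists P; rewrite ?col_P.
have [A2 c2 e2] : exists2 A, corner A & u' = colact A u.
  by apply/(lk _ (inv u)); exists P; rewrite ?col_P.
subst u u'; exists rows, rows', A1, A2; do !split=> //.
- move=> a ga e; have := h2 a ga e; by rewrite /T /= val_gen_theta.
- move=> a ga e; have := h3 a ga e; by rewrite /T /= val_gen_theta.
Qed.

End Columns.

Section YoungSubgroups.
Variable r : nat.
Notation S := {perm 'I_r}.
Implicit Types (a : 'I_r) (w s t : S) (i k g : Idx r).

Lemma len_invg w : len w^-1%g = len w.
Proof.
pose f (pq : 'I_r * 'I_r) := (w pq.2, w pq.1).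
have finj : injective f by move=> [p q] [p' q'] [/perm_inj -> /perm_inj ->].
rewrite /len -[RHS](card_imset _ finj); apply: eq_card => -[x y]; rewrite inE /=.
apply/idP/imsetP => [/andP[h1 h2]|[[p q]]].
  by exists (w^-1%g y, w^-1%g x); rewrite ?inE /f /= !permKV // h1 h2.
by rewrite inE /= => /andP[h1 h2] [-> ->]; rewrite !permK h1 h2.
Qed.

Lemma len_upl a w : is_gen a -> (w^-1%g a < w^-1%g (nxt a))%N -> len (w * adjT a)%g = (len w).+1.
Proof. by move=> ga up; rewrite -len_invg invMg adjTV // len_up // len_invg. Qed.

Lemma len_downl a w : is_gen a -> ~~ (w^-1%g a < w^-1%g (nxt a))%N -> len w = (len (w * adjT a)%g).+1.
Proof. by move=> ga dn; rewrite -len_invg (len_down ga dn) -len_invg invMg invgK adjTV. Qed.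

Lemma block_increasing g (f : 'I_r -> int) : monotone g ->
  (forall a, is_gen a -> g (nxt a) = g a -> f a < f (nxt a)) ->
  forall p q : 'I_r, (p < q)%N -> g p = g q -> f p < f q.
Proof.
move=> mg h p q; have [n] := ubnP (q - p)%N; elim: n q => // n IH q lt pq e.
have rq := ltn_ord q; have hq : (q.-1 < r)%N by lia.
pose c := Ordinal hq; have gc : is_gen c by rewrite /is_gen /=; lia.
have eq : q = nxt c by apply: val_inj; rewrite /= val_nxt //=; lia.
have gcq : g (nxt c) = g c.
  apply/le_anti/andP; split; first by rewrite -eq -e; apply: mg => /=; lia.
  by apply: mg; rewrite -eq /=; lia.
have [epc|ne] := eqVneq p c; first by rewrite eq epc; apply: h.
apply: lt_trans (_ : f c < _); last by rewrite eq; exact: h.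
have pc : (p < c)%N by move: ne; rewrite -val_eqE /=; lia.
by apply: IH => //=; [lia | rewrite -gcq -eq].
Qed.

Definition ygrp g : {set S} := [set t : S | [forall p, g (t p) == g p]].

Lemma ygrpP g t : reflect (forall p, g (t p) = g p) (t \in ygrp g).
Proof. by rewrite inE; apply: (iffP forallP) => h p; [exact/eqP|apply/eqP]. Qed.

Lemma ygrp1 g : 1%g \in ygrp g. Proof. by apply/ygrpP => p; rewrite perm1. Qed.
Lemma ygrpM g s t : s \in ygrp g -> t \in ygrp g -> (s * t)%g \in ygrp g.
Proof. by move=> /ygrpP hs /ygrpP ht; apply/ygrpP => p; rewrite permM ht hs. Qed.
Lemma ygrpV g s : s \in ygrp g -> s^-1%g \in ygrp g.
Proof. by move=> /ygrpP hs; apply/ygrpP => p; rewrite -hs permKV. Qed.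
Lemma ygrp_adjT g a : is_gen a -> g (nxt a) = g a -> adjT a \in ygrp g.
Proof.
move=> ga e; apply/ygrpP => p.
have [->|pa] := eqVneq p a; first by rewrite adjTL.
have [->|pb] := eqVneq p (nxt a); first by rewrite adjTR.
by rewrite adjTD.
Qed.
Lemma ygrp_idxM g s t : (idxM g s == idxM g t) = ((s^-1 * t)%g \in ygrp g).
Proof.
apply/eqP/ygrpP => [/ffunP e p|h].
  by have := e (s^-1%g p); rewrite !ffunE permKV permM.
by apply/ffunP => p; rewrite !ffunE; have := h (s p); rewrite permM permK.
Qed.

Lemma reduced_ygrp_rcons g ws a : monotone g -> reduced (rcons ws a) ->
  wordperm (rcons ws a) \in ygrp g ->
  [/\ reduced ws, is_gen a, wordperm ws \in ygrp g, g (nxt a) = g a &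
      (wordperm ws a < wordperm ws (nxt a))%N].
Proof.
move=> mg red; have [rws ga up] := reduced_rcons red.
rewrite wordperm_rcons => /ygrpP h; set w := wordperm ws in up h *.
have e : g (nxt a) = g a.
  apply/eqP; rewrite eq_le; apply/andP; split; last by apply: mg; rewrite val_nxt.
  have <- := h (nxt a); have <- := h a; rewrite !permM adjTL adjTR //.
  exact/mg/ltnW.
split=> //; apply/ygrpP => p.
by have := h (adjT a p); rewrite permM adjTK // => ->; apply/ygrpP/ygrp_adjT.
Qed.

Lemma reduced_ygrp g ws : monotone g -> reduced ws -> wordperm ws \in ygrp g ->
  all (fun a => is_gen a && (g (nxt a) == g a)) ws.
Proof.
move=> mg; elim/last_ind: ws => // ws a IH red yw.
have [rws ga yws e _] := reduced_ygrp_rcons mg red yw.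
by rewrite all_rcons ga e eqxx IH.
Qed.

Lemma inv_ygrp g t : monotone g -> t \in ygrp g -> inv g t = len t.
Proof.
move=> mg /ygrpP ht; apply: eq_card => -[p q]; rewrite !inE /=.
case: ltnP => //= pq; case: ltnP => //= qp; rewrite !ht; apply/eqP/eqP; rewrite eq_le mg ?(ltnW pq) //=.
by have := mg (t q) (t p) (ltnW qp); rewrite !ht.
Qed.

Lemma size_redw w : size (redw w) = len w.
Proof. by have [/andP[_ /eqP <-] ->] := reduced_redw w. Qed.

End YoungSubgroups.

Section Young.
Import Gen.
Variables (K : fieldType) (v : K) (r : nat).
Hypothesis v0 : v != 0.
Hypothesis v_root : forall n, (0 < n)%N -> v ^+ n != 1.
Hypothesis sum_sqr : forall (I : eqType) (s : seq I) (f : I -> K),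
  \sum_(i <- s) f i * f i = 0 -> forall i, i \in s -> f i = 0.
Notation RF := (rfm K r).
Notation S := {perm 'I_r}.
Notation V := {ffun S -> K^o}.
Notation Hm := (@Hm K v r).
Notation Tm := (@Tm K v r).
Notation Wm := (@Wm K v r).
Notation centralizes := (@centralizes K v r).
Notation corner := (@corner K v r).
Notation theta := (@theta K v r).
Notation theta_perm := (@theta_perm K v r).
Notation collapse := (@collapse K v r).
Notation P := (proj_varpi K r).
Implicit Types (a : 'I_r) (w s t : S) (i k g : Idx r).

Lemma Wm_strict g i ws : monotone g ->
  (forall p q : 'I_r, (p < q)%N -> g p = g q -> i p < i q) ->
  reduced ws -> wordperm ws \in ygrp g ->
  forall k, mx (Wm ws) i k = (idxM i (wordperm ws) == k)%:R.
Proof.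
move=> mg si; elim/last_ind: ws => [|ws a IH] red yw k; first by rewrite Wm_nil idxM1.
have [rws ga yws e up] := reduced_ygrp_rcons mg red yw.
set w := wordperm ws in IH up yws *.
have lt : i (w a) < i (w (nxt a)).
  by apply: si => //; move/ygrpP: yws => yws; rewrite !yws e.
rewrite Wm_rcons (@mx_row_delta _ _ _ _ _ (idxM i w) 1) => [|l]; last by rewrite IH // mul1r.
rewrite mul1r mx_Hm /hdiag /hoff !ffunE lt (lt_eqF lt) mul0r add0r mul1r.
by rewrite idxM_mul wordperm_rcons.
Qed.

Lemma colact_theta_ygrp g (u : V) c t : monotone g ->
  (forall a, is_gen a -> g (nxt a) = g a -> colact (theta a) u = c *: u) ->
  t \in ygrp g -> colact (theta_perm t) u = c ^+ len t *: u.
Proof.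
move=> mg h yt; have [red e] := reduced_redw t; rewrite -size_redw /theta_perm.
have : all (fun a => is_gen a && (g (nxt a) == g a)) (redw t) by apply: reduced_ygrp => //; rewrite e.
elim: (redw t) => [|a ws IH] /=; first by rewrite col_P scale1r.
case/andP=> /andP[ga /eqP ea] all_ws.
have gws : all (@is_gen r) ws by apply: sub_all all_ws => x /andP[].
have [_ _ eP] := corner_theta_word v0 gws.
by rewrite colM // h // linearZ /= IH // scalerA exprS.
Qed.

Lemma corner_support (A : RF) : (forall i k, ~~ [exists s, emb s == k] -> mx A i k = 0) -> A * P = A.
Proof.
move=> h; rewrite -[RHS]mulr1; apply: mx_inj => i k; apply: mx_col_ext => j ne.
have [/existsP[s /eqP <-]|nj] := boolP [exists s, emb s == j]; first by rewrite P_emb mx1.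
by rewrite h // eqxx in ne.
Qed.

Lemma collapse_transpose g (C : RF) : monotone g -> mx C = trM (mx (collapse g)) ->
  collapse g * C = \sum_(t in ygrp g) v ^+ len t *: theta_perm t.
Proof.
move=> mg eC; have cB := centralizes_collapse v0 mg; have cC := centralizes_transpose eC cB.
have c1 : corner (collapse g * C).
  split; [exact: centralizesM|exact/on_varpiM/block_on_varpi|].
  by rewrite -mulrA corner_support // => i k nk; rewrite eC /trM block_on_varpi.
have c2 : corner (\sum_(t in ygrp g) v ^+ len t *: theta_perm t).
  by apply: corner_sum => // t _; apply: cornerZ; exact: corner_theta_perm.
apply: (corner_ext c1 c2) => k.
rewrite block_mul mx_sum idxM1 eC /trM.
have -> : inv g 1%g = 0%N by rewrite inv_ygrp ?ygrp1 // len1.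
rewrite expr0 mul1r.
rewrite (eq_bigr (fun t => v ^+ len t * (emb t == k)%:R)) => [|t _]; last by rewrite mxZ theta_perm_row Tm_emb.
have [/existsP[s /eqP <-]|nk] := boolP [exists s, emb s == k]; last first.
  rewrite block_on_varpi // big1 // => t _; case: eqP => [e|]; last by rewrite mulr0.
  by case/existsP: nk; exists t; apply/eqP.
have eY : (idxM g s == g) = (s \in ygrp g) by rewrite eq_sym -{1}(idxM1 g) ygrp_idxM invg1 mul1g.
rewrite collapse_emb eY big_mkcond (bigD1 s) //= eqxx mulr1.
rewrite big1 ?addr0 => [|t ts]; last by rewrite emb_eq (negbTE ts) mulr0; case: ifP.
by case: ifP => [ys|_]; rewrite ?mulr0 // mulr1 inv_ygrp.
Qed.

(* The signed sum over a Young subgroup; [ymat] in the right Hecke algebra. *)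
Definition ycoef t : K := (- v^-1) ^+ len t.
Definition ym g : RF := \sum_(t in ygrp g) ycoef t *: Tm t.
Definition ytheta g : RF := \sum_(t in ygrp g) ycoef t *: theta_perm t.

Lemma corner_ytheta g : corner (ytheta g).
Proof. by apply: corner_sum => // t _; apply: cornerZ; exact: corner_theta_perm. Qed.

Lemma ytheta_row g k : mx (ytheta g) (emb 1%g) k = mx (ym g) (emb 1%g) k.
Proof. by rewrite !mx_sum; apply: eq_bigr => t _; rewrite !mxZ theta_perm_row. Qed.

Lemma centralizes_ym A g : centralizes A -> ym g * A = A * ym g.
Proof.
move=> cA; rewrite /ym mulr_suml mulr_sumr; apply: eq_bigr => t _.
by rewrite -scalerAl -scalerAr (centralizes_Tm _ cA).
Qed.

Lemma ymat_ym lam : ymat v lam = mx (ym (omega r (conjp r lam))).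
Proof.
apply/funext => i; apply/funext => k; rewrite /ymat mx_sum; apply: eq_bigr => t _.
rewrite mxZ mulrA; congr (_ * _); rewrite /ycoef -exprVn -exprMn; congr (_ ^+ _).
by rewrite invrN mulNr expr2 invfM -mulrA mulVf // mulr1.
Qed.

Lemma colact_ytheta g (u : V) : monotone g -> u != 0 ->
  (forall a, is_gen a -> g (nxt a) = g a -> colact (theta a) u = - v^-1 *: u) ->
  colact (ytheta g) u != 0.
Proof.
move=> mg u0 h; rewrite /ytheta col_sum.
rewrite (eq_bigr (fun t => (ycoef t * ycoef t) *: u)) => [|t yt]; last first.
  by rewrite colZ (colact_theta_ygrp mg h yt) scalerA.
rewrite -scaler_suml scaler_eq0 negb_or u0 andbT; apply/eqP.
rewrite -big_filter => /sum_sqr/(_ 1%g).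
rewrite mem_filter ygrp1 mem_index_enum => /(_ isT)/eqP.
by apply/negP; rewrite /ycoef len1 expr0 oner_neq0.
Qed.

Lemma colact_collapse g (C : RF) (u : V) : monotone g -> u != 0 ->
  mx C = trM (mx (collapse g)) ->
  (forall a, is_gen a -> g (nxt a) = g a -> colact (theta a) u = v *: u) ->
  exists2 c, c != 0 & colact (collapse g * C) u = c *: u.
Proof.
move=> mg u0 eC h; rewrite (collapse_transpose mg eC) col_sum.
exists (\sum_(t in ygrp g) v ^+ len t * v ^+ len t).
  apply/eqP; rewrite -big_filter => /sum_sqr/(_ 1%g).
  rewrite mem_filter ygrp1 mem_index_enum => /(_ isT)/eqP.
  by apply/negP; rewrite len1 expr0 oner_neq0.
rewrite scaler_suml; apply: eq_bigr => t yt.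
by rewrite colZ (colact_theta_ygrp mg h yt) scalerA.
Qed.

Lemma Tm_emb_mul t (A : RF) k : mx (Tm t * A) (emb 1%g) k = mx A (emb t) k.
Proof.
rewrite (@mx_row_delta _ _ _ _ _ (emb t) 1) => [|l]; last by rewrite [RHS]mul1r; exact: Tm_emb.
exact: mul1r.
Qed.

Lemma ym_theta a g : is_gen a -> g (nxt a) = g a ->
  forall k, mx (ym g * theta a) (emb 1%g) k = - v^-1 * mx (ym g) (emb 1%g) k.
Proof.
move=> ga e k; have ya := ygrp_adjT ga e; rewrite mulr_suml !mx_sum mulr_sumr.
rewrite (eq_bigr (fun t => ycoef t * theta_diag v a t * (emb t == k)%:R
    + ycoef t * (emb (t * adjT a)%g == k)%:R)) => [|t _]; last first.
  rewrite -scalerAl mxZ Tm_emb_mul.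
  by rewrite theta_emb mulrDr mulrA.
rewrite big_split /= [X in _ + X](reindex_inj (mulIg (adjT a))) /=.
rewrite [X in _ + X](eq_bigl (fun t => t \in ygrp g)) => [|t]; last first.
  apply/idP/idP => h; last exact: ygrpM.
  by rewrite -(mulg1 t) -(adjT2 ga) mulgA; exact: ygrpM.
rewrite -big_split /=; apply: eq_bigr => t _.
rewrite -mulgA adjT2 // mulg1 mxZ Tm_emb // mulrA -mulrDl; congr (_ * _).
rewrite /ycoef /theta_diag; case: ifP => [up|/negbT dn].
  by rewrite len_upl // exprS mulr0 add0r.
rewrite (len_downl ga dn) exprS; move: (_ ^+ _) => x.
by field.
Qed.

Definition bicommutes (X : RF) := forall A, centralizes A -> X * A = A * X.

Lemma bicommutes_row (X Y : RF) c s k : bicommutes X -> bicommutes Y ->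
  (forall l, mx X (emb 1%g) l = c * mx Y (emb 1%g) l) -> mx X (emb s) k = c * mx Y (emb s) k.
Proof.
move=> cX cY h; have [cs _ _] := corner_theta_perm v0 s.
have row (Z : RF) : bicommutes Z -> mx Z (emb s) k = mx (Z * theta_perm s) (emb 1%g) k.
  move=> cZ; rewrite cZ // (@mx_row_delta _ _ _ _ _ (emb s) 1) ?mul1r // => l.
  by rewrite theta_perm_row Tm_emb // mul1r.
rewrite !row // -mxZ scalerAl; apply: mx_row_ext; apply/funext => l.
by rewrite h mxZ.
Qed.

Lemma bicommutes_ym g : bicommutes (ym g).
Proof. by move=> A cA; exact: centralizes_ym. Qed.

Lemma bicommutesM X Y : bicommutes X -> bicommutes Y -> bicommutes (X * Y).
Proof. by move=> hX hY A cA; rewrite -mulrA hY // mulrA hX // mulrA. Qed.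

Lemma bicommutes_Hm a : is_gen a -> bicommutes (Hm a).
Proof. by move=> ga A cA; exact: cA. Qed.

Lemma ym_Hm_varpi a g s k : is_gen a -> g (nxt a) = g a ->
  mx (Hm a * ym g) (emb s) k = - v^-1 * mx (ym g) (emb s) k.
Proof.
move=> ga e; apply: bicommutes_row => [||l].
- by apply: bicommutesM; [exact: bicommutes_Hm|exact: bicommutes_ym].
- exact: bicommutes_ym.
rewrite mx_HmM_emb // !perm1 val_nxt // ltnSn mul0r add0r mulg1.
rewrite -(ym_theta ga e) centralizes_ym; last exact: centralizes_theta.
by rewrite theta_up ?mul1g // invg1 !perm1 val_nxt // ltnSn.
Qed.

Lemma idxM_row g s X : monotone g -> bicommutes X -> forall k,
  v ^+ inv g s * mx X (idxM g s) k = mx (X * collapse g) (emb s) k.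
Proof.
move=> mg cX k; rewrite cX; last exact: centralizes_collapse.
by rewrite block_mul.
Qed.

Lemma ym_Hm a g g' s k : monotone g -> is_gen a -> g' (nxt a) = g' a ->
  mx (Hm a * ym g') (idxM g s) k = - v^-1 * mx (ym g') (idxM g s) k.
Proof.
move=> mg ga e; have bH : bicommutes (Hm a * ym g').
  by apply: bicommutesM; [exact: bicommutes_Hm|exact: bicommutes_ym].
apply: (mulfI (expf_neq0 (inv g s) v0)).
rewrite idxM_row // mulrCA idxM_row //; last exact: bicommutes_ym.
rewrite -mxZ scalerAl; apply: mx_row_ext; apply/funext => l.
by rewrite ym_Hm_varpi // mxZ.
Qed.

Definition strict_on_blocks g' i := forall a, is_gen a -> g' (nxt a) = g' a -> i a < i (nxt a).

Lemma ym_row_strict g g' s : monotone g ->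
  (forall k, mx (ym g') (idxM g s) k = 0) \/
  exists s' c, strict_on_blocks g' (idxM g s') /\
    forall k, mx (ym g') (idxM g s) k = c * mx (ym g') (idxM g s') k.
Proof.
move=> mg; have [n] := ubnP (len s); elim: n s => // n IH s lt.
have [st|] := pselect (strict_on_blocks g' (idxM g s)).
  by right; exists s, 1; split=> // k; rewrite mul1r.
move/existsNP => [a /not_implyP[ga /not_implyP[e /negP]]].
rewrite -leNgt le_eqVlt => /orP[/eqP eq|gt].
  left=> k; have := ym_Hm s k mg ga e; rewrite mx_HmM /hdiag /hoff eq ltxx eqxx mul0r addr0.
  move/eqP; rewrite -subr_eq0 -mulrBl mulf_eq0 opprK => /orP[|/eqP //].
  move=> /eqP h; have : v ^+ 4 = 1.
    have h2 : v ^+ 2 = -1.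
      have hv : v = - v^-1 by apply/eqP; rewrite -addr_eq0 h.
      by rewrite expr2 {1}hv mulNr mulVf.
    by rewrite (exprM v 2 2) h2 sqrrN expr1n.
  by move=> e4; have := v_root (isT : (0 < 4)%N); rewrite e4 eqxx.
have down : ~~ (s a < s (nxt a))%N.
  apply/negP => up; move: gt; rewrite !ffunE ltNge => /negP; apply.
  exact/mg/ltnW.
have ls := len_down ga down; set s1 := (adjT a * s)%g in ls *.
have ek : idxM g s = idxM (idxM g s1) (adjT a) by rewrite idxM_mul adjTKl.
have h1 k : mx (ym g') (idxM g s) k = - v^-1 * mx (ym g') (idxM g s1) k.
  rewrite -(ym_Hm s1 k mg ga e) mx_HmM /hdiag /hoff -ek.
  have lt1 : idxM g s1 a < idxM g s1 (nxt a).
    by move: gt; rewrite !ffunE !permM adjTL adjTR.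
  by rewrite lt1 (lt_eqF lt1) mul0r add0r mul1r.
case: (IH s1) => [|h|[s' [c [st h]]]]; first by rewrite ls in lt.
  by left=> k; rewrite h1 h mulr0.
by right; exists s', (- v^-1 * c); split=> // k; rewrite h1 h mulrA.
Qed.

Lemma ym_diag g i : monotone g ->
  (forall p q : 'I_r, (p < q)%N -> g p = g q -> i p < i q) -> mx (ym g) i i = 1.
Proof.
move=> mg si; rewrite mx_sum (bigD1 1%g) ?ygrp1 //= big1 ?addr0.
  rewrite mxZ /ycoef len1 expr0 mul1r /Tm; have [red e] := reduced_redw (1%g : S).
  by rewrite (Wm_strict mg si) // e ?ygrp1 // idxM1 eqxx.
move=> t /andP[yt t1]; rewrite mxZ; have [red e] := reduced_redw t.
rewrite /Tm (Wm_strict mg si) ?e //; case: eqP => [/ffunP ei|]; last by rewrite mulr0.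
case/eqP: t1; apply/permP => p; rewrite perm1; apply/eqP.
have := ei p; rewrite ffunE; have := ygrpP _ _ yt p; move=> gp ip.
by case: (ltngtP (t p) p) => [lt|lt|/val_inj -> //];
  [have := si _ _ lt gp | have := si _ _ lt (esym gp)]; rewrite ip ltxx.
Qed.

End Young.

(** * The generators of the Weyl modules *)

Section Contents.
Variable r : nat.
Notation S := {perm 'I_r}.
Implicit Types (a : 'I_r) (w s t : S) (i k g : Idx r).

Lemma idxME i s p : idxM i s p = i (s p). Proof. by rewrite ffunE. Qed.

Lemma content_idxM i s : content (idxM i s) = content i.
Proof.
apply/funext => x; rewrite /content -(card_imset [set p | idxM i s p == x]%SET (@perm_inj _ s)).
apply: eq_card => p; rewrite !inE; apply/imsetP/idP => [[q]|e].
  by rewrite inE ffunE => /eqP <- ->.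
by exists (s^-1%g p); rewrite ?inE ?ffunE permKV.
Qed.

Lemma content_sum i x : content i x = (\sum_p (i p == x))%N.
Proof. by rewrite /content -sum1_card big_mkcond /=; apply: eq_bigr => p _; rewrite inE; case: eqP. Qed.

Lemma same_content i k : content i = content k -> exists s, idxM i s = k.
Proof.
move=> e; pose ti := [tuple i p | p < r]; pose tk := [tuple k p | p < r].
have /tuple_permP[s es] : perm_eq tk ti.
  apply/allP => x _ /=; have cnt (j : Idx r) : count_mem x [tuple j p | p < r] = content j x.
    by rewrite content_sum /= count_map -sum1_count big_enum_cond big_mkcond /=; apply: eq_bigr => p _; case: eqP.
  by rewrite !cnt e.
exists s; apply/ffunP => p; rewrite ffunE.
have := congr1 (fun t : seq int => nth 0 t p) es.
by rewrite -!tnth_nth !tnth_mktuple.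
Qed.

Lemma exists_monotone i : exists s, monotone (idxM i s).
Proof.
pose ti := [tuple i p | p < r].
have /tuple_permP[s es] : perm_eq (sort <=%O ti) ti by rewrite perm_sort.
exists s => p q pq; have ss := sort_sorted (@le_total _ int) ti.
have nt (p' : 'I_r) : idxM i s p' = nth 0 (sort <=%O ti) p'.
  by rewrite es -tnth_nth !tnth_mktuple ffunE.
rewrite !nt; apply: (sorted_leq_nth le_trans le_refl 0 ss) => //.
  by rewrite inE size_sort size_tuple.
by rewrite inE size_sort size_tuple.
Qed.

Section Part.
Variable l : nat -> nat.
Hypothesis pl : partn r l.
Notation g := (omega r (part l)).

Lemma monotone_omega (l' : nat -> nat) : monotone (omega r (part l')).
Proof. by move=> p q pq; rewrite !omega_part lez_nat ltnS bl_mono. Qed.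

Lemma fibers_content i (f : 'I_r -> nat) : (forall p, i p = Posz (f p).+1) ->
  content i = part l <-> fibers l f.
Proof.
move=> e; split=> [h t|h].
  have := congr1 (fun c : int -> nat => c (Posz t.+1)) h; rewrite content_sum /= => <-.
  by apply: eq_bigr => p _; rewrite e eqz_nat eqSS.
apply/funext => x; rewrite content_sum; case: x => [[|n]|n] /=.
- by rewrite big1 // => p _; rewrite e.
- by rewrite -(h n); apply: eq_bigr => p _; rewrite e eqz_nat eqSS.
- by rewrite big1 // => p _; rewrite e.
Qed.

Lemma content_omega : content g = part l.
Proof.
by apply/(@fibers_content _ (fun p : 'I_r => bl r l p)) => [p|t]; [exact: omega_part|exact: sum_bl].
Qed.

Lemma idxM_omega s p : idxM g s p = Posz (bl r l (s p)).+1.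
Proof. by rewrite ffunE omega_part. Qed.

Lemma fibers_idxM s : fibers l (fun p : 'I_r => bl r l (s p)).
Proof.
apply/(@fibers_content (idxM g s)) => [p|]; first exact: idxM_omega.
by rewrite content_idxM content_omega.
Qed.

Definition rho : Idx r := [ffun p : 'I_r => Posz (off r (conj_part r l) p).+1].

Lemma content_rho : content rho = part l.
Proof.
by apply/(@fibers_content _ (fun p : 'I_r => off r (conj_part r l) p)) => [p|t]; [rewrite ffunE|exact: fibers_off].
Qed.

Lemma omega_block (l' : nat -> nat) (p q : 'I_r) :
  omega r (part l') q = omega r (part l') p <-> bl r l' q = bl r l' p.
Proof. by rewrite !omega_part; split=> [[]|->]. Qed.

Lemma rho_strict (p q : 'I_r) : (p < q)%N ->
  omega r (part (conj_part r l)) p = omega r (part (conj_part r l)) q -> rho p < rho q.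
Proof.
move=> pq /omega_block e; rewrite !ffunE ltz_nat ltnS /off e.
have := bl_bounds (partn_conj pl) (ltn_ord p); rewrite e; lia.
Qed.

Lemma strict_blocks_nat (l' : nat -> nat) i (f : 'I_r -> nat) : (forall p, i p = Posz (f p).+1) ->
  strict_on_blocks (omega r (part l')) i ->
  forall p q : 'I_r, q = p.+1 :> nat -> bl r l' q = bl r l' p -> (f p < f q)%N.
Proof.
move=> e st p q eq eb; have gp : is_gen p by rewrite /is_gen -eq.
have en : nxt p = q by apply: val_inj; rewrite /= val_nxt.
by have := st p gp; rewrite en => /(_ (iffRL (omega_block _ _ _) eb)); rewrite !e ltz_nat ltnS.
Qed.

Lemma strict_rho s : strict_on_blocks (omega r (part (conj_part r l))) (idxM g s) -> idxM g s = rho.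
Proof.
move=> st; apply/ffunP => p; rewrite idxM_omega ffunE; congr (Posz _.+1).
apply: (@strict_unique r l l pl (fun p => bl r l (s p))) => //; first exact: fibers_idxM.
by apply: strict_blocks_nat st => q; exact: idxM_omega.
Qed.

Lemma exists_rho : exists s, idxM g s = rho.
Proof. by apply: same_content; rewrite content_omega content_rho. Qed.

End Part.

Lemma strict_dominates l l' s : partn r l -> partn r l' ->
  strict_on_blocks (omega r (part (conj_part r l))) (idxM (omega r (part l')) s) ->
  forall m, (ps l' m <= ps l m)%N.
Proof.
move=> pl pl' st m; apply: (@strict_dominance r l l' pl (fun p => bl r l' (s p))).
  exact: fibers_idxM.
by apply: strict_blocks_nat st => q; exact: idxM_omega.
Qed.

Lemma varpi_part : varpi r = part (fun n => (n < r)%N).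
Proof.
by apply/funext => -[[|n]|n] //; rewrite /varpi /= lez_nat.
Qed.

Lemma partn_varpi : partn r (fun n => (n < r)%N).
Proof.
split=> [n|n|].
- by case: (ltnP n.+1 r) => // h; rewrite (ltnW h).
- by rewrite ltnNge => ->.
by rewrite sum_lt minnn.
Qed.

Lemma omega_varpi : omega r (varpi r) = emb 1%g.
Proof.
apply/ffunP => p; rewrite varpi_part omega_part ffunE perm1; congr (Posz _.+1).
apply: (bl_uniq partn_varpi) => //; rewrite /ps !sum_lt.
have := ltn_ord p; lia.
Qed.

Lemma content_varpi i : content i = varpi r <-> exists s, emb s = i.
Proof.
have c1 : content (emb (1%g : S)) = varpi r.
  by rewrite -omega_varpi varpi_part content_omega //; exact: partn_varpi.
split=> [e|[s <-]]; last by rewrite -[s]mulg1 -idxM_emb content_idxM.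
have [s <-] : exists s, idxM (emb (1%g : S)) s = i by apply: same_content; rewrite c1.
by exists (s * 1)%g; rewrite idxM_emb.
Qed.

Section Wlam.
Variable l : nat -> nat.
Hypothesis pl : partn r l.
Notation g := (omega r (part l)).
Notation g' := (omega r (part (conj_part r l))).
Notation w := (wlam r (part l)).

Definition distinguished w := (forall a b : S, a \in ygrp g -> b \in ygrp g' -> (len w <= len (b * w * a)%g)%N) /\
  (forall a : S, a \in ygrp g -> (w * a * w^-1)%g \in ygrp g' -> a = 1%g).

Lemma distinguished_wlam : distinguished w.
Proof.
have [s0 es] := exists_rho pl.
have triv0 (a : S) : a \in ygrp g -> (s0 * a * s0^-1)%g \in ygrp g' -> a = 1%g.
  move=> /ygrpP ya /ygrpP yb; suff e : (s0 * a * s0^-1)%g = 1%g.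
    by apply: (mulgI s0); apply: (mulIg s0^-1%g); rewrite e mulg1 mulgV.
  apply/permP => p; rewrite perm1; set q := (s0 * a * s0^-1)%g p.
  have er : rho l q = rho l p by rewrite -es !idxME /q !permM permKV ya.
  have eq : g' q = g' p := yb p.
  by case: (ltngtP q p) => [lt|lt|/val_inj //];
    [have := rho_strict pl lt eq | have := rho_strict pl lt (esym eq)]; rewrite er ltxx.
have [ab /andP[ya yb] hmin] : exists2 ab : S * S, (ab.1 \in ygrp g) && (ab.2 \in ygrp g') &
    forall a b : S, a \in ygrp g -> b \in ygrp g' -> (len (ab.2 * s0 * ab.1)%g <= len (b * s0 * a)%g)%N.
  case: (@arg_minnP _ (1%g, 1%g) (fun ab : S * S => (ab.1 \in ygrp g) && (ab.2 \in ygrp g'))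
    (fun ab => len (ab.2 * s0 * ab.1)%g)) => [|ab yab h]; first by rewrite !ygrp1.
  by exists ab => // a b ya yb; apply: (h (a, b)); rewrite /= ya.
pose w1 := (ab.2 * s0 * ab.1)%g.
have d1 : distinguished w1.
  split=> [a b ha hb|a ha hb].
    have -> : (b * w1 * a = (b * ab.2) * s0 * (ab.1 * a))%g by rewrite /w1 !mulgA.
    by apply: hmin; exact: ygrpM.
  have e : (ab.1 * a * ab.1^-1 = 1)%g.
    apply: triv0; first by apply: ygrpM; [exact: ygrpM|exact: ygrpV].
    have -> : (s0 * (ab.1 * a * ab.1^-1) * s0^-1 = ab.2^-1 * (w1 * a * w1^-1) * ab.2)%g.
      by rewrite /w1 !invMg !mulgA mulVg mul1g mulgKV.
    by apply: ygrpM => //; apply: ygrpM => //; exact: ygrpV.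
  by apply: (mulgI ab.1); apply: (mulIg ab.1^-1%g); rewrite e mulg1 mulgV.
rewrite /wlam; case: pickP => [w2 /andP[/forall_inP h1 /forall_inP h2]|/(_ w1)].
  split=> [a b ha hb|a ha hb]; last first.
    by have := h2 a ha; rewrite conjp_part hb => /eqP.
  have := h1 a ha; rewrite conjp_part => /forall_inP; exact.
case/negP; apply/andP; split; apply/forall_inP => a ha.
  by apply/forall_inP => b; rewrite conjp_part => hb; case: d1 => h _; exact: h.
by apply/implyP; rewrite conjp_part => hb; apply/eqP; case: d1 => _; exact.
Qed.

Lemma wlam_fiber (p q : 'I_r) : (p < q)%N -> g p = g q -> (w^-1%g p < w^-1%g q)%N.
Proof.
move=> pq e; have [h _] := distinguished_wlam.
rewrite -ltz_nat; apply: (@block_increasing r g (fun p => Posz (w^-1%g p)) (@monotone_omega l) _ p q pq e).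
move=> a ga ea; rewrite ltz_nat ltnNge; apply/negP => ge.
have dn : ~~ (w^-1%g a < w^-1%g (nxt a))%N by rewrite -leqNgt.
have := h (adjT a) 1%g (ygrp_adjT ga ea) (ygrp1 _); rewrite mul1g.
by rewrite (len_downl ga dn) ltnn.
Qed.

Lemma idxM_wlam : idxM g w = rho l.
Proof.
have [h1 h2] := distinguished_wlam; apply: (strict_rho pl) => a ga ea.
rewrite !idxME lt_neqAle; apply/andP; split; last first.
  rewrite leNgt; apply/negP => gt.
  have dn : ~~ (w a < w (nxt a))%N.
    apply/negP => up; move: gt; rewrite ltNge => /negP; apply; apply: monotone_omega; exact: ltnW.
  have := h1 1%g (adjT a) (ygrp1 _) (ygrp_adjT ga ea); rewrite mulg1.
  by rewrite (len_down ga dn) ltnn.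
apply/eqP => eg; pose x := tperm (w a) (w (nxt a)).
have yx : x \in ygrp g.
  by apply/ygrpP => p; rewrite /x; case: tpermP => [->|->|].
have ex : (w * x * w^-1)%g = adjT a.
  by rewrite (adjTE ga) /x -tpermJ /conjg !mulgA mulgK mulgV mul1g.
have := h2 x yx; rewrite ex => /(_ (ygrp_adjT ga ea)) x1.
have := nxt_neq ga; rewrite -(inj_eq (@perm_inj _ w)) => /eqP; apply.
by rewrite -(tpermL (w a) (w (nxt a))) -/x x1 perm1.
Qed.

Lemma inv_wlam : inv g w = 0%N.
Proof.
apply/eqP; rewrite cards_eq0; apply/eqP/setP => -[p q]; rewrite !inE /=.
apply/negbTE/negP => /and3P[pq qp /eqP e].
by have := wlam_fiber qp (esym e); rewrite !permK; lia.
Qed.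

End Wlam.
End Contents.

Section WeylGenerators.
Import Gen.
Variables (K : fieldType) (v : K) (r : nat).
Hypothesis v0 : v != 0.
Hypothesis v_root : forall n, (0 < n)%N -> v ^+ n != 1.
Hypothesis sum_sqr : forall (I : eqType) (s : seq I) (f : I -> K),
  \sum_(i <- s) f i * f i = 0 -> forall i, i \in s -> f i = 0.
Notation RF := (rfm K r).
Notation S := {perm 'I_r}.
Notation Tm := (@Tm K v r).
Notation centralizes := (@centralizes K v r).
Notation corner := (@corner K v r).
Notation theta_perm := (@theta_perm K v r).
Notation collapse := (@collapse K v r).
Notation ym := (@ym K v r).
Notation ytheta := (@ytheta K v r).
Notation omega l := (omega r (part l)).
Notation conj l := (conj_part r l).
Implicit Types (a : 'I_r) (w s t : S) (i k : Idx r) (l : nat -> nat).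

Definition Zm l : RF :=
  ytheta (omega (conj l)) * (v ^+ len (wlam r (part l)) *: theta_perm (wlam r (part l)) * collapse (omega l)).

Lemma centralizes_omega l : centralizes (collapse (omega l)).
Proof. by apply: centralizes_collapse => //; exact: monotone_omega. Qed.

Lemma centralizes_Zm l : centralizes (Zm l).
Proof.
apply: centralizesM; first by case: (corner_ytheta v0 (omega (conj l))).
apply: centralizesM (centralizes_omega l); apply: centralizesZ.
by case: (corner_theta_perm v0 (wlam r (part l))).
Qed.

Lemma Zm_on_varpi l : on_varpi (Zm l).
Proof. by apply: on_varpiM; case: (corner_ytheta v0 (omega (conj l))). Qed.

Lemma ytheta_mul_row g (G : RF) k : centralizes G ->
  mx (ytheta g * G) (emb 1%g) k = mx (G * ym g) (emb 1%g) k.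
Proof.
move=> cG; rewrite -(centralizes_ym _ cG); apply: mx_row_ext; apply/funext => l.
exact: ytheta_row.
Qed.

Lemma theta_perm_mul_row w (G : RF) k : mx (theta_perm w * G) (emb 1%g) k = mx G (emb w) k.
Proof.
rewrite -[RHS](Tm_emb_mul v); apply: mx_row_ext; apply/funext => l; exact: theta_perm_row.
Qed.

Lemma Zm_row l k : partn r l -> mx (Zm l) (emb 1%g) k =
  v ^+ len (wlam r (part l)) * mx (ym (omega (conj l))) (rho r l) k.
Proof.
move=> pl; rewrite ytheta_mul_row; last first.
  apply: centralizesM (centralizes_omega l); apply: centralizesZ.
  by case: (corner_theta_perm v0 (wlam r (part l))).
rewrite -!scalerAl mxZ -mulrA theta_perm_mul_row block_mul.
by rewrite inv_wlam // expr0 mul1r idxM_wlam.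
Qed.

Lemma omega_row_Tm l k : partn r l ->
  mx (Tm (wlam r (part l))) (omega l) k = (rho r l == k)%:R.
Proof.
move=> pl; rewrite Tm_monotone ?idxM_wlam //; first exact: monotone_omega.
by move=> p q pq e; apply: wlam_fiber.
Qed.

Lemma Zm_zvec l k : partn r l -> mx (Zm l) (emb 1%g) k = @zvec K v r (part l) k.
Proof.
move=> pl; rewrite Zm_row // /zvec.
pose X : RF := v ^+ len (wlam r (part l)) *: Tm (wlam r (part l)).
have -> : mulR (Tw v (wlam r (part l))) (ymat v (part l)) (omega l) k = mx (X * ym (omega (conj l))) (omega l) k.
  by rewrite ymat_ym ?conjp_part.
rewrite /X -scalerAl mxZ; congr (_ * _).
rewrite (@mx_row_delta _ _ _ _ _ (rho r l) 1) ?mul1r // => l'.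
by rewrite omega_row_Tm // mul1r.
Qed.

Lemma content_emb i : content i <> varpi r <-> ~~ [exists s, emb s == i].
Proof.
split=> [n|/existsP n /content_varpi[s e]]; last by apply: n; exists s; apply/eqP.
by apply/existsP => -[s /eqP e]; apply: n; apply/content_varpi; exists s.
Qed.

Lemma is_z_Zm l : partn r l -> is_z v (part l) (mx (Zm l)).
Proof.
move=> pl; split; first exact/inS_mx/centralizes_Zm.
  by move=> i /content_emb ni k; exact: Zm_on_varpi.
move=> w; apply/funext => k; rewrite omega_varpi -mx_Tm vecmat_mx (centralizes_Tm _ (@centralizes_Zm l)).
rewrite -vecmat_mx; congr (vecmat _ _ k); apply/funext => k'; exact: Zm_zvec.
Qed.

Lemma is_z_unique l F : partn r l -> is_z v (part l) F -> F = mx (Zm l).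
Proof.
move=> pl [/inS_rfm[A cA <-] oA hA]; congr mx.
apply: (centralizes_ext cA (@centralizes_Zm l)) => [i k /content_emb ni||k].
- exact: oA.
- exact: Zm_on_varpi.
have [_ _ hZ] := is_z_Zm pl.
have := congr1 (fun x : Vec K r => x k) (hA 1%g); have := congr1 (fun x : Vec K r => x k) (hZ 1%g).
by rewrite omega_varpi -!mx_Tm !vecmat_mx !Tm_emb_mul => -> ->.
Qed.

Lemma corner_support_row F k : corner F -> ~~ [exists s, emb s == k] -> mx F (emb 1%g) k = 0.
Proof. by case=> _ _ e; exact: mulP_support. Qed.

Lemma corner_mul_row F (G : RF) k : corner F ->
  mx (F * G) (emb 1%g) k = \sum_s mx F (emb 1%g) (emb s) * mx G (emb s) k.
Proof.
move=> cF; rewrite (@mxM_sum _ _ _ _ [seq emb t | t : S]).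
- by rewrite big_map big_enum.
- by rewrite map_inj_uniq ?enum_uniq //; exact: emb_inj.
- move=> j ne; have [/existsP[w /eqP <-]|nj] := boolP [exists s, emb s == j]; first exact: codom_f.
  by rewrite corner_support_row // eqxx in ne.
Qed.

Lemma ytheta_corner_row l l' F k : corner F ->
  mx (ytheta (omega (conj l)) * (F * collapse (omega l'))) (emb 1%g) k =
  \sum_s mx F (emb 1%g) (emb s) * (v ^+ inv (omega l') s * mx (ym (omega (conj l))) (idxM (omega l') s) k).
Proof.
move=> cF; have [cF' _ _] := cF; rewrite ytheta_mul_row; last exact: centralizesM (centralizes_omega l').
rewrite -mulrA corner_mul_row //; apply: eq_bigr => s _.
by rewrite block_mul.
Qed.

(* [x_mu H y_(mu^t)] is one-dimensional. *)
Lemma ytheta_corner_collapse l F : partn r l -> corner F ->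
  exists c, ytheta (omega (conj l)) * (F * collapse (omega l)) = c *: Zm l.
Proof.
move=> pl cF; have [cF' _ _] := cF.
have [c hc] : exists c, forall k, mx (ytheta (omega (conj l)) * (F * collapse (omega l))) (emb 1%g) k =
    c * mx (ym (omega (conj l))) (rho r l) k.
  have h s : exists c, forall k, mx (ym (omega (conj l))) (idxM (omega l) s) k =
      c * mx (ym (omega (conj l))) (rho r l) k.
    have [e|[s' [c [/strict_rho -> // h]]]] := ym_row_strict v0 v_root (omega (conj l)) s (@monotone_omega r l); last by exists c.
    by exists 0 => k; rewrite e mul0r.
  pose cs s := xget 0 [set c | forall k, mx (ym (omega (conj l))) (idxM (omega l) s) k =
      c * mx (ym (omega (conj l))) (rho r l) k].
  have hs s k : mx (ym (omega (conj l))) (idxM (omega l) s) k = cs s * mx (ym (omega (conj l))) (rho r l) k.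
    by rewrite /cs; case: xgetP => [c _ //|hn]; have [c hc] := h s; case: (hn c).
  exists (\sum_s mx F (emb 1%g) (emb s) * (v ^+ inv (omega l) s * cs s)) => k.
  rewrite ytheta_corner_row // mulr_suml; apply: eq_bigr => s _.
  by rewrite hs !mulrA.
have [cY oY _] := corner_ytheta v0 (omega (conj l)).
have vl : v ^+ len (wlam r (part l)) != 0 by exact: expf_neq0.
exists (c / v ^+ len (wlam r (part l))); apply: (@centralizes_ext K v) => [||||k].
- by apply: centralizesM cY _; exact: centralizesM (centralizes_omega l).
- exact/centralizesZ/centralizes_Zm.
- exact: on_varpiM.
- exact/on_varpiZ/Zm_on_varpi.
by rewrite hc mxZ Zm_row // mulrA divfK.
Qed.

Lemma ytheta_dominance l l' F : partn r l -> partn r l' -> corner F ->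
  ytheta (omega (conj l)) * (F * collapse (omega l')) != 0 -> forall m, (ps l' m <= ps l m)%N.
Proof.
move=> pl pl' cF nz; have [cF' _ _] := cF.
have [[s [k nsk]]|hn] := pselect (exists s k, mx (ym (omega (conj l))) (idxM (omega l') s) k != 0).
  have [e|[s' [c [st _]]]] := ym_row_strict v0 v_root (omega (conj l)) s (@monotone_omega r l').
    by rewrite e eqxx in nsk.
  exact: strict_dominates pl pl' st.
case/eqP: nz; have [cY oY _] := corner_ytheta v0 (omega (conj l)).
apply: (@centralizes_ext K v) => [||||k].
- by apply: centralizesM cY _; exact: centralizesM (centralizes_omega l').
- exact: centralizes0.
- exact: on_varpiM.
- by move=> i k _; rewrite mx0.
rewrite ytheta_corner_row // mx0 big1 // => s _.
have [->|ne] := eqVneq (mx (ym (omega (conj l))) (idxM (omega l') s) k) 0; first by rewrite !mulr0.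
by case: hn; exists s, k.
Qed.

Lemma Zm_neq0 l : partn r l -> Zm l != 0.
Proof.
move=> pl; apply/eqP => /(congr1 (fun A => mx A (emb 1%g) (rho r l))).
rewrite Zm_row // mx0 ym_diag ?mulr1 //; first by apply/eqP; rewrite expf_neq0.
- exact: monotone_omega.
- by move=> p q; apply: rho_strict.
Qed.

Lemma gram_eq0 (X X' : RF) : on_varpi X -> mx X' = trM (mx X) -> X * X' = 0 -> X = 0.
Proof.
move=> oX eX e; have o0 : on_varpi (0 : RF) by move=> i k _; rewrite mx0.
apply: (mx_emb_eq oX o0) => s k.
have [t [ut ht]] := rowfin_seq (emb s) (svalP X).
have : \sum_(j <- t) mx X (emb s) j * mx X (emb s) j = 0.
  rewrite -[RHS](mx0 _ (emb s) (emb s)) -e (@mxM_sum _ _ _ _ t) //.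
  by apply: eq_bigr => j _; rewrite eX.
move/sum_sqr => h; rewrite mx0; apply/eqP/negPn/negP => ne.
by have /h e0 := ht _ ne; rewrite e0 eqxx in ne.
Qed.

Lemma gram3_neq0 (X X' : RF) : on_varpi X -> mx X' = trM (mx X) -> X != 0 -> X * X' * X != 0.
Proof.
move=> oX eX nz; apply/eqP => e; case/eqP: nz; apply: (gram_eq0 oX eX).
have oXX : on_varpi (X * X') by exact: on_varpiM.
apply: (gram_eq0 oXX (X' := X * X')); last by rewrite mulrA e mul0r.
by rewrite mxM trM_mulR -eX; congr mulR; apply/funext => i; apply/funext => k; rewrite eX.
Qed.

End WeylGenerators.

Lemma subspace_row_space (F : fieldType) n (U : 'rV[F]_n -> Prop) : U 0 ->
  (forall c x y, U x -> U y -> U (c *: x + y)) ->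
  exists A : 'M[F]_n, forall x, U x <-> (x <= A)%MS.
Proof.
move=> U0 Ul; have Usub m (A : 'M_(m, n)) x : (forall i, U (row i A)) -> (x <= A)%MS -> U x.
  move=> hA /submxP[y ->]; rewrite mulmx_sum_row; elim/big_rec: _ => // i z _; exact: Ul.
pose Q d := `[< exists A : 'M[F]_n, (forall i, U (row i A)) /\ \rank A = d >].
have Q0 : exists d, Q d.
  by exists 0%N; apply/asboolP; exists 0; split=> [i|]; rewrite ?row0 ?mxrank0.
have Qb d : Q d -> (d <= n)%N by move=> /asboolP[A [_ <-]]; exact: rank_leq_row.
case: (ex_maxnP Q0 Qb) => d /asboolP[A [UA rA]] dmax.
exists A => x; split=> [Ux|]; last exact: Usub.
have UAx i : U (row i (A + x)%MS).
  have /sub_addsmxP[[y z] -> /=] : (row i (A + x)%MS <= A + x)%MS by exact: row_sub.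
  rewrite -[y *m A]scale1r; apply: Ul; first by apply: Usub UA _; exact: submxMl.
  apply: (Usub _ x) => [j|]; last exact: submxMl.
  by rewrite row_id.
have : Q (\rank (A + x)%MS) by apply/asboolP; exists (A + x)%MS.
move/dmax; rewrite -rA => le.
apply: submx_trans (addsmxSr A x) _.
by have := mxrank_leqif_eq (addsmxSl A x); case=> _; rewrite eqn_leq mxrankS ?addsmxSl // le => /esym/andP[].
Qed.

Lemma separating_functional (F : fieldType) n (U : 'rV[F]_n -> Prop) e : U 0 ->
  (forall c x y, U x -> U y -> U (c *: x + y)) -> ~ U e ->
  exists f : 'cV[F]_n, (forall x, U x -> x *m f = 0) /\ e *m f != 0.
Proof.
move=> U0 Ul ne; have [A hA] := subspace_row_space U0 Ul.
have : e *m cokermx A != 0 by rewrite -submxE; apply/negP => /hA.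
case/matrix0Pn => i [j nz]; exists (col j (cokermx A)); split=> [x /hA|].
  by rewrite submxE => /eqP e0; rewrite colE mulmxA e0 mul0mx.
apply/matrix0Pn; exists i, 0; by rewrite colE mulmxA -colE mxE.
Qed.

Section Ideal.
Import Gen.
Variables (K : fieldType) (v : K) (r : nat).
Hypothesis v0 : v != 0.
Hypothesis v_root : forall n, (0 < n)%N -> v ^+ n != 1.
Hypothesis sum_sqr : forall (I : eqType) (s : seq I) (f : I -> K),
  \sum_(i <- s) f i * f i = 0 -> forall i, i \in s -> f i = 0.
Notation RF := (rfm K r).
Notation S := {perm 'I_r}.
Notation V := {ffun S -> K^o}.
Notation centralizes := (@centralizes K v r).
Notation corner := (@corner K v r).
Notation theta := (@theta K v r).
Notation theta_perm := (@theta_perm K v r).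
Notation collapse := (@collapse K v r).
Notation Zm := (@Zm K v r).
Notation P := (proj_varpi K r).
Notation omega l := (omega r (part l)).
Notation conj l := (conj_part r l).

Inductive in_ideal : RF -> Prop :=
| ideal0 : in_ideal 0
| ideal_cons l a b X : partn r l -> centralizes a -> centralizes b -> in_ideal X ->
    in_ideal (a * Zm l * b + X).

Lemma in_idealD X Y : in_ideal X -> in_ideal Y -> in_ideal (X + Y).
Proof.
by elim=> [|l a b X' pl ca cb _ IH] hY; rewrite ?add0r // -addrA; apply: ideal_cons => //; exact: IH.
Qed.

Lemma in_idealZ c X : in_ideal X -> in_ideal (c *: X).
Proof.
elim=> [|l a b X' pl ca cb _ IH]; first by rewrite scaler0; exact: ideal0.
rewrite scalerDr !scalerAl; apply: ideal_cons => //; exact: centralizesZ.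
Qed.

Lemma in_ideal_gen l a b : partn r l -> centralizes a -> centralizes b -> in_ideal (a * Zm l * b).
Proof. by move=> pl ca cb; rewrite -[_ * b]addr0; apply: ideal_cons => //; exact: ideal0. Qed.

Definition first_row (X : RF) : 'rV[K]_#|S| := \row_j mx X (emb 1%g) (emb (enum_val j)).

Lemma first_row_colact X (f : 'cV[K]_#|S|) :
  (first_row X *m f) 0 0 = colact X [ffun s => f (enum_rank s) 0] 1%g.
Proof.
rewrite mxE ffunE (reindex_onto (@enum_rank _) (@enum_val _ _)) => [|i _]; last by rewrite enum_valK.
apply: eq_big => [s|s _]; first by rewrite enum_rankK eqxx.
by rewrite mxE ffunE enum_rankK.
Qed.

Lemma colact_theta_perm s (f : V) : colact (theta_perm s) f 1%g = f s.
Proof.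
rewrite ffunE (bigD1 s) //= theta_perm_row Tm_emb eqxx mul1r big1 ?addr0 // => t ts.
by rewrite theta_perm_row Tm_emb emb_eq eq_sym (negbTE ts) mul0r.
Qed.

Lemma corner_Zm_transpose l (C : RF) : mx C = trM (mx (collapse (omega l))) -> corner (Zm l * C).
Proof.
move=> eC; have cC := centralizes_transpose eC (@centralizes_omega K v r v0 l).
split; [exact: centralizesM (centralizes_Zm v0 l) cC|exact/on_varpiM/(Zm_on_varpi v0)|].
rewrite -mulrA corner_support // => i k nk; by rewrite eC /trM block_on_varpi.
Qed.

(* A nonzero column [n] is not annihilated by all [Z_mu S]: Jucys-Murphy theory produces in its
   orbit an eigenvector for the rows and one for the columns of a common diagram. *)
Lemma annihilated_column (n : V) :
  (forall l (C B : RF), partn r l -> mx C = trM (mx (collapse (omega l))) -> corner B ->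
     colact (Zm l * C * B) n = 0) -> n = 0.
Proof.
move=> ann; apply/eqP/negPn/negP => n0.
have [rows [rows' [A1 [A2 [[dr sr dr' sr' hc] [[c1 c2 u0 u0'] [h1 h2]]]]]]] :=
  jucys_murphy_columns v0 v_root sum_sqr n0.
pose l := nth 0%N rows; have pl : partn r l := rows_partn dr sr.
have lc : conj l = nth 0%N rows' by apply/funext => j; exact: conj_rows dr sr hc j.
have [C eC] : exists C : RF, mx C = trM (mx (collapse (omega l))).
  by apply: on_varpi_transpose; exact: block_on_varpi.
have eig1 a : is_gen a -> omega l (nxt a) = omega l a ->
    colact (theta a) (colact A1 n) = v *: colact A1 n.
  move=> ga /omega_block; rewrite val_nxt // => e; apply: h1 => //.
  exact: (reading_block dr sr ga e).
have eig2 a : is_gen a -> omega (conj l) (nxt a) = omega (conj l) a ->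
    colact (theta a) (colact A2 (colact A1 n)) = - v^-1 *: colact A2 (colact A1 n).
  move=> ga /omega_block; rewrite val_nxt // lc => e; apply: h2 => //.
  exact: (reading_block dr' sr' ga e).
have Y0 := colact_ytheta v0 sum_sqr (@monotone_omega r (conj l)) u0' eig2.
have [c nzc ec] := colact_collapse v0 sum_sqr (@monotone_omega r l) u0 eC eig1.
have [c' ec'] := ytheta_corner_collapse v0 v_root pl c2.
have cY := corner_ytheta v0 (omega (conj l)).
have cYA := cornerM cY c2; have [_ _ eYA] := cYA; have [_ _ eY] := cY.
have [_ _ eZC] := corner_Zm_transpose eC.
case/eqP: Y0; apply: (scalerI nzc); rewrite scaler0.
rewrite -colM // -linearZ /= -ec -colM // mulrA -[_ * A2 * _]mulrA ec' -scalerAl colZ.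
by rewrite -colM // ann // scaler0.
Qed.

Theorem proj_varpi_in_ideal : in_ideal P.
Proof.
pose U (x : 'rV[K]_#|S|) := exists X, [/\ in_ideal X, corner X & x = first_row X].
have cP : corner P := corner_P r v0.
have [[X [iX cX eX]]|nU] := pselect (U (first_row P)).
  suff -> : P = X by [].
  apply: (corner_ext cP cX) => k.
  have [/existsP[s /eqP <-]|nk] := boolP [exists s, emb s == k]; last by rewrite !(@corner_support_row _ v).
  by have := congr1 (fun x : 'rV_#|S| => x 0 (enum_rank s)) eX; rewrite !mxE enum_rankK.
exfalso; have c00 : corner 0 by have := cornerZ 0 cP; rewrite scale0r.
have [||f [hf]] := separating_functional _ _ nU.
- exists 0; split; [exact: ideal0|exact: c00|].
  by apply/rowP => j; rewrite !mxE mx0.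
- move=> c x y [X [iX cX ->]] [Y [iY cY ->]]; exists (c *: X + Y); split.
  + by apply: in_idealD => //; exact: in_idealZ.
  + by apply: cornerD => //; exact: cornerZ.
  by apply/rowP => j; rewrite !mxE mxD mxZ.
pose n : V := [ffun s => f (enum_rank s) 0].
have n0 : n = 0.
  apply: annihilated_column => l C B pl eC cB.
  have cZ := corner_Zm_transpose eC; have cZB := cornerM cZ cB.
  apply/ffunP => s; rewrite [RHS]ffunE -(colact_theta_perm s (colact _ n)).
  have ct := corner_theta_perm v0 s; have [cts _ et] := ct; rewrite -colM // -first_row_colact hf ?mxE //.
  exists (theta_perm s * (Zm l * C * B)); split=> //; last exact: cornerM.
  have [cB' _ _] := cB.
  have cC := centralizes_transpose eC (@centralizes_omega K v r v0 l).
  by rewrite -[Zm l * C * B]mulrA mulrA; apply: in_ideal_gen => //; exact: centralizesM.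
case/eqP; apply/matrixP => i j; rewrite !ord1 first_row_colact -/n n0 linear0 ffunE mxE.
by [].
Qed.

End Ideal.

(** * Modules over the Schur algebra *)

Lemma In_mem (T : eqType) (x : T) s : List.In x s <-> x \in s.
Proof.
elim: s => [|y s IH] //=; rewrite inE; split=> [[->|/IH ->]|/orP[/eqP ->|/IH]]; rewrite ?eqxx ?orbT //.
  by left.
by right.
Qed.

Lemma NoDup_uniq (T : eqType) (s : seq T) : List.NoDup s <-> uniq s.
Proof.
split; elim: s => [|y s IH] //=.
- by move=> nd; inversion nd; rewrite IH // andbT; apply/negP => /In_mem.
- by move=> _; exact: List.NoDup_nil.
by case/andP=> ys us; apply: List.NoDup_cons; [move/In_mem; exact/negP|exact: IH].
Qed.

Section DirectSums.
Import Gen.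
Variables (K : fieldType) (v : K) (r : nat) (M : zmodType) (act : Mat K r -> M -> M).
Notation RF := (rfm K r).
Notation submod := (submod v act).
Notation irred := (irred v act).
Notation centralizes := (@centralizes K v r).
Hypothesis modM : Smodule v act.
Implicit Types (A B : RF) (m n : M).

Lemma act_mxD A B m : centralizes A -> centralizes B ->
  act (mx (A + B)) m = act (mx A) m + act (mx B) m.
Proof.
move=> /inS_mx cA /inS_mx cB; have [h _ _ _] := modM; rewrite -h //.
Qed.

Lemma actD A m n : centralizes A -> act (mx A) (m + n) = act (mx A) m + act (mx A) n.
Proof. by move=> /inS_mx cA; have [_ h _ _] := modM; exact: h. Qed.

Lemma act_mxM A B m : centralizes A -> centralizes B ->
  act (mx (A * B)) m = act (mx B) (act (mx A) m).
Proof. by move=> /inS_mx cA /inS_mx cB; have [_ _ h _] := modM; rewrite -h. Qed.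

Lemma act_mx1 m : act (mx (1 : RF)) m = m.
Proof.
have [_ _ _ h] := modM; exact: h.
Qed.

Lemma act0r A : centralizes A -> act (mx A) 0 = 0.
Proof. by move=> cA; apply: (addrI (act (mx A) 0)); rewrite -actD // !addr0. Qed.

Lemma act_mx0 m : act (mx (0 : RF)) m = 0.
Proof.
have c0 := @centralizes0 K v r.
by apply: (addrI (act (mx 0) m)); rewrite -act_mxD // !addr0.
Qed.

Lemma act_mxN1 m : act (mx (-1 *: 1 : RF)) m = - m.
Proof.
have c1 := @centralizes1 K v r; apply: (addrI m); rewrite subrr -{1}[m]act_mx1 -act_mxD //.
  by rewrite scaleN1r subrr act_mx0.
exact: centralizesZ.
Qed.

Lemma act_sum A (J : Type) (s : seq J) (c : J -> M) : centralizes A ->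
  act (mx A) (\sum_(j <- s) c j) = \sum_(j <- s) act (mx A) (c j).
Proof.
move=> hF; elim/big_rec2: _ => [|j x y _ <-]; [exact: act0r|exact: actD].
Qed.

Lemma submod_act N A m : submod N -> centralizes A -> N m -> N (act (mx A) m).
Proof. by case=> _ _ h /inS_mx; exact: h. Qed.

Lemma submod_neg N m : submod N -> N m -> N (- m).
Proof.
by move=> sN Nm; rewrite -act_mxN1; apply: submod_act => //; apply: centralizesZ; exact: centralizes1.
Qed.

Definition independent (F : set (set M)) := forall (s : seq (set M)) (c : set M -> M),
  uniq s -> (forall N, N \in s -> F N /\ N (c N)) -> \sum_(N <- s) c N = 0 ->
  forall N, N \in s -> c N = 0.

Definition sum_of (F : set (set M)) : M -> Prop := fun m =>
  exists (s : seq (set M)) (c : set M -> M),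
    [/\ uniq s, forall N, N \in s -> F N /\ N (c N) & m = \sum_(N <- s) c N].

Lemma sum_of_submod F : (forall N, F N -> submod N) -> submod (sum_of F).
Proof.
move=> hF; split.
- by exists [::], (fun=> 0); split; rewrite ?big_nil.
- move=> _ _ [s [c [us hs ->]]] [t [d [ut ht ->]]].
  pose e N := (if N \in s then c N else 0) + (if N \in t then d N else 0).
  exists (undup (s ++ t)), e; split; first exact: undup_uniq.
    move=> N; rewrite mem_undup mem_cat => Nst.
    have FN : F N by case/orP: Nst => [/hs|/ht] [].
    have [N0 ND _] := hF N FN; split=> //; apply: ND; case: ifP => //; [by case/hs|by case/ht].
  have ext (u : seq (set M)) (f : set M -> M) : uniq u -> {subset u <= undup (s ++ t)} ->
      \sum_(N <- u) f N = \sum_(N <- undup (s ++ t)) if N \in u then f N else 0.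
    move=> uu su; rewrite -big_mkcond -big_filter; apply: perm_big; apply: uniq_perm => //.
      by rewrite filter_uniq // undup_uniq.
    by move=> N; rewrite mem_filter; case: (boolP (N \in u)) => //= /su ->.
  rewrite big_split /= -!ext // => N; rewrite mem_undup mem_cat => ->; rewrite ?orbT //.
- move=> _ _ /inS_rfm[A cA <-] [s [c [us hs ->]]]; exists s, (fun N => act (mx A) (c N)); split=> //.
    by move=> N /hs[FN cN]; split=> //; exact: submod_act (hF N FN) _ _.
  exact: act_sum.
Qed.

Lemma sum_of_mem (F : set (set M)) N m : F N -> N m -> sum_of F m.
Proof.
move=> FN Nm; exists [:: N], (fun=> m); split=> //; last by rewrite big_seq1.
by move=> N'; rewrite inE => /eqP ->.
Qed.

Lemma independentU (F : set (set M)) N0 : independent F -> (forall N, F N -> submod N) ->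
  (forall m, N0 m -> sum_of F (- m) -> m = 0) -> independent (F `|` [set N0]).
Proof.
move=> iF sF h s c us hs sum0.
pose t := [seq N <- s | N != N0].
have ut : uniq t by exact: filter_uniq.
have ht N : N \in t -> F N /\ N (c N).
  by rewrite mem_filter => /andP[/eqP NN0 /hs[[FN|//]]].
have c0 : N0 \in s -> c N0 = 0.
  move=> N0s; have [_ Nc] := hs _ N0s; apply: h => //; exists t, c; split=> //.
  move: sum0; rewrite (bigD1_seq N0) //= => /eqP; rewrite addr_eq0 => /eqP ->.
  by rewrite opprK big_filter.
have sumt : \sum_(N <- t) c N = 0.
  have rest0 : \sum_(N <- s | ~~ (N != N0)) c N = 0.
    rewrite big_seq_cond big1 // => N.
    by case/andP=> Ns; rewrite negbK => /eqP e; move: Ns; rewrite e => /c0.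
  by rewrite big_filter -[RHS]sum0 [RHS](bigID (fun N => N != N0)) /= rest0 addr0.
move=> N Ns; have [e|ne] := eqVneq N N0; first by rewrite e c0 // -e.
by apply: (iF t c ut ht sumt); rewrite mem_filter ne.
Qed.

Theorem compred_of_sums : (forall m, sum_of irred m) -> compred v act setT.
Proof.
move=> hM.
have irrS N : irred N -> submod N by case.
pose good (F : set (set M)) := (F `<=` irred)%classic /\ independent F.
have [C sub tot|F [[FI iF] Fmax]] := @Zorn_bigcup (set M) good.
  split=> [N [F CF FN]|s c us hs sum0 N Ns]; first by case: (sub _ CF) => h _; exact: h.
  suff [F CF hF] : exists2 F, C F & forall N', N' \in s -> F N'.
    case: (sub _ CF) => _ iF; apply: (iF s c us _ sum0 N Ns) => N' N's.
    by split; [exact: hF|case: (hs _ N's)].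
  have {hs} hs N' : N' \in s -> exists2 F, C F & F N' by case/hs => -[F CF FN] _; exists F.
  have s0 : s != [::] by apply: contraTneq Ns => ->.
  elim: s s0 hs {us sum0 Ns} => // N1 s IH _ hs.
  have [F1 CF1 FN1] := hs N1 (mem_head _ _).
  have [->|sn] := eqVneq s [::]; first by exists F1 => // N'; rewrite inE => /eqP ->.
  have [|F2 CF2 h2] := IH sn; first by move=> N' N's; apply: hs; rewrite inE N's orbT.
  have [h12|h21] := tot _ _ CF1 CF2.
    by exists F2 => // N'; rewrite inE => /orP[/eqP ->|/h2 //]; exact: h12.
  by exists F1 => // N'; rewrite inE => /orP[/eqP -> //|/h2]; exact: h21.
have FS N : F N -> submod N by move=> /FI; exact: irrS.
have sS := sum_of_submod FS.
have all N : irred N -> forall m, N m -> sum_of F m.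
  move=> iN; have [[N0 ND NA] _ Nmin] := iN.
  have [s0 sD sA] := sS.
  have sP : submod (fun m => N m /\ sum_of F m).
    split=> [//|a b [Na sa] [Nb sb]|A m hA [Nm sm]]; split; auto.
  case: (Nmin _ sP (fun m => @proj1 _ _)) => [z|h m /h[]//].
  have F'F : ~ F N.
    move=> FN; have [_ [m [Nm nz]] _] := iN; apply: nz; apply: z; split=> //.
    exact: sum_of_mem Nm.
  case: (Fmax (F `|` [set N])%classic).
    split; first by move=> N' FN'; left.
    by move=> h; apply: F'F; apply: h; right.
  split=> [N' [/FI //|-> //]|].
  apply: independentU => // m Nm sm; apply: z; split=> //.
  by rewrite -[m]opprK; exact: submod_neg.
have sall m : sum_of F m.
  have [s [c [us hs ->]]] := hM m; have [s0 sD sA] := sS.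
  rewrite big_seq; elim/big_rec: _ => // N x Ns sx; apply: sD => //.
  by have [iN cN] := hs _ Ns; exact: all iN _ cN.
exists {N : set M | F N}, (fun j => sval j); split=> [[N FN]|]; first exact: FI.
have sinj : injective (fun j : {N : set M | F N} => sval j).
  by move=> [N h] [N' h'] /= e; subst N'; congr exist; exact: Prop_irrelevance.
have NDmap (s : seq {N : set M | F N}) : List.NoDup s -> uniq [seq sval j | j <- s].
  by move=> nd; apply/NoDup_uniq; exact: FinFun.Injective_map_NoDup.
split=> [m _|s c nd hs sum0 j js].
  have [s [c [us hs ->]]] := sall m.
  have lift : exists s' : seq {N : set M | F N}, [seq sval j | j <- s'] = s.
    elim: s us hs => [|N s IH] /=; first by exists [::].
    case/andP=> _ us hs; have [|s' e] := IH us.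
      by move=> N' N's; apply: hs; rewrite inE N's orbT.
    have [FN _] := hs N (mem_head _ _).
    by exists (exist _ N FN :: s'); rewrite /= e.
  have [s' es] := lift; subst s; exists s', (fun j => c (sval j)); split.
  - apply: (@List.NoDup_map_inv _ _ (fun j => sval j)); exact/NoDup_uniq.
  - move=> j js; case: (hs (sval j)) => //; apply/In_mem; exact: (List.in_map (fun j => sval j)).
  - by rewrite big_map.
pose c' N := if pselect (F N) is left h then c (exist _ N h) else 0.
have ec j' : c' (sval j') = c j'.
  rewrite /c'; case: pselect => [h|nF]; last by case: nF; exact: svalP.
  by congr c; exact: sinj.
have := iF [seq sval j | j <- s] c' (NDmap _ nd) _ _ (sval j) _; rewrite ec; apply.
- move=> N /In_mem /(List.in_map_iff (fun j => sval j)) [j' [<- j's]].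
  by rewrite ec; split; [exact: svalP|exact: hs].
- by rewrite big_map -[RHS]sum0; apply: eq_bigr => j' _; exact: ec.
- by apply/In_mem; exact: (List.in_map (fun j => sval j)).
Qed.

End DirectSums.

Lemma is_weight_content r (k : Idx r) : is_weight r (content k).
Proof.
exists (undup [seq k p | p : 'I_r]); split; first exact: undup_uniq.
- move=> x; rewrite mem_undup cards_eq0 => /set0Pn[p]; rewrite inE => /eqP <-.
  by apply: (map_f k); rewrite mem_enum.
under eq_bigr => x _ do rewrite content_sum.
rewrite exchange_big /= -[RHS]card_ord -sum1_card; apply: eq_bigr => p _.
rewrite (bigD1_seq (k p)) ?undup_uniq ?mem_undup ?(map_f k) ?mem_enum //= eqxx big1 // => x.
by rewrite eq_sym => /negbTE ->.
Qed.

Section WeylModules.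
Import Gen.
Variables (K : fieldType) (v : K) (r : nat).
Hypothesis v0 : v != 0.
Hypothesis v_root : forall n, (0 < n)%N -> v ^+ n != 1.
Hypothesis sum_sqr : forall (I : eqType) (s : seq I) (f : I -> K),
  \sum_(i <- s) f i * f i = 0 -> forall i, i \in s -> f i = 0.
Notation RF := (rfm K r).
Notation centralizes := (@centralizes K v r).
Notation corner := (@corner K v r).
Notation theta_perm := (@theta_perm K v r).
Notation collapse := (@collapse K v r).
Notation ytheta := (@ytheta K v r).
Notation Zm := (@Zm K v r).
Notation P := (proj_varpi K r).
Notation omega l := (omega r (part l)).
Notation conj l := (conj_part r l).
Notation regact := (@regact K r).
Notation Weyl l := (@Weyl K v r (part l)).
Implicit Types (H G : RF) (l : nat -> nat).

Let cZm l : centralizes (Zm l) := @centralizes_Zm K v r v0 l.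

Lemma Zm_mulE l l' H : centralizes H -> exists2 F, corner F &
  Zm l * H * Zm l' = ytheta (omega (conj l)) * (F * collapse (omega l')).
Proof.
move=> cH; have [cZ cZ'] := (cZm l, cZm l').
have [th [cth eZ]] : exists th, (forall l, corner (th l)) /\
    forall l, Zm l = ytheta (omega (conj l)) * (th l * collapse (omega l)).
  by exists (fun l => v ^+ len (wlam r (part l)) *: theta_perm (wlam r (part l))); split=> // l1;
    exact: (cornerZ _ (corner_theta_perm v0 _)).
have [c1 o1 _] := cth l; have [c2 _ e2] := cth l'.
have [cy _ _] := corner_ytheta v0 (omega (conj l')).
have cB := @centralizes_omega K v r v0 l.
exists (th l * collapse (omega l) * H * ytheta (omega (conj l')) * th l').
  split; last by rewrite -[LHS]mulrA; congr (_ * _).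
    exact: centralizesM (centralizesM (centralizesM (centralizesM c1 cB) cH) cy) c2.
  by rewrite -!mulrA; exact: on_varpiM.
by rewrite !eZ !mulrA.
Qed.

Lemma Zm_sandwich l H : partn r l -> centralizes H -> exists c, Zm l * H * Zm l = c *: Zm l.
Proof. by move=> pl cH; have [F cF ->] := Zm_mulE l l cH; exact: ytheta_corner_collapse. Qed.

Lemma Zm_mul_dominance l l' H : partn r l -> partn r l' -> centralizes H ->
  Zm l * H * Zm l' != 0 -> forall m, (ps l' m <= ps l m)%N.
Proof.
by move=> pl pl' cH; have [F cF ->] := Zm_mulE l l' cH; exact: ytheta_dominance.
Qed.

(* With [p = z g] and [p'] its transpose, [p p' z = c z], and [c <> 0] since [p p' p = c p] does
   not vanish, sums of squares being anisotropic. *)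
Lemma Zm_generated l G : partn r l -> centralizes G -> Zm l * G != 0 ->
  exists2 H, centralizes H & Zm l * G * (H * Zm l) = Zm l.
Proof.
move=> pl cG nz; have cZ := cZm l.
have op : on_varpi (Zm l * G) by apply: on_varpiM; exact: Zm_on_varpi.
have [p' ep] := on_varpi_transpose op.
have cp := centralizes_transpose ep (centralizesM cZ cG).
have [c ec] := Zm_sandwich pl (centralizesM cG cp).
have c0 : c != 0.
  apply: contraNneq (gram3_neq0 sum_sqr op ep nz) => c0.
  by rewrite -[Zm l * G * p']mulrA [_ * (Zm l * G)]mulrA ec c0 scale0r mul0r.
exists (c^-1 *: p'); first exact: centralizesZ.
by rewrite -scalerAl -scalerAr -mulrA [G * _]mulrA mulrA ec scalerA mulVf // scale1r.
Qed.

Lemma WeylE l X : partn r l -> Weyl l X <-> exists2 G, centralizes G & X = mx (Zm l * G).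
Proof.
move=> pl; split=> [[_ [Z [/inS_rfm[G cG <-] hZ ->]]]|[G cG ->]].
  by exists G => //; rewrite (is_z_unique v0 pl hZ).
by exists (mx G), (mx (Zm l)); split; [exact/inS_mx|exact: is_z_Zm|].
Qed.

Lemma regact_mx A B : regact (mx A) (mx B) = mx (B * A).
Proof. by []. Qed.

Lemma mx_addE A B : (mx A : MatZ K r) + mx B = mx (A + B).
Proof. by apply/funext => i; apply/funext => k; rewrite mxD. Qed.

Lemma mx_zeroE : (0 : MatZ K r) = mx (0 : RF).
Proof. by apply/funext => i; apply/funext => k; rewrite mx0. Qed.

Lemma mx_injE (A B : RF) : mx A = mx B -> A = B.
Proof. by move=> e; apply: mx_inj => i k; rewrite e. Qed.

Lemma Weyl_submod l : partn r l -> submod v regact (Weyl l).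
Proof.
move=> pl; split.
- by apply/WeylE => //; exists 0; [exact: centralizes0|rewrite mulr0 mx_zeroE].
- move=> _ _ /(WeylE _ pl)[G cG ->] /(WeylE _ pl)[H cH ->]; apply/WeylE => //.
  by exists (G + H); [exact: centralizesD|rewrite mulrDr mx_addE].
- move=> _ _ /inS_rfm[A cA <-] /(WeylE _ pl)[G cG ->]; apply/WeylE => //.
  by exists (G * A); [exact: centralizesM|rewrite regact_mx mulrA].
Qed.

Lemma Weyl_Zm l : partn r l -> Weyl l (mx (Zm l)).
Proof. by move=> pl; apply/WeylE => //; exists 1; [exact: centralizes1|rewrite mulr1]. Qed.

Theorem Weyl_irred l : partn r l -> irred v regact (Weyl l).
Proof.
move=> pl; split; first exact: Weyl_submod.
  exists (mx (Zm l)); split; first exact: Weyl_Zm.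
  by rewrite mx_zeroE => /mx_injE/eqP; apply/negP; exact: Zm_neq0.
move=> N [N0 ND NA] NW; have [z|] := pselect (forall m, N m -> m = 0); [by left|right].
case/existsNP: b => X /not_implyP[NX X0] _ /(WeylE _ pl)[G' cG' ->].
have [G cG eX] := (WeylE X pl).1 (NW _ NX); subst X.
have [|H cH <-] := Zm_generated pl cG.
  by apply: contra_notN X0 => /eqP ->; rewrite mx_zeroE.
rewrite -mulrA -regact_mx; apply: NA => //; apply/inS_mx.
exact: centralizesM (centralizesM cH (cZm l)) cG'.
Qed.

Lemma kproj_factor_or_zero lam : (forall i k, @kproj K r lam i k = 0) \/
  exists C B : RF, [/\ centralizes C, centralizes B, on_varpi B & mx (C * B) = @kproj K r lam].
Proof.
have [[i <-]|no] := pselect (exists i : Idx r, content i = lam); last first.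
  by left=> i k; rewrite /kproj; case: pselect => // e; case: no; exists i.
right; have [s ms] := exists_monotone i; apply: (kproj_factor v0 sum_sqr ms) => j; split=> [e|[t <-]].
  by apply: same_content; rewrite content_idxM.
by rewrite !content_idxM.
Qed.

Definition KP lam : RF := diag_rf (fun i => (content i == lam)%:R).

Lemma mx_KP lam : mx (KP lam) = @kproj K r lam.
Proof.
apply/funext => i; apply/funext => k; rewrite mx_diag /kproj.
by case: pselect => [->|/eqP/negbTE ->]; rewrite ?eqxx ?mul1r ?mul0r.
Qed.

Lemma mx_MKP lam (A : RF) i k : mx (A * KP lam) i k = mx A i k * (content k == lam)%:R.
Proof. exact: mx_Mdiag. Qed.

Lemma mx_sumZ (J : Type) (s : seq J) (c : J -> MatZ K r) i k :
  (\sum_(j <- s) c j) i k = \sum_(j <- s) c j i k.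
Proof. by elim/big_rec2: _ => [//|j x y _ <-]. Qed.

Theorem Weyl_weightmod l : partn r l -> weightmod regact (Weyl l).
Proof.
move=> pl; split=> [_ /(WeylE _ pl)[G cG ->]|s c /NoDup_uniq us hs sum0 lam /In_mem sl].
  pose X := Zm l * G; have oX : on_varpi X by apply: on_varpiM; exact: Zm_on_varpi.
  pose supp i := xget [::] [set t : seq (Idx r) | forall k, mx X i k != 0 -> k \in t].
  have hsupp i k : mx X i k != 0 -> k \in supp i.
    rewrite /supp; case: xgetP => [t -> h|no]; first exact: h.
    by have [t [_ ht]] := rowfin_seq i (svalP X); case: (no t).
  pose ks := flatten [seq supp (emb s) | s : {perm 'I_r}].
  exists (undup [seq content k | k <- ks]), (fun lam => regact (@kproj K r lam) (mx X)); split.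
  - by apply/NoDup_uniq; exact: undup_uniq.
  - move=> lam /In_mem; rewrite mem_undup => /mapP[k _ ->]; split; first exact: is_weight_content.
    by exists (mx X); split=> //; apply/WeylE => //; exists G.
  apply/funext => i; apply/funext => k; rewrite mx_sumZ.
  under eq_bigr => lam _ do rewrite -mx_KP regact_mx mx_MKP.
  have [->|nz] := eqVneq (mx X i k) 0; first by rewrite big1 // => lam _; rewrite mul0r.
  rewrite (bigD1_seq (content k)) ?undup_uniq //=.
    by rewrite eqxx mulr1 big1 ?addr0 // => lam; rewrite eq_sym => /negbTE ->; rewrite mulr0.
  rewrite mem_undup; apply: map_f; apply/flattenP; exists (supp i); last exact: hsupp.
  have [/existsP[t /eqP <-]|ni] := boolP [exists t, emb t == i].
    by apply: (map_f (fun t => supp (emb t))); rewrite mem_enum.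
  by case/eqP: nz; exact: oX.
have cE lam' i k : lam' \in s -> content k != lam' -> c lam' i k = 0.
  move/In_mem/hs => [_ [_ [/(WeylE _ pl)[G cG ->] ->]]] ne.
  by rewrite -mx_KP regact_mx mx_MKP (negbTE ne) mulr0.
apply/funext => i; apply/funext => k.
have [e|ne] := eqVneq (content k) lam; last by rewrite cE.
have := congr1 (fun X : MatZ K r => X i k) sum0; rewrite mx_sumZ (bigD1_seq lam) //= big_seq_cond.
by rewrite big1 ?addr0 // => lam' /andP[s' ne]; rewrite cE // e eq_sym.
Qed.

Theorem Weyl_iso_inj l l' : partn r l -> partn r l' ->
  iso v regact (Weyl l) regact (Weyl l') -> part l = part l'.
Proof.
move=> pl pl' [phi [phiD phiW phi_inj phi_sur phi_act]].
have [cZ cZ'] := (cZm l, cZm l').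
have unitZ l1 : partn r l1 -> exists2 H, centralizes H & Zm l1 * (H * Zm l1) = Zm l1.
  move=> p1; have [|H cH e] := Zm_generated p1 (@centralizes1 K v r).
    by rewrite mulr1; exact: Zm_neq0.
  by exists H => //; rewrite -{1}[Zm l1]mulr1.
have Znz l1 : partn r l1 -> mx (Zm l1) <> 0 :> MatZ K r.
  by move=> p1; rewrite mx_zeroE => /mx_injE/eqP; apply/negP; exact: Zm_neq0.
have W0 : Weyl l 0 by case: (Weyl_submod pl).
have phi0 : phi 0 = 0 by apply: (addrI (phi 0)); rewrite -phiD // !addr0.
have d1 m : (ps l m <= ps l' m)%N.
  have [G cG eG] := (WeylE _ pl').1 (phiW _ (Weyl_Zm pl)).
  have [H cH eH] := unitZ l pl; apply: (Zm_mul_dominance pl' pl (centralizesM cG cH)).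
  apply/eqP => e0; apply: (Znz l pl); apply: phi_inj; [exact: Weyl_Zm|exact: W0|].
  rewrite phi0 -eH -regact_mx phi_act; [|exact/inS_mx/centralizesM|exact: Weyl_Zm].
  by rewrite eG regact_mx mulrA -[_ * H]mulrA e0 mx_zeroE.
have d2 m : (ps l' m <= ps l m)%N.
  have [X [WX eX]] := phi_sur _ (Weyl_Zm pl'); have [G cG eG] := (WeylE _ pl).1 WX; subst X.
  have [H cH eH] := unitZ l' pl'; apply: (Zm_mul_dominance pl pl' (centralizesM cG cH)).
  apply/eqP => e0; apply: (Znz l' pl'); rewrite -eH -regact_mx -eX.
  rewrite -phi_act; [|exact/inS_mx/centralizesM|exact: WX].
  by rewrite regact_mx mulrA -[_ * H]mulrA e0 -mx_zeroE.
by congr part; apply/funext; exact: dominance_antisym.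
Qed.

Section Modules.
Variables (M : zmodType) (act : Mat K r -> M -> M).
Hypothesis modM : Smodule v act.
Implicit Types m : M.

Definition orbit_Zm l m : set M := [set n | exists2 G, centralizes G & n = act (mx (Zm l * G)) m].

Lemma orbit_Zm_submod l m : submod v act (orbit_Zm l m).
Proof.
have cZ := cZm l; split.
- by exists 0; [exact: centralizes0|rewrite mulr0 (act_mx0 modM)].
- move=> _ _ [G cG ->] [H cH ->]; exists (G + H); first exact: centralizesD.
  by rewrite mulrDr (act_mxD modM _ (centralizesM cZ cG) (centralizesM cZ cH)).
- move=> _ _ /inS_rfm[A cA <-] [G cG ->]; exists (G * A); first exact: centralizesM.
  by rewrite mulrA (act_mxM modM _ (centralizesM cZ cG) cA).
Qed.

Lemma orbit_Zm_gen l m : orbit_Zm l m (act (mx (Zm l)) m).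
Proof. by exists 1; [exact: centralizes1|rewrite mulr1]. Qed.

Lemma act_Weyl_submod l m (N : M -> Prop) : partn r l -> submod v act N ->
  submod v regact (fun X => Weyl l X /\ N (act X m)).
Proof.
move=> pl sN; have [N0 ND NA] := sN; have [W0 WD WA] := Weyl_submod pl; have cZ := cZm l; split.
- by split=> //; rewrite mx_zeroE (act_mx0 modM).
- move=> X Y [WX NX] [WY NY]; split; first exact: WD.
  move: NX NY; have [G cG ->] := (WeylE X pl).1 WX; have [H cH ->] := (WeylE Y pl).1 WY.
  by rewrite mx_addE (act_mxD modM _ (centralizesM cZ cG) (centralizesM cZ cH)); exact: ND.
- move=> F X hF [WX NX]; split; first exact: WA.
  move: NX; have [G cG ->] := (WeylE X pl).1 WX; have [A cA eA] := inS_rfm hF.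
  rewrite -eA regact_mx (act_mxM modM _ (centralizesM cZ cG) cA).
  by move=> NX; rewrite eA; exact: NA.
Qed.

Lemma act_Weyl_inj l m : partn r l -> act (mx (Zm l)) m <> 0 ->
  forall G, centralizes G -> act (mx (Zm l * G)) m = 0 -> Zm l * G = 0.
Proof.
move=> pl nz G cG e0; have c0 : submod v act (fun n => n = 0).
  split=> [//|_ _ -> ->|_ _ /inS_rfm[A cA <-] ->]; first by rewrite addr0.
  by rewrite (act0r modM).
have [_ _ /(_ _ (act_Weyl_submod m pl c0))] := Weyl_irred pl; case=> [X []//|h|h].
  by apply: mx_injE; rewrite -mx_zeroE; apply: h; split=> //; apply/WeylE => //; exists G.
by case: nz; case: (h _ (Weyl_Zm pl)).
Qed.

Lemma orbit_Zm_irred l m : partn r l -> act (mx (Zm l)) m <> 0 -> irred v act (orbit_Zm l m).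
Proof.
move=> pl nz; split; first exact: orbit_Zm_submod.
  by exists (act (mx (Zm l)) m); split=> //; exact: orbit_Zm_gen.
move=> N sN NO; have [_ _ /(_ _ (act_Weyl_submod m pl sN))] := Weyl_irred pl; case=> [X []//|h|h].
  left=> n Nn; have [G cG e] := NO _ Nn; rewrite e.
  suff -> : mx (Zm l * G) = 0 :> MatZ K r by rewrite mx_zeroE (act_mx0 modM).
  by apply: h; split; [apply/WeylE => //; exists G|rewrite -e].
by right=> _ [G cG ->]; have [|] := h (mx (Zm l * G)); first by apply/WeylE => //; exists G.
Qed.

Definition Zm_orbits : set (set M) :=
  [set N | exists l m, [/\ partn r l, act (mx (Zm l)) m <> 0 & N = orbit_Zm l m]].

Lemma Zm_orbits_irred N : Zm_orbits N -> irred v act N.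
Proof. by case=> l [m [pl nz ->]]; exact: orbit_Zm_irred. Qed.

Lemma sum_of_proj_varpi m : sum_of Zm_orbits (act (mx P) m).
Proof.
have sS : submod v act (sum_of Zm_orbits).
  by apply: (sum_of_submod modM) => N /Zm_orbits_irred[].
have [S0 SD _] := sS.
suff [] : centralizes P /\ sum_of Zm_orbits (act (mx P) m) by [].
elim: (proj_varpi_in_ideal r v0 v_root sum_sqr) => [|l a b X pl ca cb _ [cX IH]].
  by split; [exact: centralizes0|rewrite (act_mx0 modM)].
have cZ := cZm l; have caZ := centralizesM ca cZ; have cazb := centralizesM caZ cb.
split; first exact: centralizesD.
rewrite (act_mxD modM) // (act_mxM modM) // (act_mxM modM) //; apply: SD => //.
apply: (submod_act sS) => //.
have [->|/eqP nz] := eqVneq (act (mx (Zm l)) (act (mx a) m)) 0; first exact: S0.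
by apply: sum_of_mem (orbit_Zm_gen l _); exists l, (act (mx a) m).
Qed.

Lemma sum_of_weightmod : weightmod act setT -> forall m, sum_of Zm_orbits m.
Proof.
move=> [wM _] m.
have sS : submod v act (sum_of Zm_orbits).
  by apply: (sum_of_submod modM) => N /Zm_orbits_irred[].
have [S0 SD _] := sS.
have [//|s [c [_ hs ->]]] := wM m.
have {}hs j : List.In j s -> sum_of Zm_orbits (c j).
  move/hs => [_ [n [_ ->]]]; have [z|[C [B [cC cB oB <-]]]] := kproj_factor_or_zero j.
    have -> : @kproj K r j = mx (0 : RF) by apply/funext => i; apply/funext => k; rewrite z mx0.
    by rewrite (act_mx0 modM).
  have cP := @centralizes_proj_varpi K v r v0; rewrite (act_mxM modM) //.
  rewrite -((proj_varpi_mul _).1 oB) (act_mxM modM) //; apply: (submod_act sS) => //.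
  exact: sum_of_proj_varpi.
elim: s hs => [|j s IH] hs; first by rewrite big_nil.
by rewrite big_cons; apply: SD; [apply: hs; left|apply: IH => j' h; apply: hs; right].
Qed.

Theorem weightmod_compred : weightmod act setT -> compred v act setT.
Proof.
move=> wM; apply: (compred_of_sums modM) => m.
have [s [c [us hs ->]]] := sum_of_weightmod wM m; exists s, c; split=> // N /hs[/Zm_orbits_irred].
by [].
Qed.

Theorem irred_weightmod_Weyl : irred v act setT -> weightmod act setT ->
  exists2 l, partn r l & iso v act setT regact (Weyl l).
Proof.
move=> [_ [m0 [_ m0nz]] irrM] wM.
have [l [m [pl nz]]] : exists l m, partn r l /\ act (mx (Zm l)) m <> 0.
  have [[|N s] [c [us hs e]]] := sum_of_weightmod wM m0; first by case: m0nz; rewrite e big_nil.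
  by have [[l [m [pl nz _]]] _] := hs N (mem_head _ _); exists l, m.
exists l => //; have onto n : orbit_Zm l m n.
  case: (irrM _ (orbit_Zm_submod l m)) => // [h|h]; last exact: h.
  by case: nz; apply: h; exact: orbit_Zm_gen.
have cZ := cZm l.
pose phi n := xget (0 : MatZ K r) [set X | Weyl l X /\ act X m = n].
have phiP n : Weyl l (phi n) /\ act (phi n) m = n.
  rewrite /phi; case: xgetP => [X -> //|no]; have [G cG e] := onto n.
  by case: (no (mx (Zm l * G))); split=> //; apply/WeylE => //; exists G.
have phi_uniq X n : Weyl l X -> act X m = n -> X = phi n.
  move=> WX eX; have [W' e'] := phiP n; move: eX e'.
  have [G cG ->] := (WeylE X pl).1 WX; have [H cH ->] := (WeylE _ pl).1 W' => eX e'.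
  congr mx; apply/eqP; rewrite -subr_eq0 -mulrBr; apply/eqP; apply: (act_Weyl_inj pl nz).
    by rewrite -scaleN1r; apply: centralizesD => //; exact: centralizesZ.
  have cN : centralizes (- (Zm l * H)) by rewrite -scaleN1r; apply: centralizesZ; exact: centralizesM.
  rewrite mulrBr (act_mxD modM) //; last exact: centralizesM.
  rewrite eX -e' -(act_mxD modM) ?subrr ?(act_mx0 modM) //; exact: centralizesM.
have [W0 WD WA] := Weyl_submod pl.
exists phi; split=> [a b _ _|n _|n n' _ _ e|X WX|F n hF _].
- have [[Wa ea] [Wb eb]] := (phiP a, phiP b); apply/esym/phi_uniq; first exact: WD.
  move: ea eb; have [G cG ->] := (WeylE _ pl).1 Wa; have [H cH ->] := (WeylE _ pl).1 Wb.
  by rewrite mx_addE (act_mxD modM) => [-> ->||] //; exact: centralizesM.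
- by case: (phiP n).
- by have [_ <-] := phiP n; have [_ <-] := phiP n'; rewrite e.
- by exists (act X m); split=> //; exact/esym/phi_uniq.
- have [Wn en] := phiP n; apply/esym/phi_uniq; first exact: WA.
  rewrite -[in RHS]en; have [G cG ->] := (WeylE _ pl).1 Wn; have [A cA <-] := inS_rfm hF.
  by rewrite regact_mx (act_mxM modM) //; exact: centralizesM.
Qed.

End Modules.

End WeylModules.

(** * The ground field *)

Section RationalFunctions.
Import Num.Theory.
Local Open Scope quotient_scope.

Lemma fraction_numden (R : idomainType) (x : {fraction R}) :
  exists n d : R, d != 0 /\ x * FracField.tofrac d = FracField.tofrac n.
Proof.
elim/quotW: x => x; exists (frac x).1, (frac x).2; split; first exact: denom_ratioP.
rewrite !piE; apply/eqmodP; rewrite /= FracField.equivfE /FracField.mulf.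
have d0 := denom_ratioP x.
by rewrite !numden_Ratio ?mulr1 ?mulf_neq0 ?oner_neq0 // mulrC.
Qed.

Lemma common_denominator (R : idomainType) (I : eqType) (s : seq I) (f : I -> {fraction R}) :
  exists (d : R) (p : I -> R), d != 0 /\
    forall i, i \in s -> f i * FracField.tofrac d = FracField.tofrac (p i).
Proof.
elim: s => [|i s [d [p [d0 hp]]]]; first by exists 1, (fun=> 0); split; first exact: oner_neq0.
have [n [e [e0 hn]]] := fraction_numden (f i).
exists (d * e), (fun j => if j == i then n * d else p j * e); split; first by rewrite mulf_neq0.
move=> j; rewrite inE; case: eqVneq => [-> _|_ /= js].
  by rewrite !tofracM mulrCA hn mulrC.
by rewrite !tofracM mulrA hp.
Qed.

Lemma poly_sum_sqr_eq0 (R : realFieldType) (I : eqType) (s : seq I) (p : I -> {poly R}) :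
  \sum_(i <- s) p i * p i = 0 -> forall i, i \in s -> p i = 0.
Proof.
move=> e i si; apply/eqP/negPn/negP => nz.
pose rs := [seq n%:R | n <- iota 0 (size (p i))] : seq R.
have : (size rs < size (p i))%N.
  apply: max_poly_roots nz _ _; last first.
    by rewrite map_inj_uniq ?iota_uniq // => m n /eqP; rewrite eqr_nat => /eqP.
  apply/allP => x _; have := congr1 (fun q => q.[x]) e.
  rewrite horner_sum horner0 => /eqP; rewrite psumr_eq0; last first.
    by move=> j _; rewrite hornerM -expr2 sqr_ge0.
  by move/allP => /(_ i si) /=; rewrite hornerM mulf_eq0 orbb.
by rewrite size_map size_iota ltnn.
Qed.

Lemma K_sum_sqr_eq0 (I : eqType) (s : seq I) (f : I -> K) :
  \sum_(i <- s) f i * f i = 0 -> forall i, i \in s -> f i = 0.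
Proof.
move=> e; have [d [p [d0 hp]]] := common_denominator s f.
pose D : K := FracField.tofrac d.
have D0 : D != 0 by rewrite /D tofrac_eq0.
have ep : \sum_(i <- s) p i * p i = 0.
  apply/eqP; rewrite -tofrac_eq0 rmorph_sum /=; apply/eqP.
  transitivity (D * D * \sum_(i <- s) f i * f i); last by rewrite e mulr0.
  rewrite mulr_sumr !big_seq; apply: eq_bigr => i si.
  by rewrite tofracM -hp // -/D; ring.
move=> i si; apply: (mulIf D0); rewrite mul0r /D hp //.
by rewrite (poly_sum_sqr_eq0 ep si) tofrac0.
Qed.

Lemma v_neq0 : v != 0. Proof. by rewrite /v tofrac_eq0 polyX_eq0. Qed.

Lemma v_root n : (0 < n)%N -> v ^+ n != 1.
Proof.
move=> n0; rewrite /v -tofracXn -tofrac1 tofrac_eq; apply/eqP => /(congr1 (fun p : {poly rat} => size p)).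
by rewrite size_polyXn size_poly1 => -[e]; rewrite e in n0.
Qed.

End RationalFunctions.

Lemma weight_modules_over_field (K : fieldType) (v : K) (r : nat) : v != 0 ->
  (forall n, (0 < n)%N -> v ^+ n != 1) ->
  (forall (I : eqType) (s : seq I) (f : I -> K),
     \sum_(i <- s) f i * f i = 0 -> forall i, i \in s -> f i = 0) ->
  ( (forall mu, is_partition r mu ->
        Gen.irred v (@Gen.regact K r) (@Gen.Weyl K v r mu) /\
        Gen.weightmod (@Gen.regact K r) (@Gen.Weyl K v r mu))
    /\ (forall mu nu, is_partition r mu -> is_partition r nu ->
          Gen.iso v (@Gen.regact K r) (@Gen.Weyl K v r mu) (@Gen.regact K r) (@Gen.Weyl K v r nu) ->
          mu = nu)
    /\ (forall (M : zmodType) (act : Gen.Mat K r -> M -> M),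
          Gen.Smodule v act -> Gen.irred v act setT -> Gen.weightmod act setT ->
          exists mu, is_partition r mu /\
            Gen.iso v act setT (@Gen.regact K r) (@Gen.Weyl K v r mu)) )
  /\
  (forall (M : zmodType) (act : Gen.Mat K r -> M -> M),
      Gen.Smodule v act -> Gen.weightmod act setT -> Gen.compred v act setT).
Proof.
move=> v0 v_root sum_sqr; split; last by move=> M act modM; exact: weightmod_compred v0 v_root sum_sqr M act modM.
split; first by move=> _ /is_partition_part[l pl ->]; split; [exact: Weyl_irred|exact: Weyl_weightmod].
split=> [_ _ /is_partition_part[l pl ->] /is_partition_part[l' pl' ->]|M act modM irrM wM].
  exact: Weyl_iso_inj.
have [l pl h] := irred_weightmod_Weyl v0 v_root sum_sqr modM irrM wM.
by exists (part l); split=> //; exact: part_is_partition.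
Qed.

Theorem theorem10p8 (r : nat) :
  (* (1) mu |-> W(infty,mu) is a bijection from Lambda^+(r) onto the
         isomorphism classes of irreducible weight S(infty,r)-modules *)
  ( (forall mu, is_partition r mu ->
        irred (@regact r) (@Weyl r mu) /\ weightmod (@regact r) (@Weyl r mu))
    /\ (forall mu nu, is_partition r mu -> is_partition r nu ->
          iso (@regact r) (@Weyl r mu) (@regact r) (@Weyl r nu) -> mu = nu)
    /\ (forall (M : zmodType) (act : Mat r -> M -> M),
          Smodule act -> irred act setT -> weightmod act setT ->
          exists mu, is_partition r mu /\ iso act setT (@regact r) (@Weyl r mu)) )
  /\
  (* (2) every weight S(infty,r)-module is completely reducible *)
  (forall (M : zmodType) (act : Mat r -> M -> M),
      Smodule act -> weightmod act setT -> compred act setT).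
Proof.
exact: (@weight_modules_over_field K v r v_neq0 v_root K_sum_sqr_eq0).
Qed.
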